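(* Let $n\ge 1$ and let $\mathcal N=(N_1,\ldots,N_n)$ be a Grassmann necklace in $\binom{[n]}{r}$. Then the exterior $\mathcal{O}ut(\mathcal N)$ is a pure system, and its rank is equal to the number of alignments of the permutation $\pi=\pi(\mathcal N)$ corresponding to $\mathcal N$.
   Context: $[n]=\{1,\ldots,n\}$, regarded as $\mathbb Z$ modulo $n$; $\binom{[n]}{r}$ is the set of $r$-element subsets of $[n]$. For $i\in[n]$, $<_i$ is the cyclically shifted order $i<_i i+1<_i\cdots<_i n<_i 1<_i\cdots<_i i-1$. For $X,Y\in\binom{[n]}{r}$, write $X\ll_i Y$ if $x<_i y$ for all $x\in X-Y$ and $y\in Y-X$. $X$ and $Y$ are (weakly) separated, written $X\|Y$, if $X\ll_j Y$ for some $j\in[n]$. A system $\mathcal X\subseteq\binom{[n]}{r}$ is separated if $X\|Y$ for all $X,Y\in\mathcal X$. A system $\mathcal D\subseteq\binom{[n]}{r}$ is pure if all inclusion-wise maximal separated subsystems of $\mathcal D$ have the same size; this size is called the rank of $\mathcal D$. A (Grassmann) necklace in $\binom{[n]}{r}$ is a family $\mathcal N=(N_1,\ldots,N_n)$ of sets in $\binom{[n]}{r}$ such that $N_{i+1}\supseteq N_i-\{i\}$ for each $i$ (indices modulo $n$). Standing assumption: $i\in N_i$ for every $i\in[n]$. Then $N_{i+1}=(N_i-\{i\})\cup\{\pi(i)\}$ for a unique element $\pi(i)$ (possibly $\pi(i)=i$), and $\pi=\pi(\mathcal N):[n]\to[n]$ is a permutation, the permutation corresponding to $\mathcal N$. The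 interior of $\mathcal N$ is $\mathcal{I}nt(\mathcal N)=\{X\in\binom{[n]}{r} : N_i\ll_i X \text{ for every } i\in[n]\}$. Put $\mathcal S(\mathcal N)=\{X\in\binom{[n]}{r} : X\|N_i \text{ for all } i\in[n]\}$. One has $\mathcal{I}nt(\mathcal N)\subseteq\mathcal S(\mathcal N)$, and the exterior of $\mathcal N$ is $\mathcal{O}ut(\mathcal N)=\mathcal S(\mathcal N)\setminus\mathcal{I}nt(\mathcal N)$. An alignment of a permutation $\pi$ of $[n]$ is an ordered pair $(i,j)$ of elements of $[n]$ such that $\pi^{-1}(i),\,i,\,j,\,\pi^{-1}(j)$ occur in this cyclic order, where $j=\pi(j)$ is allowed but $i=\pi(i)$ is not; that is, with $p=\pi^{-1}(i)$ and $q=\pi^{-1}(j)$, one has $p<_p i<_p j\le_p q$. *)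

(* Defs.v *)
From mathcomp Require Import all_boot.
From mathcomp Require Import perm fingroup.

Set Implicit Arguments.
Unset Strict Implicit.
Unset Printing Implicit Defensive.

(* [n] is 'I_n, i.e. the labels 0, ..., n-1 instead of 1, ..., n; the cyclic
   successor i + 1 modulo n is ordS i. *)

Section CyclicOrder.

Variable n : nat.
Implicit Types (i x y : 'I_n).

(* Number of steps from i to x along the cycle: i, i+1, ..., i-1 are sent to
   0, 1, ..., n-1, so <_i compares these values. *)
Definition cyc_pos i x : nat := (x + (n - i)) %% n.

Definition cyc_lt i x y : bool := cyc_pos i x < cyc_pos i y.

Definition cyc_le i x y : bool := cyc_pos i x <= cyc_pos i y.

End CyclicOrder.

Section Separation.

Variable n : nat.
Implicit Types (X Y : {set 'I_n}) (C D : {set {set 'I_n}}).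

(* X <<_i Y and X || Y below are only ever used for sets X, Y of the same
   cardinality r. *)
Definition sep_at (i : 'I_n) X Y : bool :=
  [forall x in X :\: Y, forall y in Y :\: X, cyc_lt i x y].

Definition sep X Y : bool := [exists j : 'I_n, sep_at j X Y].

Definition separated_system C : bool :=
  [forall X in C, forall Y in C, sep X Y].

Definition max_separated D C : bool :=
  maxset (fun C' : {set {set 'I_n}} => (C' \subset D) && separated_system C') C.

Definition pure D : Prop :=
  forall C1 C2, max_separated D C1 -> max_separated D C2 -> #|C1| = #|C2|.

(* Meaningful when D is pure, in which case it is the common size of all the
   maximal separated subsystems (rank_pure). *)
Definition rank D : nat := \max_(C | max_separated D C) #|C|.

Lemma rank_pure D C : pure D -> max_separated D C -> #|C| = rank D.
Proof.
move=> pD mC; apply/eqP; rewrite eqn_leq; apply/andP; split.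
  by rewrite /rank (bigD1 C) //= leq_maxl.
by apply/bigmax_leqP => C' mC'; rewrite (pD _ _ mC' mC).
Qed.

End Separation.

(* The last field is the convention that i belongs to N_i for every i. *)
Record necklace (n r : nat) := Necklace {
  neck_set :> 'I_n -> {set 'I_n};
  neck_card : forall i, #|neck_set i| = r;
  neck_step : forall i, neck_set i :\ i \subset neck_set (ordS i);
  neck_mem : forall i, i \in neck_set i
}.

Section Necklace.

Variables n r : nat.
Implicit Type N : necklace n r.

Lemma neck_cardS N (i j : 'I_n) : #|N j| = #|N i :\ i|.+1.
Proof.
have -> : #|N j| = #|N i| by rewrite !neck_card.
by rewrite (cardsD1 i) neck_mem.
Qed.

Lemma neck_next_uniq N (i : 'I_n) :
  exists! k, N (ordS i) = k |: (N i :\ i).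
Proof.
have cD : #|N (ordS i) :\: (N i :\ i)| = 1.
  by rewrite cardsD (setIidPr (neck_step N i)) (neck_cardS _ i) subSnn.
have /cards1P[k Dk] : #|N (ordS i) :\: (N i :\ i)| == 1 by rewrite cD.
exists k; split=> [|k' Dk'].
  by rewrite -Dk setUC -{1}(setID (N (ordS i)) (N i :\ i)) (setIidPr (neck_step N i)).
apply/eqP; rewrite eq_sym -in_set1 -Dk Dk' inE setU11 andbT.
apply/negP => k'N; have := neck_cardS N i (ordS i).
by rewrite Dk' (setUidPr _) ?sub1set // => /eqP; rewrite eqn_leq ltnn andbF.
Qed.

(* The unique element pi(i) such that N_{i+1} = (N_i - {i}) U {pi(i)}; the
   default value i is never used (neck_nextE). *)
Definition neck_next N (i : 'I_n) : 'I_n :=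
  odflt i [pick k | N (ordS i) == k |: (N i :\ i)].

Lemma neck_nextE N (i : 'I_n) : N (ordS i) = neck_next N i |: (N i :\ i).
Proof.
rewrite /neck_next; case: pickP => [k /eqP //|noK].
by have [k [/eqP]] := neck_next_uniq N i; rewrite noK.
Qed.

Lemma neck_next_inj N : injective (neck_next N).
Proof.
have nextN i : neck_next N i \notin N i :\ i.
  apply/negP => kN; have := neck_cardS N i (ordS i).
  rewrite neck_nextE (setUidPr _) ?sub1set // => /eqP.
  by rewrite eqn_leq ltnn andbF.
move=> i j eq_ij; set k := neck_next N i.
have step l : (k \in N (ordS l)) + (l == k) = (k \in N l) + (neck_next N l == k).
  have := nextN l; rewrite neck_nextE !inE (eq_sym k (neck_next N l)).
  rewrite (eq_sym k l).
  have [->|] := eqVneq (neck_next N l) k; have [<-|] := eqVneq l k;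
    by rewrite ?neck_mem //=; case: (k \in N l).
have : \sum_l ((k \in N (ordS l)) + (l == k)) =
       \sum_l ((k \in N l) + (neck_next N l == k)) by apply: eq_bigr.
rewrite !big_split /= [X in _ = X + _](reindex_inj (@ordS_inj n)) /=.
move/addnI; rewrite (bigD1 k) //= eqxx big1 => [|l /negPf-> //].
have [//|ne_ij] := eqVneq i j.
by rewrite (bigD1 i) //= eqxx (bigD1 j) 1?eq_sym //= -eq_ij eqxx.
Qed.

Definition neck_perm N : {perm 'I_n} := perm (@neck_next_inj N).

Lemma neck_permE N (i : 'I_n) : N (ordS i) = neck_perm N i |: (N i :\ i).
Proof. by rewrite permE neck_nextE. Qed.

Definition Int N : {set {set 'I_n}} :=
  [set X : {set 'I_n} | (#|X| == r) && [forall i, sep_at i (N i) X]].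

Definition Sep N : {set {set 'I_n}} :=
  [set X : {set 'I_n} | (#|X| == r) && [forall i, sep X (N i)]].

Definition Out N : {set {set 'I_n}} := Sep N :\: Int N.

End Necklace.

(* With p = s^-1(i) and q = s^-1(j): p <_p i <_p j <=_p q, so j may be a fixed
   point of s but i may not. *)
Definition alignments n (s : {perm 'I_n}) : {set 'I_n * 'I_n} :=
  [set ij : 'I_n * 'I_n |
    let: (i, j) := ij in let p := (s^-1)%g i in let q := (s^-1)%g j in
    [&& cyc_lt p p i, cyc_lt p i j & cyc_le p j q]].

(* Main.v *)
Require Import Defs.
From mathcomp Require Import all_boot.
From mathcomp Require Import perm fingroup.
From mathcomp Require Import zify.

Set Implicit Arguments.
Unset Strict Implicit.
Unset Printing Implicit Defensive.

(** Two sets are separated iff no four elements, read around the circle, lie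
    alternately in X \ Y and Y \ X.

    Every maximal separated system of r-sets has r(n-r)+1 members.  Indeed such
    a system has at most r(n-r)+1 members, and it extends to a maximal separated
    system D of subsets of [n] of arbitrary sizes.  For all a, b, e the system D
    contains a cube { K U T : T subset of {a, b, e} }; hence all sets of size at
    most 3 are strongly shattered, and |D| >= sum_(i <= 3) C(n, i), which is the
    sum of all the r(n-r)+1, so that equality holds on each level.

    To find the cubes, fix a and b.  The squares in directions a, b form a chain
    once the arc from a to b is complemented.  Suppose two consecutive squares
    K0 < K1 differ by a set E of at least two elements.  A set S between them
    fits all V in D iff S \ K0 satisfies certain implications f -> g,
    f /\ h -> g and g -> f \/ h between elements of E.  The closure of an extreme
    element of E under the first two kinds satisfies the third kind too, and it
    is not E for one of the two extreme elements: this gives a square in between.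
    The rules of inference between implications involve two sets V, V' and at
    most five elements; they are decided by exploring a finite automaton.

    For a necklace, every interior set is separated from every exterior set: if
    X and Y cross, N_j <<_j Y propagates from j to j+1 or creates an obstruction
    which itself propagates around the circle, and a finite automaton again checks
    the transition.  So maximal systems B in Int and C in Out add up to
    r(n-r)+1.  Finally |B| = r(n-r)+1 - #alignments: exchanging pi(i-1) and pi(i)
    when pi(i) <_i pi(i-1) adds one set to the interior and removes one alignment,
    and when no exchange is possible the interior contains all r-sets. *)

(** * Alternation of sign words *)

(** The alternation criterion makes sense for sets of different sizes, where it is known as chord
    separation. This is what allows leaving the level of r-sets: each level by itself is only
    bounded from above, and the lower bound is obtained for all levels at once. Automata are needed
    because n is arbitrary and any number of positions may lie between the few named elements. Such
    a stretch matters only through its sign changes, and counting these up to four blocks is a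
    finite state. Implications have at most three elements because a crossing has four points: when
    all of them lie in E, one can be replaced by a, whose sign is free. Separation from K0 forces a
    premise and separation from K1 a conclusion, which leaves exactly the three shapes. Extreme
    elements of E matter because an implication with two elements on the same side of the third
    reduces to an arc; the closure argument starts or ends at such an element. *)

(* [None] is the sign zero.  The code of a word records its number of sign
   changes and its first sign: 0 = no sign, 1 = "+", 2 = "-", 3 = "+-",
   4 = "-+", 5 = "+-+", 6 = "-+-", 7 = at least four alternating blocks. *)
Definition astep (s : option bool) (c : nat) : nat :=
  match s with
  | None => c
  | Some true => match c with 0 => 1 | 2 => 3 | 4 => 5 | 6 => 7 | _ => c end
  | Some false => match c with 0 => 2 | 1 => 4 | 3 => 6 | 5 => 7 | _ => c end
  end.

Definition code (w : seq (option bool)) : nat := foldr astep 0 w.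

Definition cross (w : seq (option bool)) : bool := code w == 7.

Fixpoint alternating (s : bool) (k : nat) : seq (option bool) :=
  if k is k'.+1 then Some s :: alternating (~~ s) k' else [::].

Lemma code_le7 w : code w <= 7.
Proof.
elim: w => //= s w; move: (code w) => c.
by case: s => [[]|]; do 8!case: c => [//|c].
Qed.

(** Length, capped at 3, of the longest alternating subword starting with [s]. The cap is forced by
    code 7, which forgets its first sign: four blocks contain three alternating signs starting with
    either one. *)
Definition max_alt (s : bool) (c : nat) : nat :=
  nth 0 (if s then [:: 0; 1; 0; 2; 1; 3; 2; 3] else [:: 0; 0; 1; 1; 2; 2; 3; 3]) c.

Lemma subseq_alternating s k w : k <= 3 ->
  subseq (alternating s k) w = (k <= max_alt s (code w)).
Proof.
elim: w s k => [|x w IH] s [|k] //= k3; first by rewrite /max_alt; case: s.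
have k2 : k <= 3 by apply: leq_trans k3.
have := code_le7 w; move: (IH (~~ s) k k2) (IH s k.+1 k3) => /=.
case: x => [x|] /=; last by move=> _ ->.
have -> : (Some s == Some x) = (s == x) by [].
case: eqP => [<-|/eqP sx] => [-> _|_ ->].
  move: (code w) => c; case: s {IH k2}; move: k k3 => [|[|[|k]]] // _;
  by move: c => [|[|[|[|[|[|[|[|c]]]]]]]].
have {sx} -> : x = ~~ s by move: sx; case: s {IH}; case: x.
move: (code w) => c; case: s {IH k2}; move: k k3 => [|[|[|k]]] // _;
by move: c => [|[|[|[|[|[|[|[|c]]]]]]]].
Qed.

Lemma crossE w :
  cross w = subseq (alternating true 4) w || subseq (alternating false 4) w.
Proof.
elim: w => [//|x w IH]; have c7 := code_le7 w.
have Ht : subseq (alternating true 3) w = (3 <= max_alt true (code w)).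
  exact: subseq_alternating.
have Hf : subseq (alternating false 3) w = (3 <= max_alt false (code w)).
  exact: subseq_alternating.
case: x => [x|]; last exact: IH.
move: IH Ht Hf; rewrite /cross /=.
have -> : (Some true == Some x) = x by case: x.
have -> : (Some false == Some x) = ~~ x by case: x.
case: x => /=.
  move=> IH _ ->; have [->|c6] := eqVneq (code w) 7; first by [].
  move: IH; rewrite (negPf c6) => /esym/norP[_ /negPf->].
  by move: (code w) c7 c6 => [|[|[|[|[|[|[|[|c]]]]]]]].
move=> IH -> _; have [->|c6] := eqVneq (code w) 7; first by rewrite orbT.
move: IH; rewrite (negPf c6) => /esym/norP[/negPf-> _].
by move: (code w) c7 c6 => [|[|[|[|[|[|[|[|c]]]]]]]].
Qed.

(** * Deciding properties of words by reachability *)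

(** Sets of automaton states stored by prefix, so that membership stays cheap when the checks are
    computed. *)
Inductive trie := Trie of bool & seq trie.

Definition trie0 := Trie false [::].

Fixpoint trie_mem (k : seq nat) (t : trie) : bool :=
  match k, t with
  | [::], Trie b _ => b
  | x :: k', Trie _ ts => trie_mem k' (nth trie0 ts x)
  end.

Fixpoint trie_add (k : seq nat) (t : trie) : trie :=
  match k, t with
  | [::], Trie _ ts => Trie true ts
  | x :: k', Trie b ts =>
      Trie b (set_nth trie0 ts x (trie_add k' (nth trie0 ts x)))
  end.

Fixpoint trie_all (P : seq nat -> bool) (t : trie) : bool :=
  let: Trie b ts := t in
  (b ==> P [::]) &&
  (fix children i ts := match ts with
     | [::] => true
     | t' :: ts' => trie_all (fun k => P (i :: k)) t' && children i.+1 ts'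
     end) 0 ts.

Lemma trie_allP P t k : trie_all P t -> trie_mem k t -> P k.
Proof.
elim: k P t => [|x k IH] P [b ts] /=; first by case/andP=> /implyP.
case/andP=> _; rewrite -[x in P (x :: _)]add0n; move: 0 => i.
have mem0 k' : trie_mem k' trie0 = false by elim: k' => //= y k' IHk; case: y.
elim: ts x i => [|t ts IHts] [|x] i /=; rewrite ?mem0 //.
  by case/andP=> tP _; rewrite addn0; apply: (IH (fun k' => P (i :: k'))).
by case/andP=> _; rewrite addnS -addSn; apply: IHts.
Qed.

(* A product of automata reading words over [L] from right to left, all with
   initial state [0].  A component [c] turns a letter [l] into an action
   [act c l], which [c] executes by [exec c].  A word is discarded as soon as
   one of the first components, the guards, reaches its dead state. *)
Record component (L : Type) := Component {
  act : L -> nat;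
  exec : nat -> nat -> nat;
  dead : nat
}.

Section Automaton.

Variables (L : eqType) (letters : seq L) (guards tracks : seq (component L)).

Definition feed (c : component L) (w : seq L) : nat :=
  foldr (fun l => exec c (act c l)) 0 w.

Definition run (w : seq L) : seq nat :=
  [seq feed c w | c <- guards] ++ [seq feed c w | c <- tracks].

Fixpoint tracks_step (cs : seq (component L)) (s x : seq nat) : seq nat :=
  match cs, s, x with
  | c :: cs', i :: s', j :: x' => exec c j i :: tracks_step cs' s' x'
  | _, _, _ => [::]
  end.

Fixpoint guards_step (cs : seq (component L)) (s x : seq nat) : option (seq nat) :=
  match cs, s, x with
  | c :: cs', i :: s', j :: x' =>
      let y := exec c j i in
      if eqn y (dead c) then None
      else if guards_step cs' s' x' is Some s'' then Some (y :: s'') else None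
  | _, _, _ => Some (tracks_step tracks s x)
  end.

Definition actions (l : L) : seq nat :=
  [seq act c l | c <- guards] ++ [seq act c l | c <- tracks].

Definition visit (acc : trie * seq (seq nat)) (s : option (seq nat)) :=
  if s is Some s then
    if trie_mem s acc.1 then acc else (trie_add s acc.1, s :: acc.2)
  else acc.

Definition explore_round (xs : seq (seq nat)) (acc : trie * seq (seq nat)) :=
  foldl (fun acc s => foldl (fun acc x => visit acc (guards_step guards s x))
    acc xs) (acc.1, [::]) acc.2.

(** The exploration need not be trusted: the resulting set is tested to contain the initial state
    and to be closed under steps, so 200 is mere fuel. Letters with equal actions are merged, which
    is why [act] is kept apart from [exec]. *)
Definition verify (fin : seq nat -> bool) : bool :=
  let s0 := run [::] in
  let xs := undup [seq actions l | l <- letters] in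
  let t := (iter 200 (explore_round xs) (trie_add s0 trie0, [:: s0])).1 in
  trie_mem s0 t &&
  trie_all (fun s => if fin s then all (fun x =>
    if guards_step guards s x is Some s' then trie_mem s' t else true) xs else false) t.

Definition alive (w : seq L) : bool := all (fun c => feed c w != dead c) guards.

Hypothesis guards_absorbing :
  all (fun c => all (fun l => exec c (act c l) (dead c) == dead c) letters) guards.

Lemma run_cons l w : alive (l :: w) ->
  guards_step guards (run w) (actions l) = Some (run (l :: w)).
Proof.
rewrite /alive /run /actions; elim: guards => [_|c cs IH] /=.
  by congr Some; elim: tracks => //= c cs ->.
case/andP=> /negPf cl /IH->.
by have -> : eqn (exec c (act c l) (feed c w)) (dead c) = false := cl.
Qed.

Lemma alive_cons l w : l \in letters -> alive (l :: w) -> alive w.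
Proof.
move=> lL; have := guards_absorbing; rewrite /alive.
elim: guards => //= c cs IH /andP[/allP/(_ l lL)/eqP cP csP] /andP[cl].
move/(IH csP) => ->; rewrite andbT.
by apply: contraNneq cl => ->; rewrite cP.
Qed.

Theorem verifyP fin w :
  verify fin -> all (mem letters) w -> alive w -> fin (run w).
Proof.
rewrite /verify; set xs := undup _; set t := fst _; case/andP=> t0 tall wL gd.
suff /(trie_allP tall) : trie_mem (run w) t by case: ifP.
elim: w wL gd => [//|l w IH] /= /andP[lL wL] gd.
have := trie_allP tall (IH wL (alive_cons lL gd)).
case: ifP => // _ /allP/(_ (actions l)); rewrite mem_undup map_f // run_cons //.
exact.
Qed.

End Automaton.

(** * Words of pairs of sets *)

Definition sdiff (x y : bool) : option bool := if x == y then None else Some x.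

(* A letter [(m, (v, v', k))] describes a position of the circle, read from the
   mark 1, for two sets V, V' and a reference set K: the marks 1 and [last] are
   the positions a, b of which K is free, the other marks are free positions of
   E, and [m = 0] is a position where K is fixed. *)
Section Marked.

Variable last : nat.

Definition letter := (nat * (bool * bool * bool))%type.

Definition lset (second : bool) (l : letter) : bool :=
  let: (_, (v, v', _)) := l in if second then v' else v.

Definition wsign (test : bool * seq (option bool)) (l : letter) : option bool :=
  let v := lset test.1 l in
  if l.1 == 0 then sdiff v l.2.2
  else if (l.1 == 1) || (l.1 == last) then Some v
  else match nth None test.2 l.1 with
       | Some s => if v == s then Some s else None
       | None => None
       end.

(** Roles describing the two given squares: no marked element is present in K0, and all of them are
    present in K1. Separation from both is known and serves as a guard. *)
Definition all_plus (second : bool) := (second, nseq last (Some true)).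
Definition all_minus (second : bool) := (second, nseq last (Some false)).

(** Reading goes from right to left, so the marks must arrive as [last], ..., 2, 1. The state counts
    them, and 99 lies beyond every value of [last] in use. *)
Definition stage : component letter :=
  Component (fun l => l.1) (fun m c =>
    if m == 0 then c else if m + c == last then c.+1 else 99) 99.

Definition sign_component (f : letter -> option bool) : component letter :=
  Component (fun l => match f l with None => 0 | Some true => 1 | Some false => 2 end)
    (fun x => astep (match x with 0 => None | 1 => Some true | _ => Some false end)) 7.

Definition pair_guards : seq (component letter) :=
  [:: stage;
      sign_component (fun l => sdiff (lset false l) (lset true l));
      sign_component (wsign (all_plus false)); sign_component (wsign (all_minus false));
      sign_component (wsign (all_plus true)); sign_component (wsign (all_minus true))].

(** A hypothesis is applied only with its premises outside the set and its conclusions inside, so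
    letters contradicting this can be left out. *)
Definition consistent (hyps : seq (bool * seq (option bool))) (l : letter) : bool :=
  all (fun t => if nth None t.2 l.1 is Some s then lset t.1 l == s else true) hyps.

Definition letters (hyps : seq (bool * seq (option bool))) : seq letter :=
  [seq l <- [seq (m, (b.1.1, b.1.2, b.2)) |
    m <- iota 0 last.+1,
    b <- [seq (b, k) | b <- [seq (v, v') | v <- [:: true; false], v' <- [:: true; false]],
          k <- [:: true; false]]] | consistent hyps l].

(* The conclusions are guards: words satisfying one of them are discarded. *)
Definition guards_of (concls : seq (bool * seq (option bool))) :=
  pair_guards ++ [seq sign_component (wsign t) | t <- concls].

(** Contrapositive form: if the known separations hold and no conclusion crosses, then some
    hypothesis does not cross. Dropping 6 + [size concls] entries skips [pair_guards] and the
    conclusions and leaves the states of the hypotheses. *)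
Definition pair_check hyps concls : bool :=
  verify (letters hyps) (guards_of concls) [seq sign_component (wsign t) | t <- hyps]
    (fun s => (nth 0 s 0 == last) ==> has (fun c => c != 7) (drop (6 + size concls) s)).

(* Lets conversion compare checks by unfolding them instead of running them. *)
Strategy expand [pair_check].

Lemma guards_of_absorbing hyps concls : last < 99 ->
  all (fun c => all (fun l => exec c (act c l) (dead c) == dead c) (letters hyps))
    (guards_of concls).
Proof.
move=> last99.
have absorb f : all (fun l => exec (sign_component f) (act (sign_component f) l) 7 == 7)
    (letters hyps).
  by apply/allP => l _ /=; case: (f l) => [[]|].
rewrite all_cat; apply/andP; split; last first.
  by rewrite all_map; apply/allP => t _; exact: absorb.
apply/andP; split; last by do 5![apply/andP; split; first exact: absorb].
apply/allP => l _ /=; case: ifP => // _; case: ifP => // /eqP E.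
by move: last99; rewrite -E ltnNge leq_addl.
Qed.

Lemma feed_sign f w : feed (sign_component f) w = code [seq f l | l <- w].
Proof. by elim: w => //= l w ->; case: (f l) => [[]|]. Qed.

Theorem pair_checkP hyps concls (w : seq letter) :
  pair_check hyps concls -> last < 99 ->
  all (fun l : letter => l.1 <= last) w -> all (consistent hyps) w ->
  [seq m <- [seq l.1 | l <- w] | m != 0] = iota 1 last ->
  ~~ cross [seq sdiff (lset false l) (lset true l) | l <- w] ->
  (forall v, ~~ cross [seq wsign (all_plus v) l | l <- w]) ->
  (forall v, ~~ cross [seq wsign (all_minus v) l | l <- w]) ->
  all (fun t => cross [seq wsign t l | l <- w]) hyps ->
  has (fun t => cross [seq wsign t l | l <- w]) concls.
Proof.
move=> chk last99 wle wcons stg dif plus minus Hh; apply/negPn/negP => nC.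
have wstg : feed stage w = last.
  suff: forall d, [seq m <- [seq l.1 | l <- w] | m != 0] = iota (last - d).+1 d ->
    d <= last -> feed stage w = d.
    by apply => //; rewrite subnn.
  elim: w {wle wcons stg dif plus minus Hh nC} => [[|d]|l w IH d] //=.
  case: eqP => [l0|/eqP l0] /=; first exact: IH.
  case: d => [|d] //= [lE wE] dlast; rewrite (IH d) 1?ltnW //.
    by rewrite lE subnSK // subnK 1?ltnW // eqxx.
  by rewrite wE subnSK.
have wL : all (mem (letters hyps)) w.
  apply/allP => -[m [[v v'] k]] lw; rewrite /= mem_filter (allP wcons _ lw).
  apply/allpairsP; exists (m, (v, v', k)); split; last by [].
    by rewrite mem_iota ltnS (allP wle _ lw).
  by case: v {lw}; case: v'; case: k.
have al : alive (guards_of concls) w.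
  rewrite /alive all_cat /= wstg !feed_sign -!/(cross _) dif !plus !minus.
  rewrite (ltn_eqF last99) all_map; apply/allP => t tc /=.
  by rewrite feed_sign; apply: contra nC => ct; apply/hasP; exists t.
have := verifyP (guards_of_absorbing hyps concls last99) chk wL al.
rewrite /= wstg eqxx /= drop_size_cat; last by rewrite !size_map.
rewrite -map_comp has_map => /hasP[t th] /=; rewrite feed_sign => /negP[].
exact: (allP Hh).
Qed.

End Marked.

Definition roles (minus plus : seq nat) : seq (option bool) :=
  [seq if m \in minus then Some false else if m \in plus then Some true else None
  | m <- iota 0 10].

(** * Separation as absence of crossings *)

Section Circle.

Variable n : nat.
Implicit Types (b c x y : 'I_n) (X Y : {set 'I_n}).

Lemma cyc_posE b x : cyc_pos b x = if b <= x then x - b else x + n - b.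
Proof.
have bn := ltn_ord b; have xn := ltn_ord x; rewrite /cyc_pos; case: (leqP b x) => bx.
  have -> : x + (n - b) = n + (x - b) by lia.
  by rewrite modnDl modn_small //; lia.
by rewrite modn_small; lia.
Qed.

Lemma cyc_pos_lt b x : cyc_pos b x < n.
Proof. by rewrite ltn_pmod //; apply: leq_ltn_trans (ltn_ord b). Qed.

Lemma cyc_posxx b : cyc_pos b b = 0.
Proof. by rewrite cyc_posE leqnn subnn. Qed.

Lemma cyc_pos_inj b : injective (cyc_pos b).
Proof.
move=> x y; have := ltn_ord b; have := ltn_ord x; have := ltn_ord y.
rewrite !cyc_posE => ? ? ? e; apply/val_inj; move: e => /=.
by case: (leqP b x); case: (leqP b y); lia.
Qed.

Lemma cyc_pos_rebase b c x :
  cyc_pos b c <= cyc_pos b x /\ cyc_pos b c + cyc_pos c x = cyc_pos b x \/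
  cyc_pos b x < cyc_pos b c /\ cyc_pos b c + cyc_pos c x = cyc_pos b x + n.
Proof.
have := ltn_ord b; have := ltn_ord x; have := ltn_ord c; rewrite !cyc_posE => ? ? ?.
by case: (leqP c x); case: (leqP b c); case: (leqP b x); lia.
Qed.

Lemma cyc_ltxx b x : cyc_lt b x x = false.
Proof. exact: ltnn. Qed.

Lemma cyc_lt_trans b : transitive (cyc_lt b).
Proof. by move=> y x z; exact: ltn_trans. Qed.

Definition around b : seq 'I_n := sort (relpre (cyc_pos b) leq) (enum 'I_n).

Lemma around_uniq b : uniq (around b).
Proof. by rewrite sort_uniq enum_uniq. Qed.

Lemma mem_around b x : x \in around b.
Proof. by rewrite mem_sort mem_enum. Qed.

Lemma around_sorted b : sorted (cyc_lt b) (around b).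
Proof.
suff: sorted ltn [seq cyc_pos b x | x <- around b] by rewrite sorted_map.
rewrite ltn_sorted_uniq_leq (map_inj_uniq (@cyc_pos_inj b)) around_uniq.
by rewrite sorted_map sort_sorted // => x y; exact: leq_total.
Qed.

Lemma around_filter b (s : seq 'I_n) :
  sorted (cyc_lt b) s -> [seq x <- around b | x \in s] = s.
Proof.
move=> ss; apply: (irr_sorted_eq (@cyc_lt_trans b) (@cyc_ltxx b)) => // [|x].
  exact: (sorted_filter (@cyc_lt_trans b)) (around_sorted b).
by rewrite mem_filter mem_around andbT.
Qed.

Definition alternates b (f : 'I_n -> option bool) (s : bool) (x1 x2 x3 x4 : 'I_n) :=
  [&& cyc_lt b x1 x2, cyc_lt b x2 x3 & cyc_lt b x3 x4] /\
  [/\ f x1 = Some s, f x2 = Some (~~ s), f x3 = Some s & f x4 = Some (~~ s)].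

Lemma cross_aroundP b f :
  reflect (exists s x1 x2 x3 x4, alternates b f s x1 x2 x3 x4)
          (cross [seq f x | x <- around b]).
Proof.
rewrite crossE; apply: (iffP idP) => [ss|[s [x1 [x2 [x3 [x4 [xs [e1 e2 e3 e4]]]]]]]].
  have [s /subseqP[m _ em]] :
      exists s, subseq (alternating s 4) [seq f x | x <- around b].
    by case/orP: ss; [exists true|exists false].
  move: em; rewrite -map_mask.
  have := subseq_sorted (@cyc_lt_trans b) (mask_subseq m (around b)) (around_sorted b).
  case: (mask m _) => [|x1 [|x2 [|x3 [|x4 [|x5 t]]]]] //= xs [e1 e2 e3 e4].
  exists s, x1, x2, x3, x4; rewrite /alternates -e1 -e2 -e3 -e4 negbK.
  by move: xs; rewrite andbT.
suff : subseq (alternating s 4) [seq f x | x <- around b].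
  by case: (s) => ->; rewrite ?orbT.
have -> : alternating s 4 = [seq f x | x <- [:: x1; x2; x3; x4]].
  by rewrite /= e1 e2 e3 e4 negbK.
by apply: map_subseq; rewrite -(@around_filter b [:: x1; x2; x3; x4]) ?filter_subseq //= andbT.
Qed.

(** Moving the base point rotates the four points; since 4 is even they still alternate, possibly
    from the opposite sign. The cases count the points that precede the new base point. *)
Lemma cross_around_rebase b c f :
  cross [seq f x | x <- around b] = cross [seq f x | x <- around c].
Proof.
suff imp d e : cross [seq f x | x <- around d] -> cross [seq f x | x <- around e].
  by apply/idP/idP; exact: imp.
case/cross_aroundP=> s [x1 [x2 [x3 [x4 [/and3P[l1 l2 l3] [e1 e2 e3 e4]]]]]].
apply/cross_aroundP; move: l1 l2 l3; rewrite /cyc_lt.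
have R x := cyc_pos_rebase d e x; have N := cyc_pos_lt d.
have := N x1; have := N x2; have := N x3; have := N x4; have := N e.
have := R x1; have := R x2; have := R x3; have := R x4.
move=> R4 R3 R2 R1 ? ? ? ? ? l1 l2 l3.
have [h1|h1] := leqP (cyc_pos d e) (cyc_pos d x1).
  exists s, x1, x2, x3, x4; split; last by split.
  by rewrite /cyc_lt; apply/and3P; split; lia.
have [h2|h2] := leqP (cyc_pos d e) (cyc_pos d x2).
  exists (~~ s), x2, x3, x4, x1; split; last by split; rewrite ?negbK.
  by rewrite /cyc_lt; apply/and3P; split; lia.
have [h3|h3] := leqP (cyc_pos d e) (cyc_pos d x3).
  exists s, x3, x4, x1, x2; split; last by split; rewrite ?negbK.
  by rewrite /cyc_lt; apply/and3P; split; lia.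
have [h4|h4] := leqP (cyc_pos d e) (cyc_pos d x4).
  exists (~~ s), x4, x1, x2, x3; split; last by split; rewrite ?negbK.
  by rewrite /cyc_lt; apply/and3P; split; lia.
exists s, x1, x2, x3, x4; split; last by split.
by rewrite /cyc_lt; apply/and3P; split; lia.
Qed.

Definition crossing b X Y := cross [seq sdiff (x \in X) (x \in Y) | x <- around b].

Lemma sdiffP X Y s x : (sdiff (x \in X) (x \in Y) == Some s) =
  if s then x \in X :\: Y else x \in Y :\: X.
Proof.
by rewrite /sdiff !inE; case: (x \in X); case: (x \in Y); case: s.
Qed.

Lemma crossing_sym b X Y : crossing b X Y = crossing b Y X.
Proof.
suff imp X' Y' : crossing b X' Y' -> crossing b Y' X' by apply/idP/idP; exact: imp.
case/cross_aroundP=> s [x1 [x2 [x3 [x4 [l [e1 e2 e3 e4]]]]]].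
apply/cross_aroundP; exists (~~ s), x1, x2, x3, x4; split=> //.
have E x t : sdiff (x \in X') (x \in Y') = Some t ->
             sdiff (x \in Y') (x \in X') = Some (~~ t).
  by rewrite /sdiff; case: (x \in X'); case: (x \in Y') => // [[<-]].
by rewrite !(E _ _ e1, E _ _ e2, E _ _ e3, E _ _ e4).
Qed.

Lemma sep_at_crossing i b X Y : sep_at i X Y -> ~~ crossing b X Y.
Proof.
move=> sp; rewrite /crossing (cross_around_rebase b i); apply/negP.
case/cross_aroundP=> s [x1 [x2 [x3 [x4 [/and3P[l1 l2 l3] []]]]]].
move=> /eqP + /eqP + /eqP + /eqP; rewrite !sdiffP.
have {sp} H x y : x \in X :\: Y -> y \in Y :\: X -> cyc_lt i x y.
  by move=> xX yY; have /forall_inP/(_ _ xX)/forall_inP/(_ _ yY) := sp.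
case: s => /= h1 h2 h3 h4.
  by have := H _ _ h3 h2; move: l2; rewrite /cyc_lt; lia.
by have := H _ _ h2 h1; move: l1; rewrite /cyc_lt; lia.
Qed.

(** For the converse take y in Y \ X and j in X \ Y with the shortest arc from y to j. If, seen from
    j, some z of Y \ X precedes some x of X \ Y, then x cannot lie on that arc, so j, z, x, y
    alternate. *)
Lemma sepE b X Y : sep X Y = ~~ crossing b X Y.
Proof.
apply/existsP/idP => [[i]|nc]; first exact: sep_at_crossing.
have [X0|/set0Pn[x0 x0X]] := eqVneq (X :\: Y) set0.
  by exists b; apply/forall_inP => x; rewrite X0 inE.
have [Y0|/set0Pn[y0 y0Y]] := eqVneq (Y :\: X) set0.
  by exists b; apply/forall_inP => x _; apply/forall_inP => y; rewrite Y0 inE.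
have P0 : [pred p : 'I_n * 'I_n | (p.1 \in X :\: Y) && (p.2 \in Y :\: X)] (x0, y0).
  by rewrite /= x0X y0Y.
case: (arg_minnP (fun p => cyc_pos p.2 p.1) P0) => -[j y] /= /andP[jX yY] mn.
exists j; apply/forall_inP => x xX; apply/forall_inP => z zY.
apply: contraR nc; rewrite /cyc_lt -leqNgt => zx.
rewrite /crossing (cross_around_rebase b j); apply/cross_aroundP.
have ne u v : u \in X :\: Y -> v \in Y :\: X -> u <> v.
  by rewrite !inE => /andP[uY _] /andP[_ vY] uv; rewrite uv vY in uY.
have ne' u v : u \in X :\: Y -> v \in Y :\: X -> cyc_pos j u <> cyc_pos j v.
  by move=> uX vY /cyc_pos_inj; exact: ne.
have mn' : cyc_pos y j <= cyc_pos y x.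
  by apply: (mn (x, y)); rewrite /= xX yY.
have := cyc_pos_rebase j y x; have := cyc_pos_rebase j y j.
have := ne' _ _ jX zY; have := ne' _ _ xX zY; have := ne' _ _ xX yY; have := ne' _ _ jX yY.
have := cyc_pos_lt j x; have := cyc_pos_lt j y; rewrite cyc_posxx => ? ? ? ? ? ? E1 E2.
exists true, j, z, x, y; split; first by rewrite /cyc_lt cyc_posxx; apply/and3P; split; lia.
by split; apply/eqP; rewrite sdiffP.
Qed.

Lemma sepC X Y : sep X Y = sep Y X.
Proof.
case: (pickP {: 'I_n}) => [b _|n0]; first by rewrite !(sepE b) crossing_sym.
by apply/existsP/existsP => -[i]; have := n0 i.
Qed.

Lemma sepxx X : 0 < n -> sep X X.
Proof.
move=> n0; apply/existsP; exists (Ordinal n0); apply/forall_inP => x.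
by rewrite setDv inE.
Qed.

Lemma sep_alternates b X Y x1 x2 x3 x4 s :
  sep X Y -> alternates b (fun x => sdiff (x \in X) (x \in Y)) s x1 x2 x3 x4 -> False.
Proof.
rewrite (sepE b) => /negP nc a; apply: nc; apply/cross_aroundP.
by exists s, x1, x2, x3, x4.
Qed.

End Circle.

(** * Refining a gap between two squares *)

Lemma code_filter (T : Type) (P : pred T) (f : T -> option bool) s :
  code [seq f x | x <- s & P x] = code [seq (if P x then f x else None) | x <- s].
Proof. by elim: s => //= x s <-; case: (P x). Qed.

Lemma cross_mono n (b : 'I_n) (P : pred 'I_n) (f g : 'I_n -> option bool) :
  (forall x s, P x -> f x = Some s -> g x = Some s) ->
  cross [seq f x | x <- around b & P x] -> cross [seq g x | x <- around b].
Proof.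
move=> fg; rewrite /cross code_filter -!/(cross _).
case/cross_aroundP=> s [x1 [x2 [x3 [x4 [l [e1 e2 e3 e4]]]]]].
have E x t : (if P x then f x else None) = Some t -> g x = Some t.
  by case: ifP => // Px /fg; apply.
by apply/cross_aroundP; exists s, x1, x2, x3, x4; split; last by split; apply: E.
Qed.

Lemma nth_roles m p i : i < 10 ->
  nth None (roles m p) i =
  if i \in m then Some false else if i \in p then Some true else None.
Proof. by move=> i10; rewrite (nth_map 0) ?size_iota ?nth_iota. Qed.

(** Two paddings, for mark 0 (an ordinary position) and mark 1 (the element b): the element of index
    i among the named ones gets mark i + 2. *)
Definition mark_roles (t : bool * (seq nat * seq nat)) :=
  (t.1, [:: None; None] ++ roles t.2.1 t.2.2).

Definition mark_valid k (t : bool * (seq nat * seq nat)) :=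
  all (fun i => i < k) (t.2.1 ++ t.2.2).

Definition check k hyps concls : bool :=
  all (mark_valid k) (hyps ++ concls) &&
  pair_check k.+2 (map mark_roles hyps) (map mark_roles concls).

(* Marks are numbered in the order from b; the boolean selects V or V'.  In the
   checks below, o lists the positions of the elements named by the pattern. *)
Definition arc_at v s t : bool * (seq nat * seq nat) := (v, ([:: s], [:: t])).
Definition and_at v f h g : bool * (seq nat * seq nat) := (v, ([:: f; h], [:: g])).
Definition or_at v g f h : bool * (seq nat * seq nat) := (v, ([:: g], [:: f; h])).

(** * Rules of inference between implications, checked by automata *)

Lemma check_and_extreme : all (fun o => let: (f, h, x) := o in
  check 3 [:: and_at false f h x] [:: arc_at false f x; arc_at false h x])
  [:: (0, 1, 2); (1, 2, 0)].
Proof. vm_cast_no_check (erefl true). Qed.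

Lemma check_or_extreme : all (fun o => let: (f, h, x) := o in
  check 3 [:: or_at false x f h] [:: arc_at false x f; arc_at false x h])
  [:: (0, 1, 2); (1, 2, 0)].
Proof. vm_cast_no_check (erefl true). Qed.

(** The four cases are the orders in which e and g lie on the same side of f, so that the walk from
    e to g turns back at f. *)
Lemma check_arc_arc_turn : all (fun o => let: (e, f, g) := o in
  check 3 [:: arc_at false e f; arc_at true f g] [:: arc_at false e g; arc_at true e g])
  [:: (0, 2, 1); (1, 2, 0); (1, 0, 2); (2, 0, 1)].
Proof. vm_cast_no_check (erefl true). Qed.

Lemma check_arc_arc_opp : all (fun o => let: (e, f) := o in
  check 2 [:: arc_at false e f; arc_at true f e] [::])
  [:: (0, 1); (1, 0)].
Proof. vm_cast_no_check (erefl true). Qed.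

(** With g between f and h, the cases place t in each of the four gaps. *)
Lemma check_and_arc : all (fun o => let: (f, g, h, t) := o in
  check 4 [:: and_at false f h g; arc_at true g t]
    [:: arc_at true f t; arc_at true h t; and_at false f h t;
        arc_at false f g; arc_at false h g])
  [:: (1, 2, 3, 0); (0, 2, 3, 1); (0, 1, 3, 2); (0, 1, 2, 3)].
Proof. vm_cast_no_check (erefl true). Qed.

Lemma check_arc_or : all (fun o => let: (f, g, h, p) := o in
  check 4 [:: or_at false g f h; arc_at true p g]
    [:: arc_at true p f; arc_at true p h; or_at false p f h;
        arc_at false g f; arc_at false g h])
  [:: (1, 2, 3, 0); (0, 2, 3, 1); (0, 1, 3, 2); (0, 1, 2, 3)].
Proof. vm_cast_no_check (erefl true). Qed.

(** Both pairs f, h and p, q straddle g; only the orders of p with f and of q with h remain open. *)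
Lemma check_and_or : all (fun o => let: (f, g, h, p, q) := o in
  check 5 [:: or_at false g f h; and_at true p q g]
    [:: or_at false p f h; or_at false q f h; and_at true p q f; and_at true p q h;
        arc_at false g f; arc_at false g h])
  [:: (0, 2, 3, 1, 4); (1, 2, 3, 0, 4); (0, 2, 4, 1, 3); (1, 2, 4, 0, 3)].
Proof. vm_cast_no_check (erefl true). Qed.

Section Gap.

Variables (n : nat) (a b : 'I_n) (D : {set {set 'I_n}}) (K0 K1 : {set 'I_n}).

Hypotheses (ab : a != b) (sepD : {in D &, forall V V', sep V V'}).
Hypotheses (aK : a \notin K1) (bK : b \notin K1) (K01 : K0 \subset K1).
Hypothesis square0 : forall T : {set 'I_n}, T \subset [set a; b] -> K0 :|: T \in D.
Hypothesis square1 : forall T : {set 'I_n}, T \subset [set a; b] -> K1 :|: T \in D.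

Let E := K1 :\: K0.

Hypothesis E_before : {in E, forall x, cyc_lt b x a}.

(* The signs of V \ S and S \ V for a set S between K0 and K1 which contains the
   elements of m and none of p, other elements of E being ignored; a and b may be
   put in S or not at will, so that they always have the sign given by V. *)
Definition csign (V : {set 'I_n}) (m p : seq 'I_n) (x : 'I_n) : option bool :=
  if x \in E then
    if x \in m then (if x \in V then None else Some false)
    else if x \in p then (if x \in V then Some true else None) else None
  else if (x == b) || (x == a) then Some (x \in V) else sdiff (x \in V) (x \in K0).

Definition clause V m p : bool := cross [seq csign V m p x | x <- around b].

Lemma E_neq x : x \in E -> (x != a) && (x != b).
Proof.
rewrite inE => /andP[_ xK]; apply/andP.
by split; apply: contraTneq xK => ->.
Qed.

(** Selects the corner of a square that is opposite to V at a and b, so that both elements carry a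
    nonzero sign, namely that of their membership in V. *)
Definition sq_other (V : {set 'I_n}) := [set a; b] :\: V.

Lemma sq_other_sub V : sq_other V \subset [set a; b].
Proof. exact: subsetDl. Qed.

Lemma a_notin0 : a \notin K0. Proof. by apply: contra aK => /(subsetP K01). Qed.
Lemma b_notin0 : b \notin K0. Proof. by apply: contra bK => /(subsetP K01). Qed.

(** All nonzero signs allowed here also occur in the comparison of V with a corner of the lower
    square: on E this means only plus signs, at elements of V. [noncross1] is the dual for the upper
    square. *)
Lemma noncross0 V (P : pred 'I_n) f : V \in D ->
  (forall x s, P x -> f x = Some s ->
    if x \in E then s && (x \in V)
    else if (x == b) || (x == a) then s == (x \in V)
    else sdiff (x \in V) (x \in K0) == Some s) ->
  ~~ cross [seq f x | x <- around b & P x].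
Proof.
move=> VD fP; have := sepD VD (square0 (sq_other_sub V)); rewrite (sepE b).
apply: contra; apply: cross_mono => x s Px /(fP _ _ Px); case: ifP => [xE|_].
  case/andP=> -> xV; move: (E_neq xE) => /andP[xa xb].
  move: xE; rewrite /sq_other !inE xV (negPf xa) (negPf xb) => /andP[/negPf-> _].
  by [].
rewrite /sq_other !inE (orbC (x == a)); case: ifP => [xab /eqP ->|xab].
  rewrite andbT /sdiff.
  have -> : (x \in K0) = false.
    by case/orP: xab => /eqP->; [exact: negPf b_notin0 | exact: negPf a_notin0].
  by case: (x \in V).
by rewrite andbF orbF => /eqP.
Qed.

Lemma noncross1 V (P : pred 'I_n) f : V \in D ->
  (forall x s, P x -> f x = Some s ->
    if x \in E then ~~ s && (x \notin V)
    else if (x == b) || (x == a) then s == (x \in V)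
    else sdiff (x \in V) (x \in K0) == Some s) ->
  ~~ cross [seq f x | x <- around b & P x].
Proof.
move=> VD fP; have := sepD VD (square1 (sq_other_sub V)); rewrite (sepE b).
apply: contra; apply: cross_mono => x s Px /(fP _ _ Px); case: ifP => [xE|xE].
  case/andP=> /negPf-> /negPf xV; move: (E_neq xE) => /andP[xa xb].
  move: xE; rewrite /sq_other !inE xV (negPf xa) (negPf xb) => /andP[_ ->].
  by [].
have xK : ((x == b) || (x == a)) = false -> (x \in K1) = (x \in K0).
  move=> _; apply/idP/idP => [x1|]; last exact: (subsetP K01).
  by move: xE; rewrite inE x1 andbT => /negbFE.
rewrite /sq_other !inE (orbC (x == a)); case: ifP => [xab /eqP ->|xab].
  rewrite andbT /sdiff.
  have -> : (x \in K1) = false by case/orP: xab => /eqP->; exact: negPf.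
  by case: (x \in V).
by rewrite andbF orbF xK // => /eqP.
Qed.

(** Otherwise all signs on E would be plus, as in the comparison with the lower square. With the
    dual [clause_plus], every implication has a premise and a conclusion. *)
Lemma clause_minus V m p : V \in D -> clause V m p -> has (fun x => (x \in E) && (x \notin V)) m.
Proof.
move=> VD; rewrite /clause -[around b](filter_predT); apply: contraTT => /hasPn mV.
apply: (noncross0 VD) => x s _; rewrite /csign.
case: ifP => [xE|_]; last by case: ifP => [_ [->]|_ ->].
case: ifP => [/mV|_]; first by rewrite xE /= negbK => ->.
by case: ifP => // _; case: ifP => // _ [<-].
Qed.

Lemma clause_plus V m p : V \in D -> clause V m p -> has (fun x => (x \in E) && (x \in V)) p.
Proof.
move=> VD; rewrite /clause -[around b](filter_predT); apply: contraTT => /hasPn mV.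
apply: (noncross1 VD) => x s _; rewrite /csign.
case: ifP => [xE|_]; last by case: ifP => [_ [->]|_ ->].
case: ifP => [_|_]; first by case: ifP => // _ [<-].
by case: ifP => [/mV|//]; rewrite xE /= => /negPf->.
Qed.

Lemma eq_clause V m p m' p' :
  {in E, forall x, csign V m p x = csign V m' p' x} -> clause V m p -> clause V m' p'.
Proof.
move=> eqE; have eq1 : csign V m p =1 csign V m' p'.
  by move=> x; have [/eqE//|xE] := boolP (x \in E); rewrite /csign (negPf xE).
by rewrite /clause (eq_map eq1).
Qed.

Definition mark_clause (V V' : {set 'I_n}) ms (t : bool * (seq nat * seq nat)) :=
  clause (if t.1 then V' else V) [seq nth b ms i | i <- t.2.1] [seq nth b ms i | i <- t.2.2].

Definition mark_mem (V V' : {set 'I_n}) ms (t : bool * (seq nat * seq nat)) :=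
  all (fun i => nth b ms i \notin if t.1 then V' else V) t.2.1 &&
  all (fun i => nth b ms i \in if t.1 then V' else V) t.2.2.

(** Passage from sets to words. Elements of E that are not named are deleted: this keeps the known
    separations and does not affect the clauses, where they have sign zero. *)
Theorem local_check V V' ms hyps concls :
  pair_check (size ms).+2 (map mark_roles hyps) (map mark_roles concls) ->
  size ms < 10 -> all (mark_valid (size ms)) (hyps ++ concls) ->
  V \in D -> V' \in D -> sorted (cyc_lt b) ms -> all (mem E) ms ->
  all (mark_mem V V' ms) hyps -> all (mark_clause V V' ms) hyps ->
  has (mark_clause V V' ms) concls.
Proof.
move=> /pair_checkP chk ms10 valid VD VD' sms /allP msE memh clh.
have ums : uniq ms by exact: sorted_uniq (@cyc_lt_trans n b) (@cyc_ltxx n b) _ sms.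
set last := (size ms).+2.
pose mark x := if x == b then 1 else if x == a then last
               else if x \in ms then (index x ms).+2 else 0.
pose P := [pred x : 'I_n | (x \notin E) || (x \in ms)].
pose L x : letter := (mark x, ((x \in V), (x \in V'), (x \in K0))).
pose w := [seq L x | x <- around b & P x].
have bE : b \notin E by apply/negP => /E_neq; rewrite eqxx andbF.
have aE : a \notin E by apply/negP => /E_neq; rewrite eqxx.
have markE x : x \in ms -> mark x = (index x ms).+2.
  move=> xm; have /andP[/negPf xa /negPf xb] := E_neq (msE _ xm).
  by rewrite /mark xa xb xm.
have markb : mark b = 1 by rewrite /mark eqxx.
have marka : mark a = last by rewrite /mark eqxx (negPf ab).
have mark_out x : x != a -> x != b -> x \notin ms -> mark x = 0.
  by move=> /negPf xa /negPf xb /negPf xm; rewrite /mark xa xb xm.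
have mark_in x : x \notin ms -> ((mark x == 0) = (x != b) && (x != a)) *
     ((mark x == 1) || (mark x == last) = (x == b) || (x == a)).
  move=> /negPf xm; rewrite /mark xm.
  by case: (x == b); case: (x == a); split; rewrite ?eqxx ?orbT.
have nthm m x : x \in ms -> all (fun i => i < size ms) m ->
    (x \in [seq nth b ms i | i <- m]) = (index x ms \in m).
  move=> xm /allP mlt; apply/mapP/idP => [[i im xi]|im]; last first.
    by exists (index x ms); rewrite ?nth_index.
  by rewrite xi index_uniq ?mlt.
have wsignE t x : mark_valid (size ms) t ->
    (if P x then wsign last (mark_roles t) (L x) else None) =
    csign (if t.1 then V' else V) [seq nth b ms i | i <- t.2.1] [seq nth b ms i | i <- t.2.2] x.
  rewrite /mark_valid all_cat => /andP[v1 v2]; rewrite /csign.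
  have [xE|xE] := boolP (x \in E); last first.
    have xm : x \notin ms by apply: contra xE => /msE.
    rewrite /P /= xE /wsign /= !(mark_in _ xm) /lset /=.
    have -> : (if t.1 then x \in V' else x \in V) = (x \in if t.1 then V' else V).
      by case: t.1.
    by case: (x == b); case: (x == a).
  rewrite /P /= xE /=; have [xm|/negPf xm] := boolP (x \in ms); last first.
    have nm m : all (fun i => i < size ms) m -> (x \in [seq nth b ms i | i <- m]) = false.
      move=> /allP mlt; apply/mapP => -[i im xi]; move/negP: xm; apply.
      by rewrite xi mem_nth ?mlt.
    by rewrite !nm.
  rewrite /wsign /= (markE _ xm) /= eqSS.
  have ix : index x ms < size ms by rewrite index_mem.
  rewrite ltn_eqF ?ltnS // (nthm _ _ xm v1) (nthm _ _ xm v2).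
  rewrite nth_roles ?(ltn_trans ix ms10) //.
  have -> : (if t.1 then x \in V' else x \in V) = (x \in if t.1 then V' else V) by case: t.1.
  case: ifP => _; first by case: (x \in _).
  by case: ifP => // _; case: (x \in _).
have clauseE t : mark_valid (size ms) t ->
    cross [seq wsign last (mark_roles t) l | l <- w] = mark_clause V V' ms t.
  move=> vt; rewrite /cross /w -map_comp code_filter; congr (code _ == 7).
  by apply: eq_map => x; exact: wsignE.
have -> : has (mark_clause V V' ms) concls =
          has (fun t => cross [seq wsign last t l | l <- w]) (map mark_roles concls).
  rewrite has_map; apply: eq_in_has => t tc /=; rewrite clauseE //.
  by apply: (allP valid); rewrite mem_cat tc orbT.
have VV v : (if v then V' else V) \in D by case: v.
have lsetE v x : lset v (L x) = (x \in if v then V' else V) by case: v.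
(* [E_before] makes a the last mark: b, the named elements and a then carry the marks 1, ..., [last]
   in this order. *)
have sms' : sorted (cyc_lt b) (b :: rcons ms a).
  have lt_b x : x != b -> cyc_lt b b x.
    move=> xb; rewrite /cyc_lt cyc_posxx lt0n; apply: contra xb => /eqP xb.
    by apply/eqP/(@cyc_pos_inj n b); rewrite xb cyc_posxx.
  rewrite /= rcons_path path_sortedE; last exact: cyc_lt_trans.
  rewrite sms andbT; apply/andP; split.
    by apply/allP => x /msE/E_neq/andP[_ /lt_b].
  case: (lastP ms) msE => [|ms' x] msE'; first exact: lt_b.
  by rewrite last_rcons; apply/E_before/msE'; rewrite mem_rcons mem_head.
apply: (chk w).
- by rewrite /last; clear -ms10; lia.
- apply/allP => _ /mapP[x _ ->] /=; rewrite /mark.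
  by do 3![case: ifP => // ?]; rewrite /last !ltnS index_size.
- apply/allP => _ /mapP[x _ ->]; apply/allP => _ /mapP[t th ->].
  have vt : mark_valid (size ms) t by apply: (allP valid); rewrite mem_cat th.
  have /andP[/allP t1 /allP t2] := allP memh _ th.
  move: vt; rewrite /mark_valid all_cat => /andP[/allP v1 /allP v2].
  rewrite lsetE /=; have [xm|xm] := boolP (x \in ms).
    rewrite (markE _ xm) /= nth_roles ?(ltn_trans _ ms10) ?index_mem //.
    case: ifP => [/t1|_]; first by rewrite nth_index // => /negPf->.
    by case: ifP => [/t2|_] //; rewrite nth_index // => ->.
  rewrite /mark (negPf xm); case: ifP => // _; case: ifP => // _.
  rewrite /= nth_roles //.
  case: ifP => [/v1|_]; first by rewrite ltnn.
  by case: ifP => [/v2|//]; rewrite ltnn.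
- rewrite -map_comp filter_map -filter_predI.
  rewrite (eq_filter (a2 := fun x => x \in b :: rcons ms a)); last first.
    move=> x; rewrite [RHS]in_cons mem_rcons in_cons /=.
    have [xm|xm] := boolP (x \in ms); first by rewrite markE // !orbT.
    rewrite (mark_in _ xm) orbF negb_and !negbK; case: eqP => [->|_] /=; first by rewrite bE.
    by case: eqP => // ->; rewrite aE.
  rewrite around_filter //.
  rewrite -[LHS]/(mark b :: [seq mark x | x <- rcons ms a]) markb map_rcons marka.
  congr (_ :: _).
  have -> : [seq mark x | x <- ms] = iota 2 (size ms).
    apply: (@eq_from_nth _ 0) => [|i]; rewrite size_map ?size_iota // => ilt.
    by rewrite (nth_map b) // markE ?mem_nth // index_uniq // nth_iota.
  by rewrite -cats1 -[[:: last]]/(iota (2 + size ms) 1)  -iotaD addn1.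
- have := sepD VD VD'; rewrite (sepE b); apply: contra; rewrite /w -map_comp.
  by apply: cross_mono => x s _ /=.
- move=> v; rewrite /w -map_comp; apply: (noncross0 (VV v)) => x s.
  rewrite /P /= /wsign lsetE /=; have [xE|xE] := boolP (x \in E).
    move=> /= xm; rewrite (markE _ xm) /= nth_nseq.
    rewrite !eqSS index_mem xm ltn_eqF ?index_mem //.
    by case: ifP => // /eqP-> [<-].
  have xm : x \notin ms by apply: contra xE => /msE.
  move=> _; rewrite !(mark_in _ xm) andbC -negb_or orbC; case: ifP => [/negbTE ->|].
    by move=> ->.
  by move=> /negbFE-> [<-].
- move=> v; rewrite /w -map_comp; apply: (noncross1 (VV v)) => x s.
  rewrite /P /= /wsign lsetE /=; have [xE|xE] := boolP (x \in E).
    move=> /= xm; rewrite (markE _ xm) /= nth_nseq.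
    rewrite !eqSS index_mem xm ltn_eqF ?index_mem //.
    by case: ifP => // /eqP-> [<-].
  have xm : x \notin ms by apply: contra xE => /msE.
  move=> _; rewrite !(mark_in _ xm) andbC -negb_or orbC; case: ifP => [/negbTE ->|].
    by move=> ->.
  by move=> /negbFE-> [<-].
by rewrite all_map; apply/allP => t th /=; rewrite clauseE ?(allP clh) //;
   apply: (allP valid); rewrite mem_cat th.
Qed.

Lemma local_has k hyps concls V V' ms : check k hyps concls -> size ms = k -> k < 10 ->
  V \in D -> V' \in D -> sorted (cyc_lt b) ms -> all (mem E) ms ->
  all (mark_mem V V' ms) hyps -> all (mark_clause V V' ms) hyps ->
  has (mark_clause V V' ms) concls.
Proof.
move=> chk sz; move: chk; rewrite /check -sz => /andP[v /local_check c] k10.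
by move/c; apply.
Qed.

(* Keeps [simpl] from running the checks. *)
Opaque check.

Definition missing (V : {set 'I_n}) x := (x \in E) && (x \notin V).
Definition present (V : {set 'I_n}) x := (x \in E) && (x \in V).

(* The implication from m (conjunctively) to p (disjunctively) imposed by some V. *)
Definition witness m p : bool :=
  [exists V in D, [&& all (missing V) m, all (present V) p & clause V m p]].

Definition arc s t := witness [:: s] [:: t].

Lemma witnessP m p :
  reflect (exists V, [/\ V \in D, all (missing V) m, all (present V) p & clause V m p])
          (witness m p).
Proof.
apply: (iffP exists_inP) => [[V VD /and3P[]]|[V [VD h1 h2 h3]]]; first by exists V.
by exists V; rewrite // h1 h2 h3.
Qed.

Lemma eq_witness m p m' p' : m =i m' -> p =i p' -> witness m p -> witness m' p'.
Proof.
move=> em ep /witnessP[V [VD h1 h2 h3]]; apply/witnessP; exists V.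
rewrite -(eq_all_r em) -(eq_all_r ep); split=> //.
by apply: eq_clause h3 => x _; rewrite /csign em ep.
Qed.

Lemma clause_witness V m p : V \in D -> all (mem E) (m ++ p) -> ~~ has (mem m) p ->
  clause V m p ->
  witness [seq x <- m | x \notin V] [seq x <- p | x \in V].
Proof.
rewrite all_cat => VD /andP[/allP mE /allP pE] /hasPn dis cl; apply/witnessP; exists V.
split=> //.
- by apply/allP => x; rewrite mem_filter /missing => /andP[-> /mE xE]; rewrite andbT.
- by apply/allP => x; rewrite mem_filter /present => /andP[-> /pE xE]; rewrite andbT.
apply: eq_clause cl => x xE; rewrite /csign xE !mem_filter.
case: (boolP (x \in m)) => [xm|_]; last by case: (x \in V); case: (x \in p).
by case: (x \in V) => //=; case: ifP => // /dis; rewrite /= xm.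
Qed.

Lemma clause_arc V s t : V \in D -> s \in E -> t \in E -> clause V [:: s] [:: t] -> arc s t.
Proof.
move=> VD sE tE cl; apply/witnessP; exists V.
have := clause_minus VD cl; have := clause_plus VD cl.
by rewrite /= /missing /present sE tE /= !orbF => -> ->.
Qed.

Lemma clause_and V f h g : V \in D -> all (mem E) [:: f; h; g] -> g \notin [:: f; h] ->
  clause V [:: f; h] [:: g] -> [|| witness [:: f; h] [:: g], arc f g | arc h g].
Proof.
move=> VD fhgE gfh cl.
have gV : g \in V by have := clause_plus VD cl; rewrite /= orbF => /andP[].
have := clause_witness VD (m := [:: f; h]) (p := [:: g]) fhgE.
rewrite /= orbF gV => /(_ gfh cl); have := clause_minus VD cl; rewrite /= orbF.
case: (f \in V); case: (h \in V); rewrite /= ?andbF // => _; rewrite /arc => ->.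
- by rewrite !orbT.
- by rewrite orbT.
by [].
Qed.

Lemma clause_or V g f h : V \in D -> all (mem E) [:: g; f; h] -> g \notin [:: f; h] ->
  clause V [:: g] [:: f; h] -> [|| witness [:: g] [:: f; h], arc g f | arc g h].
Proof.
move=> VD gfhE gfh cl.
have gV : g \notin V by have := clause_minus VD cl; rewrite /= orbF => /andP[].
have := clause_witness VD (m := [:: g]) (p := [:: f; h]) gfhE.
have -> : has (mem [:: g]) [:: f; h] = false.
  by apply: contraNF gfh; rewrite /= !inE orbF (eq_sym f) (eq_sym h).
rewrite /= gV => /(_ isT cl); have := clause_plus VD cl; rewrite /= orbF.
case: (f \in V); case: (h \in V); rewrite /= ?andbF // => _; rewrite /arc => ->.
- by [].
- by rewrite orbT.
by rewrite !orbT.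
Qed.

Lemma arc_E s t : arc s t -> [&& s \in E, t \in E & s != t].
Proof.
case/witnessP=> V []; rewrite /missing /present /= !andbT => _ /andP[-> sV] /andP[-> tV] _.
by apply: contraNneq sV => ->.
Qed.

Lemma cyc_lt_total x y : x != y -> cyc_lt b x y || cyc_lt b y x.
Proof.
move=> xy; rewrite /cyc_lt -neq_ltn; apply: contra xy => /eqP xy.
by apply/eqP/(cyc_pos_inj xy).
Qed.

Lemma arcP s t : reflect (exists V, [/\ V \in D, s \in E, t \in E, s \notin V &
    t \in V /\ clause V [:: s] [:: t]]) (arc s t).
Proof.
apply: (iffP (witnessP _ _)) => -[V] [].
  rewrite /missing /present /= !andbT => VD /andP[sE sV] /andP[tE tV] c.
  by exists V.
by move=> VD sE tE sV [tV c]; exists V; rewrite /= /missing /present sE tE sV tV.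
Qed.

Lemma pos_neq (x y : 'I_n) : x != y -> cyc_pos b x != cyc_pos b y.
Proof. by apply: contra => /eqP xy; apply/eqP/(cyc_pos_inj xy). Qed.

Lemma arc_arc_opp e f : arc e f -> arc f e -> False.
Proof.
move=> Aef; have /and3P[eE fE ef] := arc_E Aef; move: Aef.
case/arcP=> V [VD _ _ m1 [p1 c1]] /arcP[V' [V'D _ _ m2 [p2 c2]]].
have /= /and3P[/local_has loc1 /local_has loc2 _] := check_arc_arc_opp.
case/orP: (cyc_lt_total ef) => lt_ef.
  have := loc1 _ _ [:: e; f] erefl isT VD V'D.
  by rewrite /= /mark_clause /mark_mem /= lt_ef eE fE m1 p1 m2 p2 c1 c2 => /(_ isT isT isT isT).
have := loc2 _ _ [:: f; e] erefl isT VD V'D.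
by rewrite /= /mark_clause /mark_mem /= lt_ef eE fE m1 p1 m2 p2 c1 c2 => /(_ isT isT isT isT).
Qed.

Lemma arc_arc_turn e f g : arc e f -> arc f g -> cyc_lt b e f = cyc_lt b g f -> arc e g.
Proof.
move=> Aef Afg; have /and3P[eE fE ef] := arc_E Aef; have /and3P[_ gE fg] := arc_E Afg.
have eg : e != g by apply: contraTneq Afg => <-; apply/negP; exact: arc_arc_opp Aef.
move: Aef Afg => /arcP[V [VD _ _ m1 [p1 c1]]] /arcP[V' [V'D _ _ m2 [p2 c2]]] same.
have /= /and5P[/local_has loc1 /local_has loc2 /local_has loc3 /local_has loc4 _] :=
  check_arc_arc_turn.
have fin : clause V [:: e] [:: g] || clause V' [:: e] [:: g] -> arc e g.
  by case/orP; exact: clause_arc.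
have : [|| cyc_lt b e g && cyc_lt b g f, cyc_lt b g e && cyc_lt b e f,
    cyc_lt b f e && cyc_lt b e g | cyc_lt b f g && cyc_lt b g e].
  have := pos_neq eg; have := pos_neq ef; have := pos_neq fg.
  by move: same; rewrite /cyc_lt; clear; lia.
case/or4P=> /andP[l1 l2]; apply: fin.
- have := loc1 _ _ [:: e; g; f] erefl isT VD V'D.
  rewrite /= /mark_clause /mark_mem /= orbF l1 l2 eE fE gE m1 p1 m2 p2 c1 c2.
  exact.
- have := loc2 _ _ [:: g; e; f] erefl isT VD V'D.
  rewrite /= /mark_clause /mark_mem /= orbF l1 l2 eE fE gE m1 p1 m2 p2 c1 c2.
  exact.
- have := loc3 _ _ [:: f; e; g] erefl isT VD V'D.
  rewrite /= /mark_clause /mark_mem /= orbF l1 l2 eE fE gE m1 p1 m2 p2 c1 c2.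
  exact.
have := loc4 _ _ [:: f; g; e] erefl isT VD V'D.
rewrite /= /mark_clause /mark_mem /= orbF l1 l2 eE fE gE m1 p1 m2 p2 c1 c2.
exact.
Qed.

Lemma and_witnessP f h g : witness [:: f; h] [:: g] ->
  exists V, [/\ V \in D, [/\ f \in E, h \in E & g \in E],
                [/\ f \notin V, h \notin V & g \in V] & clause V [:: f; h] [:: g]].
Proof.
case/witnessP=> V []; rewrite /missing /present /= !andbT.
by move=> VD /andP[/andP[fE fV] /andP[hE hV]] /andP[gE gV] c; exists V.
Qed.

Lemma or_witnessP g f h : witness [:: g] [:: f; h] ->
  exists V, [/\ V \in D, [/\ g \in E, f \in E & h \in E],
                [/\ g \notin V, f \in V & h \in V] & clause V [:: g] [:: f; h]].
Proof.
case/witnessP=> V []; rewrite /missing /present /= !andbT.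
by move=> VD /andP[gE gV] /andP[/andP[fE fV] /andP[hE hV]] c; exists V.
Qed.

Lemma and_swap f h g : witness [:: f; h] [:: g] -> witness [:: h; f] [:: g].
Proof. by apply: eq_witness => // x; rewrite !inE orbC. Qed.

Lemma or_swap g f h : witness [:: g] [:: f; h] -> witness [:: g] [:: h; f].
Proof. by apply: eq_witness => // x; rewrite !inE orbC. Qed.

Lemma and_same_side f h x : witness [:: f; h] [:: x] -> cyc_lt b f x = cyc_lt b h x ->
  arc f x || arc h x.
Proof.
wlog fh : f h / ~~ cyc_lt b h f.
  move=> H; case: (boolP (cyc_lt b h f)) => [hf|/H//] W eq; rewrite orbC.
  by apply: H; rewrite ?(and_swap W) //; move: hf; rewrite /cyc_lt; clear; lia.
case/and_witnessP=> V [VD [fE hE xE] [m1 m2 p1] c] same.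
have [efh|nefh] := eqVneq f h.
  rewrite (_ : arc f x) //; apply: (clause_arc VD) => //.
  by apply: eq_clause c => y _; rewrite /csign -efh !inE orbb.
have fx : f != x by apply: contraNneq m1 => ->.
have hx : h != x by apply: contraNneq m2 => ->.
have /= /and3P[/local_has loc1 /local_has loc2 _] := check_and_extreme.
have fin : clause V [:: f] [:: x] || clause V [:: h] [:: x] -> arc f x || arc h x.
  by case/orP=> /(clause_arc VD) -> //; rewrite orbT.
have : [|| cyc_lt b f h && cyc_lt b h x | cyc_lt b x f && cyc_lt b f h].
  have := pos_neq fx; have := pos_neq hx; have := pos_neq nefh.
  by move: same fh; rewrite /cyc_lt; clear; lia.
case/orP=> /andP[l1 l2]; apply: fin.
- have := loc1 _ _ [:: f; h; x] erefl isT VD VD.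
  rewrite /= /mark_clause /mark_mem /= orbF l1 l2 fE hE xE m1 m2 p1 c; exact.
have := loc2 _ _ [:: x; f; h] erefl isT VD VD.
rewrite /= /mark_clause /mark_mem /= orbF l1 l2 fE hE xE m1 m2 p1 c; exact.
Qed.

Lemma or_same_side x f h : witness [:: x] [:: f; h] -> cyc_lt b f x = cyc_lt b h x ->
  arc x f || arc x h.
Proof.
wlog fh : f h / ~~ cyc_lt b h f.
  move=> H; case: (boolP (cyc_lt b h f)) => [hf|/H//] W eq; rewrite orbC.
  by apply: H; rewrite ?(or_swap W) //; move: hf; rewrite /cyc_lt; clear; lia.
case/or_witnessP=> V [VD [xE fE hE] [m1 p1 p2] c] same.
have [efh|nefh] := eqVneq f h.
  rewrite (_ : arc x f) //; apply: (clause_arc VD) => //.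
  by apply: eq_clause c => y _; rewrite /csign -efh !inE orbb.
have fx : f != x by apply: contraNneq m1 => <-.
have hx : h != x by apply: contraNneq m1 => <-.
have /= /and3P[/local_has loc1 /local_has loc2 _] := check_or_extreme.
have fin : clause V [:: x] [:: f] || clause V [:: x] [:: h] -> arc x f || arc x h.
  by case/orP=> /(clause_arc VD) -> //; rewrite orbT.
have : [|| cyc_lt b f h && cyc_lt b h x | cyc_lt b x f && cyc_lt b f h].
  have := pos_neq fx; have := pos_neq hx; have := pos_neq nefh.
  by move: same fh; rewrite /cyc_lt; clear; lia.
case/orP=> /andP[l1 l2]; apply: fin.
- have := loc1 _ _ [:: f; h; x] erefl isT VD VD.
  rewrite /= /mark_clause /mark_mem /= orbF l1 l2 fE hE xE m1 p1 p2 c; exact.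
have := loc2 _ _ [:: x; f; h] erefl isT VD VD.
rewrite /= /mark_clause /mark_mem /= orbF l1 l2 fE hE xE m1 p1 p2 c; exact.
Qed.

Lemma and_arc f g h t : cyc_lt b f g -> cyc_lt b g h -> t != f -> t != h ->
  witness [:: f; h] [:: g] -> arc g t ->
  [|| arc f t, arc h t, witness [:: f; h] [:: t], arc f g | arc h g].
Proof.
move=> fg gh tf th /and_witnessP[V [VD [fE hE gE] [m1 m2 p1] c1]].
case/arcP=> V' [V'D _ tE m3 [p3 c2]].
have tg : t != g by apply: contraTneq p3 => ->.
have fin : [|| clause V' [:: f] [:: t], clause V' [:: h] [:: t], clause V [:: f; h] [:: t],
  clause V [:: f] [:: g] | clause V [:: h] [:: g]] ->
  [|| arc f t, arc h t, witness [:: f; h] [:: t], arc f g | arc h g].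
  case/or4P=> [/(clause_arc V'D)->|/(clause_arc V'D)->|cl|/orP[] /(clause_arc VD)->] //;
    rewrite ?orbT //.
  have /or3P[|->|->] // : [|| witness [:: f; h] [:: t], arc f t | arc h t].
  - by apply: (clause_and VD _ _ cl); rewrite /= ?fE ?hE ?tE // !inE negb_or tf th.
  - by move=> ->; rewrite !orbT.
  - by rewrite orbT.
have /= /and5P[/local_has loc1 /local_has loc2 /local_has loc3 /local_has loc4 _] :=
  check_and_arc.
have : [|| cyc_lt b t f, cyc_lt b f t && cyc_lt b t g, cyc_lt b g t && cyc_lt b t h |
           cyc_lt b h t].
  have := pos_neq tf; have := pos_neq th; have := pos_neq tg.
  by move: fg gh; rewrite /cyc_lt; clear; lia.
case/or4P=> [l1|/andP[l1 l2]|/andP[l1 l2]|l1]; apply: fin.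
- have := loc1 _ _ [:: t; f; g; h] erefl isT VD V'D.
  rewrite /= /mark_clause /mark_mem /= orbF fg gh l1 fE hE gE tE m1 m2 p1 c1 m3 p3 c2; exact.
- have := loc2 _ _ [:: f; t; g; h] erefl isT VD V'D.
  rewrite /= /mark_clause /mark_mem /= orbF gh l1 l2 fE hE gE tE m1 m2 p1 c1 m3 p3 c2; exact.
- have := loc3 _ _ [:: f; g; t; h] erefl isT VD V'D.
  rewrite /= /mark_clause /mark_mem /= orbF fg l1 l2 fE hE gE tE m1 m2 p1 c1 m3 p3 c2; exact.
have := loc4 _ _ [:: f; g; h; t] erefl isT VD V'D.
rewrite /= /mark_clause /mark_mem /= orbF fg gh l1 fE hE gE tE m1 m2 p1 c1 m3 p3 c2; exact.
Qed.

Lemma arc_or f g h p : cyc_lt b f g -> cyc_lt b g h -> p != f -> p != h ->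
  witness [:: g] [:: f; h] -> arc p g ->
  [|| arc p f, arc p h, witness [:: p] [:: f; h], arc g f | arc g h].
Proof.
move=> fg gh pf ph /or_witnessP[V [VD [gE fE hE] [m1 p1 p2] c1]].
case/arcP=> V' [V'D pE _ m3 [p3 c2]].
have pg : p != g by apply: contraNneq m3 => ->.
have fin : [|| clause V' [:: p] [:: f], clause V' [:: p] [:: h], clause V [:: p] [:: f; h],
  clause V [:: g] [:: f] | clause V [:: g] [:: h]] ->
  [|| arc p f, arc p h, witness [:: p] [:: f; h], arc g f | arc g h].
  case/or4P=> [/(clause_arc V'D)->|/(clause_arc V'D)->|cl|/orP[] /(clause_arc VD)->] //;
    rewrite ?orbT //.
  have /or3P[|->|->] // : [|| witness [:: p] [:: f; h], arc p f | arc p h].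
  - by apply: (clause_or VD _ _ cl); rewrite /= ?fE ?hE ?pE // !inE negb_or pf ph.
  - by move=> ->; rewrite !orbT.
  - by rewrite orbT.
have /= /and5P[/local_has loc1 /local_has loc2 /local_has loc3 /local_has loc4 _] :=
  check_arc_or.
have : [|| cyc_lt b p f, cyc_lt b f p && cyc_lt b p g, cyc_lt b g p && cyc_lt b p h |
           cyc_lt b h p].
  have := pos_neq pf; have := pos_neq ph; have := pos_neq pg.
  by move: fg gh; rewrite /cyc_lt; clear; lia.
case/or4P=> [l1|/andP[l1 l2]|/andP[l1 l2]|l1]; apply: fin.
- have := loc1 _ _ [:: p; f; g; h] erefl isT VD V'D.
  rewrite /= /mark_clause /mark_mem /= orbF fg gh l1 fE hE gE pE m1 p1 p2 c1 m3 p3 c2; exact.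
- have := loc2 _ _ [:: f; p; g; h] erefl isT VD V'D.
  rewrite /= /mark_clause /mark_mem /= orbF gh l1 l2 fE hE gE pE m1 p1 p2 c1 m3 p3 c2; exact.
- have := loc3 _ _ [:: f; g; p; h] erefl isT VD V'D.
  rewrite /= /mark_clause /mark_mem /= orbF fg l1 l2 fE hE gE pE m1 p1 p2 c1 m3 p3 c2; exact.
have := loc4 _ _ [:: f; g; h; p] erefl isT VD V'D.
rewrite /= /mark_clause /mark_mem /= orbF fg gh l1 fE hE gE pE m1 p1 p2 c1 m3 p3 c2; exact.
Qed.

Lemma and_or f g h p q : cyc_lt b f g -> cyc_lt b g h -> cyc_lt b p g -> cyc_lt b g q ->
  p != f -> q != h -> witness [:: g] [:: f; h] -> witness [:: p; q] [:: g] ->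
  [|| witness [:: p] [:: f; h], witness [:: q] [:: f; h],
      witness [:: p; q] [:: f], witness [:: p; q] [:: h] |
      [|| arc g f, arc g h, arc p f, arc p h, arc q f | arc q h]].
Proof.
move=> fg gh pg gq pf qh /or_witnessP[V [VD [gE fE hE] [m1 p1 p2] c1]].
case/and_witnessP=> V' [V'D [pE qE _] [m3 m4 p3] c2].
have lt_neq x y : cyc_lt b x y -> (x != y) && (y != x).
  by move=> xy; rewrite (eq_sym y) andbb; apply: contraTneq xy => ->; rewrite cyc_ltxx.
have /andP[ph hp] := lt_neq _ _ (cyc_lt_trans pg gh).
have /andP[fq qf] := lt_neq _ _ (cyc_lt_trans fg gq).
have fin : [|| clause V [:: p] [:: f; h], clause V [:: q] [:: f; h],
  clause V' [:: p; q] [:: f], clause V' [:: p; q] [:: h] |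
  clause V [:: g] [:: f] || clause V [:: g] [:: h]] ->
  [|| witness [:: p] [:: f; h], witness [:: q] [:: f; h],
      witness [:: p; q] [:: f], witness [:: p; q] [:: h] |
      [|| arc g f, arc g h, arc p f, arc p h, arc q f | arc q h]].
  case/or4P=> [cl|cl|cl|/or3P[cl|/(clause_arc VD)->|/(clause_arc VD)->]] //; rewrite ?orbT //.
  - have /or3P[->|->|->] // : [|| witness [:: p] [:: f; h], arc p f | arc p h].
    + by apply: (clause_or VD _ _ cl); rewrite /= ?fE ?hE ?pE // !inE negb_or pf ph.
    + by rewrite !orbT.
    + by rewrite !orbT.
  - have /or3P[->|->|->] // : [|| witness [:: q] [:: f; h], arc q f | arc q h].
    + by apply: (clause_or VD _ _ cl); rewrite /= ?fE ?hE ?qE // !inE negb_or qf qh.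
    + by rewrite !orbT.
    + by rewrite !orbT.
    + by rewrite !orbT.
  - have /or3P[->|->|->] // : [|| witness [:: p; q] [:: f], arc p f | arc q f].
    + by apply: (clause_and V'D _ _ cl); rewrite /= ?fE ?pE ?qE // !inE negb_or eq_sym pf.
    + by rewrite !orbT.
    + by rewrite !orbT.
    + by rewrite !orbT.
  have /or3P[->|->|->] // : [|| witness [:: p; q] [:: h], arc p h | arc q h].
  + by apply: (clause_and V'D _ _ cl); rewrite /= ?hE ?pE ?qE // !inE negb_or hp eq_sym qh.
  + by rewrite !orbT.
  + by rewrite !orbT.
  + by rewrite !orbT.
have /= /and5P[/local_has loc1 /local_has loc2 /local_has loc3 /local_has loc4 _] :=
  check_and_or.
have : [|| cyc_lt b f p && cyc_lt b h q, cyc_lt b p f && cyc_lt b h q,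
           cyc_lt b f p && cyc_lt b q h | cyc_lt b p f && cyc_lt b q h].
  have := pos_neq pf; have := pos_neq qh.
  by rewrite /cyc_lt; clear; lia.
case/or4P=> /andP[l1 l2]; apply: fin.
- have := loc1 _ _ [:: f; p; g; h; q] erefl isT VD V'D.
  rewrite /= /mark_clause /mark_mem /= orbF ?fg ?gh ?pg ?gq l1 l2 fE hE gE pE qE.
  rewrite m1 p1 p2 c1 m3 m4 p3 c2; exact.
- have := loc2 _ _ [:: p; f; g; h; q] erefl isT VD V'D.
  rewrite /= /mark_clause /mark_mem /= orbF ?fg ?gh ?pg ?gq l1 l2 fE hE gE pE qE.
  rewrite m1 p1 p2 c1 m3 m4 p3 c2; exact.
- have := loc3 _ _ [:: f; p; g; q; h] erefl isT VD V'D.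
  rewrite /= /mark_clause /mark_mem /= orbF ?fg ?gh ?pg ?gq l1 l2 fE hE gE pE qE.
  rewrite m1 p1 p2 c1 m3 m4 p3 c2; exact.
have := loc4 _ _ [:: p; f; g; q; h] erefl isT VD V'D.
rewrite /= /mark_clause /mark_mem /= orbF ?fg ?gh ?pg ?gq l1 l2 fE hE gE pE qE.
rewrite m1 p1 p2 c1 m3 m4 p3 c2; exact.
Qed.

(** Reduction to the configuration assumed by [and_arc] and [and_or]: one premise on each side of
    the conclusion. *)
Lemma and_between f h g : witness [:: f; h] [:: g] ->
  [|| arc f g, arc h g, cyc_lt b f g && cyc_lt b g h | cyc_lt b h g && cyc_lt b g f].
Proof.
move=> W; have [V [_ _ [fV hV gV] _]] := and_witnessP W.
have fg : f != g by apply: contraNneq fV => ->.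
have hg : h != g by apply: contraNneq hV => ->.
have [eq|ne] := eqVneq (cyc_lt b f g) (cyc_lt b h g).
  by case/orP: (and_same_side W eq) => ->; rewrite ?orbT.
suff /orP[->|->] : cyc_lt b f g && cyc_lt b g h || cyc_lt b h g && cyc_lt b g f.
- by rewrite !orbT.
- by rewrite !orbT.
by have := pos_neq fg; have := pos_neq hg; move: ne; rewrite /cyc_lt; clear; lia.
Qed.

Lemma or_between g f h : witness [:: g] [:: f; h] ->
  [|| arc g f, arc g h, cyc_lt b f g && cyc_lt b g h | cyc_lt b h g && cyc_lt b g f].
Proof.
move=> W; have [V [_ _ [gV fV hV] _]] := or_witnessP W.
have fg : f != g by apply: contraNneq gV => <-.
have hg : h != g by apply: contraNneq gV => <-.
have [eq|ne] := eqVneq (cyc_lt b f g) (cyc_lt b h g).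
  by case/orP: (or_same_side W eq) => ->; rewrite ?orbT.
suff /orP[->|->] : cyc_lt b f g && cyc_lt b g h || cyc_lt b h g && cyc_lt b g f.
- by rewrite !orbT.
- by rewrite !orbT.
by have := pos_neq fg; have := pos_neq hg; move: ne; rewrite /cyc_lt; clear; lia.
Qed.

(* Shorten the walk at its maximum, where both neighbours lie on the same side. *)
Lemma arc_acyclic p : path.cycle arc p -> p = [::].
Proof.
have [k] := ubnP (size p); elim: k p => // k IH [//|x0 p'].
set p := x0 :: p' => pk cp.
have x0p : x0 \in p by rewrite mem_head.
case: (arg_maxnP (cyc_pos b) x0p) => f fp fmax.
have [i q eq_rot] := rot_to fp.
have memq x : x \in f :: q -> x \in p by rewrite -eq_rot mem_rot.
have : path.cycle arc (f :: q) by rewrite -eq_rot rot_cycle.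
have sq : (size q).+1 = size p by rewrite -(size_rot i p) eq_rot.
case: q memq sq {eq_rot} => [|g q'] memq sq.
  by rewrite /= andbT => /arc_E; rewrite eqxx !andbF.
rewrite /= rcons_path; set e := last g q' => /and3P[fg gq ef].
have below x : x \in f :: g :: q' -> x != f -> cyc_lt b x f.
  by move=> /memq/fmax xf /pos_neq; rewrite /cyc_lt ltn_neqAle => ->; exact: xf.
have /and3P[_ _ e_f] := arc_E ef; have /and3P[_ _] := arc_E fg; rewrite eq_sym => g_f.
have eg : arc e g.
  apply: arc_arc_turn ef fg _; rewrite !below ?inE ?eqxx ?orbT //.
  by rewrite -in_cons mem_last !orbT.
have : path.cycle arc (g :: q') by rewrite /= rcons_path gq.
by move/IH; rewrite -ltnS sq => /(_ pk).
Qed.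

(** The two walks compose to a closed one, which is empty. It will keep the two ends of E from
    generating each other. *)
Lemma connect_arc_antisym x y : connect arc x y -> connect arc y x -> x = y.
Proof.
case/connectP=> p xp yl /connectP[q yq xl].
have : path arc x (p ++ q) by rewrite cat_path xp -yl yq.
have : last x (p ++ q) = x by rewrite last_cat -yl -xl.
move Dr: (p ++ q) => r0; case/lastP: r0 Dr => [pq|r z _]; last first.
  by rewrite last_rcons => -> c; have := @arc_acyclic (x :: r) c.
by case: (p) pq yl => //= _ ->.
Qed.

(** * Closure of an extreme element under the implications *)

Definition extreme x :=
  forall y z, y \in E -> z \in E -> y != x -> z != x -> cyc_lt b y x = cyc_lt b z x.

(** The conclusion g is pushed along the walk to x by [and_arc]. Once it is x itself, extremality
    puts f and h on one side of it, and a single premise suffices. *)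
Lemma and_connect x f h g : extreme x -> witness [:: f; h] [:: g] ->
  connect arc g x -> connect arc f x || connect arc h x.
Proof.
move=> ex W /connectP[p]; elim: p g W => [|t p IH] g W /=.
  move=> _ eg; have [V [_ [fE hE gE] [fV hV gV] _]] := and_witnessP W; rewrite eg in ex *.
  have fg : f != g by apply: contraNneq fV => ->.
  have hg : h != g by apply: contraNneq hV => ->.
  by case/orP: (and_same_side W (ex _ _ fE hE fg hg)) => /connect1->; rewrite ?orbT.
case/andP=> gt tp xl.
have tx : connect arc t x by apply/connectP; exists p.
have gx : connect arc g x := connect_trans (connect1 gt) tx.
wlog /andP[fg gh] : f h W IH / cyc_lt b f g && cyc_lt b g h.
  move=> H; case/or4P: (and_between W) => [fg|hg|o|o].
  - by rewrite (connect_trans (connect1 fg) gx).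
  - by rewrite (connect_trans (connect1 hg) gx) orbT.
  - exact: H.
  rewrite orbC; apply: H => //; first exact: and_swap.
  by move=> g' /and_swap W' p' l'; rewrite orbC; exact: IH W' p' l'.
have [<-|tf] := eqVneq t f; first by rewrite tx.
have [<-|th] := eqVneq t h; first by rewrite tx orbT.
case/or4P: (and_arc fg gh tf th W gt) => [A|A|W'|/orP[] A].
- by rewrite (connect_trans (connect1 A) tx).
- by rewrite (connect_trans (connect1 A) tx) orbT.
- exact: IH W' tp xl.
- by rewrite (connect_trans (connect1 A) gx).
by rewrite (connect_trans (connect1 A) gx) orbT.
Qed.

Definition closed_under (Z : {set 'I_n}) : bool :=
  [forall s in Z, forall t, arc s t ==> (t \in Z)] &&
  [forall f in Z, forall h in Z, forall g, witness [:: f; h] [:: g] ==> (g \in Z)].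

Lemma closed_underP (Z : {set 'I_n}) : reflect
  ((forall s t, s \in Z -> arc s t -> t \in Z) /\
   (forall f h g, f \in Z -> h \in Z -> witness [:: f; h] [:: g] -> g \in Z))
  (closed_under Z).
Proof.
apply: (iffP andP) => -[H1 H2]; split.
- by move=> s t sZ; move/forall_inP/(_ _ sZ)/forallP/(_ t)/implyP: H1.
- move=> f h g fZ hZ.
  by move/forall_inP/(_ _ fZ)/forall_inP/(_ _ hZ)/forallP/(_ g)/implyP: H2.
- by apply/forall_inP => s sZ; apply/forallP => t; apply/implyP; exact: H1.
apply/forall_inP => f fZ; apply/forall_inP => h hZ; apply/forallP => g; apply/implyP.
exact: H2.
Qed.

Definition hull x : {set 'I_n} :=
  \bigcap_(Z : {set 'I_n} | (x \in Z) && closed_under Z) Z.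

Lemma hull_sub x (Z : {set 'I_n}) : x \in Z -> closed_under Z -> hull x \subset Z.
Proof. by move=> xZ cZ; apply: bigcap_inf; rewrite xZ. Qed.

Lemma hull_mem x : x \in hull x.
Proof. by apply/bigcapP => Z /andP[]. Qed.

Lemma hull_closed x : closed_under (hull x).
Proof.
apply/closed_underP; split=> [s t sH st|f h g fH hH W]; apply/bigcapP => Z /andP[xZ cZ];
  have /closed_underP[c1 c2] := cZ; have /subsetP HZ := hull_sub xZ cZ.
- by apply: c1 st; apply: HZ.
- by apply: c2 W; apply: HZ.
Qed.

Lemma hull_subE x : x \in E -> hull x \subset E.
Proof.
move=> xE; apply: hull_sub => //; apply/closed_underP.
split=> [s t _ /arc_E/and3P[]//|f h g _ _ /and_witnessP[V [_ []]]//].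
Qed.

(** By [and_connect], the elements g such that a walk from g to x' entails one from x to x' form a
    closed set. So arcs alone account for an extreme element of the hull. *)
Lemma hull_connect x x' : extreme x' -> x' \in hull x -> connect arc x x'.
Proof.
move=> ex x'H; pose Z := [set g | connect arc g x' ==> connect arc x x'].
have /subsetP/(_ _ x'H) : hull x \subset Z; last by rewrite inE connect0.
apply: hull_sub; first by rewrite inE implybb.
apply/closed_underP; split=> [s t|f h g]; rewrite !inE.
  move=> /implyP sx st; apply/implyP => tx; apply: sx.
  exact: connect_trans (connect1 st) tx.
move=> /implyP fx /implyP hx W; apply/implyP => gx.
by case/orP: (and_connect ex W gx).
Qed.

(** The elements of the hull whose disjunctive implications all hold in it form a closed set: it
    contains x by extremality, and [arc_or] and [and_or] carry it through the two closure rules. *)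
Lemma hull_or x f h g : x \in E -> extreme x -> g \in hull x ->
  witness [:: g] [:: f; h] -> (f \in hull x) || (h \in hull x).
Proof.
move=> xE ex; set H := hull x.
have /closed_underP[cA cW] := hull_closed x.
pose Q g := [forall f, forall h, witness [:: g] [:: f; h] ==> (f \in H) || (h \in H)].
have QP y : reflect (forall f h, witness [:: y] [:: f; h] -> (f \in H) || (h \in H)) (Q y).
  apply: (iffP forallP) => [Qy f' h'|Qy f']; last first.
    by apply/forallP => h'; apply/implyP; exact: Qy.
  by move/forallP/(_ h')/implyP: (Qy f').
suff: H \subset [set y in H | Q y].
  by move=> /subsetP sub /sub; rewrite inE => /andP[_ /QP]; apply.
apply: hull_sub.
  rewrite inE hull_mem; apply/QP => f' h' W.
  have [V [_ [_ fE hE] [xV fV hV] _]] := or_witnessP W.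
  have fx : f' != x by apply: contraNneq xV => <-.
  have hx : h' != x by apply: contraNneq xV => <-.
  by case/orP: (or_same_side W (ex _ _ fE hE fx hx)) => /(cA _ _ (hull_mem x)) ->;
    rewrite ?orbT.
have arcs p y : p \in H -> Q p -> arc p y -> Q y.
  move=> pH /QP Qp py; have yH := cA _ _ pH py; apply/QP => f' h' W.
  wlog /andP[fy yh] : f' h' W / cyc_lt b f' y && cyc_lt b y h'.
    move=> Hw; case/or4P: (or_between W) => [A|A|o|o].
    - by rewrite (cA _ _ yH A).
    - by rewrite (cA _ _ yH A) orbT.
    - exact: Hw.
    by rewrite orbC; apply: Hw => //; exact: or_swap.
  have [<-|pf] := eqVneq p f'; first by rewrite pH.
  have [<-|ph] := eqVneq p h'; first by rewrite pH orbT.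
  case/or4P: (arc_or fy yh pf ph W py) => [A|A|/Qp//|/orP[] A].
  - by rewrite (cA _ _ pH A).
  - by rewrite (cA _ _ pH A) orbT.
  - by rewrite (cA _ _ yH A).
  by rewrite (cA _ _ yH A) orbT.
apply/closed_underP; split=> [p y|p q y]; rewrite !inE.
  by case/andP=> pH Qp py; rewrite (cA _ _ pH py) (arcs _ _ pH Qp py).
case/andP=> pH Qp /andP[qH Qq] Wa; rewrite (cW _ _ _ pH qH Wa) /=.
have yH := cW _ _ _ pH qH Wa; apply/QP => f' h' W.
wlog /andP[fy yh] : f' h' W / cyc_lt b f' y && cyc_lt b y h'.
  move=> Hw; case/or4P: (or_between W) => [A|A|o|o].
  - by rewrite (cA _ _ yH A).
  - by rewrite (cA _ _ yH A) orbT.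
  - exact: Hw.
  by rewrite orbC; apply: Hw => //; exact: or_swap.
wlog /andP[py yq] : p q pH Qp qH Qq Wa / cyc_lt b p y && cyc_lt b y q.
  move=> Hw; case/or4P: (and_between Wa) => [A|A|o|o].
  - by have /QP := arcs _ _ pH Qp A; apply.
  - by have /QP := arcs _ _ qH Qq A; apply.
  - exact: (Hw p q).
  by apply: (Hw q p) => //; exact: and_swap.
have [<-|pf] := eqVneq p f'; first by rewrite pH.
have [<-|qh] := eqVneq q h'; first by rewrite qH orbT.
move/QP: Qp => Qp; move/QP: Qq => Qq.
have /or4P[/Qp//|/Qq//|A|/orP[A|]] := and_or fy yh py yq pf qh W Wa.
- by rewrite (cW _ _ _ pH qH A).
- by rewrite (cW _ _ _ pH qH A) orbT.
case/or4P=> [A|A|A|/or3P[] A].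
- by rewrite (cA _ _ yH A).
- by rewrite (cA _ _ yH A) orbT.
- by rewrite (cA _ _ pH A).
- by rewrite (cA _ _ pH A) orbT.
- by rewrite (cA _ _ qH A).
by rewrite (cA _ _ qH A) orbT.
Qed.

(** Neither side of an implication is empty, so the bound 3 leaves one case for each closure rule
    and one for [hull_or]. *)
Lemma hull_no_violation x m p : x \in E -> extreme x ->
  witness m p -> all (mem (hull x)) m -> ~~ has (mem (hull x)) p ->
  size m + size p <= 3 -> False.
Proof.
move=> xE ex W; have /closed_underP[cA cW] := hull_closed x.
have [V [VD _ _ cl]] := witnessP _ _ W.
have := clause_minus VD cl; have := clause_plus VD cl => {cl}.
case: m W => [|f [|h [|? m]]] //; case: p => [|g [|k [|? p]]] //= W _ _; rewrite ?andbT ?orbF //.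
- by move=> fH /negP gH _; apply: gH; exact: cA fH W.
- by move=> fH /negP gk _; apply: gk; exact: hull_or fH W.
- by case/andP=> fH hH /negP gH _; apply: gH; exact: cW W.
all: by move=> _ _; rewrite ?addSn ?addnS.
Qed.

(** The points of a crossing that lie in E form an implication violated by the hull. A point outside
    E is needed to bound their number by 3. *)
Lemma hull_sep x V (T : {set 'I_n}) : x \in E -> extreme x -> V \in D -> T \subset [set a; b] ->
  sep V (K0 :|: hull x :|: T).
Proof.
move=> xE ex VD TS; set H := hull x; have HE := subsetP (hull_subE xE).
rewrite (sepE b); apply/negP => /cross_aroundP[s [x1 [x2 [x3 [x4]]]]].
set f := fun y => sdiff (y \in V) (y \in K0 :|: H :|: T).
have aE : a \notin E by apply/negP => /E_neq; rewrite eqxx.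
have fE y v : y \in E -> f y = Some v -> (v = (y \in V)) /\ (y \in H) = ~~ v.
  move=> yE; rewrite /f /sdiff !inE.
  have -> : (y \in K0) = false by move: yE; rewrite inE => /andP[/negbTE].
  have -> : (y \in T) = false.
    apply/negP => /(subsetP TS); rewrite !inE.
    by have /andP[/negPf-> /negPf->] := E_neq yE.
  by rewrite orbF; case: (y \in V); case: (y \in H) => //= -[<-].
have fNE y v m p : y \notin E -> f y = Some v -> csign V m p y = Some v.
  move=> yE; rewrite /f /csign (negPf yE) /sdiff !inE.
  have -> : (y \in H) = false by apply: contraNF yE; exact: HE.
  have [_|/negbTE yab] := boolP ((y == b) || (y == a)); first by case: ifP.
  have -> : (y \in T) = false; last by rewrite !orbF.
  by apply/negP => /(subsetP TS); rewrite !inE orbC yab.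
pose mm ys := [seq y <- ys | missing V y].
pose pp ys := [seq y <- ys | present V y].
have no_alt t y1 y2 y3 y4 (ys := [:: y1; y2; y3; y4]) :
    [&& cyc_lt b y1 y2, cyc_lt b y2 y3 & cyc_lt b y3 y4] ->
    (forall y, y \in ys -> f y = Some (if y \in [:: y1; y3] then t else ~~ t) \/
      y = a /\ (if y \in [:: y1; y3] then t else ~~ t) = (y \in V)) ->
    has (fun y => y \notin E) ys -> False.
  move=> lt fy out.
  have uy : uniq ys.
    apply: (sorted_uniq (@cyc_lt_trans n b) (@cyc_ltxx n b)).
    by rewrite /= andbT.
  have sgn y : y \in ys ->
      csign V (mm ys) (pp ys) y = Some (if y \in [:: y1; y3] then t else ~~ t).
    move=> yys; set v := if _ then _ else _.
    have [yE|yE] := boolP (y \in E); last first.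
      case: (fy y yys); rewrite -/v; first exact: fNE.
      move=> [ya ->].
      by rewrite /csign (negPf yE) ya eqxx orbT.
    case: (fy y yys) => [/fE-/(_ yE)|[ya]]; last by rewrite ya (negPf aE) in yE.
    rewrite -/v => -[-> _]; rewrite /csign yE !mem_filter yys !andbT /missing /present yE /=.
    by case: (y \in V).
  have cl : clause V (mm ys) (pp ys).
    apply/cross_aroundP; exists t, y1, y2, y3, y4; split=> //.
    move: uy; rewrite /= !inE !negb_or.
    move=> /and4P[/and3P[n12 n13 n14] /andP[n23 n24] n34 _].
    rewrite !sgn ?inE ?eqxx ?orbT // (eq_sym y2) (eq_sym y4 y1) (eq_sym y4 y3).
    by rewrite (negPf n12) (negPf n23) (negPf n14) (negPf n34).
  have W : witness (mm ys) (pp ys).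
    by apply/witnessP; exists V; rewrite !filter_all.
  have mmH : all (mem H) (mm ys).
    apply/allP => y; rewrite mem_filter => /andP[/andP[yE yV] yys].
    case: (fy y yys) => [/(fE _ _ yE)[e ]|[ya _]]; last by rewrite ya (negPf aE) in yE.
    by rewrite e (negPf yV) /= => ->.
  have ppH : ~~ has (mem H) (pp ys).
    apply/hasPn => y; rewrite mem_filter => /andP[/andP[yE yV] yys].
    case: (fy y yys) => [/(fE _ _ yE)[e ]|[ya _]]; last by rewrite ya (negPf aE) in yE.
    by rewrite e yV /= => ->.
  apply: (hull_no_violation xE ex W mmH ppH).
  rewrite /mm /pp !size_filter -count_predUI.
  have -> : count (predI (missing V) (present V)) ys = 0.
    by apply/eqP; rewrite -leqn0 leqNgt -has_count; apply/hasPn => y _;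
      rewrite /= /missing /present; case: (y \in V); rewrite !andbF.
  rewrite addn0 -ltnS -[4]/(size ys) -(count_predC [in E] ys).
  rewrite (@eq_count _ (predU _ _) [in E]) => [|y]; last first.
    by rewrite /= /missing /present; case: (y \in V); rewrite !andbF !andbT ?orbF.
  by rewrite -[X in X < _]addn0 ltn_add2l -has_count.
case=> lt [e1 e2 e3 e4].
have [l12 l23 l34] := and3P lt.
have lt_neq y z : cyc_lt b y z -> ((y == z) = false) * ((z == y) = false).
  by move=> yz; split; apply: contraTF yz => /eqP->; rewrite cyc_ltxx.
have n12 := lt_neq _ _ l12; have n23 := lt_neq _ _ l23; have n34 := lt_neq _ _ l34.
have n13 := lt_neq _ _ (cyc_lt_trans l12 l23).
have n14 := lt_neq _ _ (cyc_lt_trans (cyc_lt_trans l12 l23) l34).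
have n24 := lt_neq _ _ (cyc_lt_trans l23 l34).
have [out|] := boolP (has (fun y => y \notin E) [:: x1; x2; x3; x4]).
  apply: (no_alt s _ _ _ _ lt _ out) => y; rewrite !inE.
  case/or4P=> /eqP->; left; rewrite ?eqxx ?orbT ?n12 ?n23 ?n14 ?n34 // e1 e2 e3 e4.
rewrite /= !negb_or !negbK andbT => /and4P[E1 E2 E3 E4].
have lt_a y : y \in E -> (y == a) = false by move=> /E_neq/andP[/negPf].
have out_a y1 y2 y3 : has (fun y => y \notin E) [:: y1; y2; y3; a] by rewrite /= aE !orbT.
(* All four points lie in E, hence before a. In a clause a carries the sign of its membership in V
   whatever T is, so it can replace x1 or x4, according to that sign. *)
have [va|va] := eqVneq (a \in V) s.
  apply: (no_alt (~~ s) x2 x3 x4 a _ _ (out_a _ _ _)); first by rewrite l23 l34 E_before.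
  move=> y; rewrite !inE => /or4P[] /eqP->; rewrite ?eqxx ?orbT //.
  - by left.
  - by left; rewrite negbK n23 n34.
  - by left.
  by right; rewrite negbK !(eq_sym a) !lt_a // va.
have {}va : (a \in V) = ~~ s by move: va; case: (a \in V); case: (s).
apply: (no_alt s x1 x2 x3 a _ _ (out_a _ _ _)); first by rewrite l12 l23 E_before.
move=> y; rewrite !inE => /or4P[] /eqP->; rewrite ?eqxx ?orbT //.
- by left.
- by left; rewrite n12 n23.
- by left.
by right; rewrite !(eq_sym a) !lt_a // va.
Qed.

Theorem gap_refinable : 1 < #|E| -> exists S : {set 'I_n},
  [/\ K0 \proper S, S \proper K1 &
      forall V (T : {set 'I_n}), V \in D -> T \subset [set a; b] -> sep V (S :|: T)].
Proof.
case/card_gt1P=> e1 [e2 [e1E e2E e12]].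
have [mn mnE mnP] := arg_minnP (cyc_pos b) e1E.
have [mx mxE mxP'] := arg_maxnP (cyc_pos b) e1E.
have mxP y : y \in E -> cyc_pos b y <= cyc_pos b mx := mxP' y.
have mnx : mn != mx.
  apply: contraNneq e12 => eq; apply/eqP/(@cyc_pos_inj n b)/eqP; rewrite eqn_leq.
  by rewrite (leq_trans (mxP _ e1E)) -?eq ?mnP // (leq_trans (mxP _ e2E)) -?eq ?mnP.
have ex_mn : extreme mn.
  by move=> y z yE zE _ _; rewrite /cyc_lt !ltnNge !mnP.
have ex_mx : extreme mx.
  move=> y z yE zE /pos_neq ym /pos_neq zm.
  by rewrite /cyc_lt !ltn_neqAle ym zm (mxP _ yE) (mxP _ zE).
(* If each end of E were in the hull of the other, walks in both directions would identify them. *)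
have [x [xE ex [y yE yH]]] : exists x, [/\ x \in E, extreme x &
    exists2 y, y \in E & y \notin hull x].
  have [mxH|mxH] := boolP (mx \in hull mn); last by exists mn; split=> //; exists mx.
  exists mx; split=> //; exists mn => //; apply: contra mnx => mnH; apply/eqP.
  by apply: connect_arc_antisym; apply: hull_connect.
have HE := subsetP (hull_subE xE).
exists (K0 :|: hull x); split.
- rewrite properE subsetUl; apply/subsetPn; exists x; first by rewrite inE hull_mem orbT.
  by move: xE; rewrite inE => /andP[].
- rewrite properE subUset K01 /=; apply/andP; split.
    by apply/subsetP => z /HE; rewrite inE => /andP[].
  apply/subsetPn; exists y; first by move: yE; rewrite inE => /andP[].
  by rewrite inE negb_or yH andbT; move: yE; rewrite inE => /andP[].
by move=> V T; exact: hull_sep.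
Qed.

End Gap.

(** * Cubes in maximal separated systems *)

Definition shatters (T : finType) (D : {set {set T}}) (K A : {set T}) : bool :=
  [disjoint K & A] && [forall B : {set T}, (B \subset A) ==> (K :|: B \in D)].

Lemma shattersP (T : finType) (D : {set {set T}}) (K A : {set T}) :
  reflect ([disjoint K & A] /\ forall B : {set T}, B \subset A -> K :|: B \in D)
          (shatters D K A).
Proof.
apply: (iffP andP) => -[dis H]; split=> //; first by move=> B /(implyP (forallP H B)).
by apply/forallP => B; apply/implyP; exact: H.
Qed.

Section Cubes.

Variables (n : nat) (D : {set {set 'I_n}}).
Implicit Types (K L T U V X : {set 'I_n}).

Hypotheses (sepD : {in D &, forall V V', sep V V'}).
Hypothesis maxD : forall X : {set 'I_n}, {in D, forall V, sep V X} -> X \in D.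

(** * The chain of squares in two fixed directions *)

Section Square.

Variables (a b : 'I_n).
Hypothesis ab : a != b.

Definition inside : {set 'I_n} := [set x | cyc_lt b a x].
Definition outside : {set 'I_n} := [set x | cyc_lt b b x && cyc_lt b x a].

Definition square K := shatters D K [set a; b].

Lemma squareP K : reflect [/\ a \notin K, b \notin K &
  forall T : {set 'I_n}, T \subset [set a; b] -> K :|: T \in D] (square K).
Proof.
apply: (iffP (shattersP _ _ _)) => [[dis H]|[aK bK H]].
  by move: dis; rewrite disjoint_sym disjoints_subset subUset !sub1set !inE => /andP[].
by rewrite disjoint_sym disjoints_subset subUset !sub1set !inE aK bK.
Qed.

(* Complementing inside the arc turns the squares into a chain. *)
Definition twist (K : {set 'I_n}) : {set 'I_n} :=
  [set x | (x \in K) (+) (x \in inside)].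

Lemma cyc_b_cases x : [|| x == b, x == a, x \in outside | x \in inside].
Proof.
rewrite !inE; have [//|xb] := eqVneq x b; have [//|xa] := eqVneq x a.
move: (pos_neq b xb) (pos_neq b xa); rewrite /cyc_lt cyc_posxx /=; lia.
Qed.

Lemma square_signs K L T T' x : square K -> square L ->
  T \subset [set a; b] -> T' \subset [set a; b] ->
  sdiff (x \in K :|: T) (x \in L :|: T') =
  if (x == a) || (x == b) then sdiff (x \in T) (x \in T') else sdiff (x \in K) (x \in L).
Proof.
move=> /squareP[aK bK _] /squareP[aL bL _] sT sT'; rewrite !inE.
have [/orP[]/eqP->|xab] := boolP ((x == a) || (x == b)).
- by rewrite (negPf aK) (negPf aL).
- by rewrite (negPf bK) (negPf bL).
have out (U : {set 'I_n}) : U \subset [set a; b] -> (x \in U) = false.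
  by move=> sU; apply: contraNF xab => /(subsetP sU); rewrite !inE.
by rewrite (out _ sT) (out _ sT') !orbF.
Qed.

(** Complementary choices of T and T' give a and b any prescribed signs, while both corners stay in
    D. *)
Lemma square_no_cross K L (sa sb : bool) (f : 'I_n -> option bool) s x1 x2 x3 x4 :
  square K -> square L ->
  (forall x, f x = if x == a then Some sa else if x == b then Some sb
                   else sdiff (x \in K) (x \in L)) ->
  alternates b f s x1 x2 x3 x4 -> False.
Proof.
move=> qK qL fE alt.
pose T := [set x in [set a; b] | if x == a then sa else sb].
pose T' := [set a; b] :\: T.
have sT : T \subset [set a; b] by apply/subsetP => x; rewrite inE => /andP[].
have sT' : T' \subset [set a; b] := subsetDl _ _.
have /squareP[_ _ KD] := qK; have /squareP[_ _ LD] := qL.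
have := sepD (KD _ sT) (LD _ sT').
rewrite (sepE b) => /negP[]; apply/cross_aroundP; exists s, x1, x2, x3, x4.
case: alt => lt [e1 e2 e3 e4]; split=> //.
suff E x : sdiff (x \in K :|: T) (x \in L :|: T') = f x by rewrite !E.
rewrite square_signs // fE !inE; case: eqP => [_|_] /=; first by case: (sa).
by case: eqP => // _; case: (sb).
Qed.

(** Elements p and q refuting both inclusions have opposite signs on the same arc and equal signs on
    different arcs. In each case suitable signs of a and b make the four points alternate. *)
Lemma square_chain K L : square K -> square L ->
  (twist K \subset twist L) || (twist L \subset twist K).
Proof.
move=> qK qL; apply: contraT; rewrite negb_or.
case/andP=> /subsetPn[p pK pL] /subsetPn[q qL' qK']; exfalso.
have ne K' L' x y : y \in twist K' -> square K' -> square L' -> y \notin twist L' ->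
   x \in [set a; b] -> y != x.
  move=> yK /squareP[aK bK _] /squareP[aL bL _] yL xab; apply: contraTneq yK => yx.
  rewrite -yx in xab; move: yL; rewrite !inE in xab *.
  by case/orP: xab => /eqP->; rewrite ?(negPf aK, negPf aL, negPf bK, negPf bL) // => ->.
have aab : a \in [set a; b] by rewrite !inE eqxx.
have bab : b \in [set a; b] by rewrite !inE eqxx orbT.
have pa := ne _ _ _ _ pK qK qL pL aab; have pb := ne _ _ _ _ pK qK qL pL bab.
have qa := ne _ _ _ _ qL' qL qK qK' aab; have qb := ne _ _ _ _ qL' qL qK qK' bab.
have pq : p != q by apply: contraNneq pL => ->.
have ba : b != a by rewrite eq_sym.
have := cyc_b_cases p; rewrite (negPf pa) (negPf pb) /=.
have := cyc_b_cases q; rewrite (negPf qa) (negPf qb) /=.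
have L0 x : x != b -> cyc_lt b b x.
  by move=> /(pos_neq b); rewrite /cyc_lt cyc_posxx lt0n.
have notboth x : x \in outside -> x \in inside -> False.
  by rewrite !inE /cyc_lt => /andP[_ h] /(ltn_trans h); rewrite ltnn.
pose f sa sb x := if x == a then Some sa else if x == b then Some sb
                   else sdiff (x \in K) (x \in L).
have no sa sb s x1 x2 x3 x4 : alternates b (f sa sb) s x1 x2 x3 x4 -> False.
  exact: square_no_cross qK qL _.
have fp sa sb : f sa sb p = Some (p \notin inside).
  rewrite /f (negPf pa) (negPf pb); move: pK pL; rewrite /sdiff !inE.
  by case: (p \in K); case: (p \in L); case: cyc_lt.
have fq sa sb : f sa sb q = Some (q \in inside).
  rewrite /f (negPf qa) (negPf qb); move: qK' qL'; rewrite /sdiff !inE.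
  by case: (q \in K); case: (q \in L); case: cyc_lt.
have fa sa sb : f sa sb a = Some sa by rewrite /f eqxx.
have fb sa sb : f sa sb b = Some sb by rewrite /f (negPf ba) eqxx.
have Ni x : x \in outside -> (x \in inside) = false by move=> xo; apply/negP/notboth.
have lt_out x : x \in outside -> cyc_lt b x a by rewrite inE => /andP[].
have lt_in x : x \in inside -> cyc_lt b a x by rewrite inE.
have tot : cyc_lt b p q || cyc_lt b q p.
  exact: cyc_lt_total.
case/orP=> qi /orP[] pi.
- case/orP: tot => lt.
    apply: (no true false false b p q a); rewrite /alternates fa fb fp fq.
    by rewrite L0 // lt lt_out // !Ni.
  apply: (no false true true b q p a); rewrite /alternates fa fb fp fq.
  by rewrite L0 // lt lt_out // !Ni.
- apply: (no true true true b q a p); rewrite /alternates fa fb fp fq.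
  by rewrite L0 // lt_out // lt_in // pi Ni.
- apply: (no false false false b p a q); rewrite /alternates fa fb fp fq.
  by rewrite L0 // lt_out // lt_in // qi Ni.
case/orP: tot => lt.
  apply: (no true false false b a p q); rewrite /alternates fa fb fp fq.
  by rewrite L0 // lt lt_in // pi qi.
apply: (no false true true b a q p); rewrite /alternates fa fb fp fq.
by rewrite L0 // lt lt_in // pi qi.
Qed.

(** Against any V one sign can occur on the outer arc and only the opposite one on the inner arc;
    with b and a there are at most three blocks. These squares are the two ends of the chain: their
    twists are empty, respectively everything except a and b. *)
Lemma extreme_square (X : {set 'I_n}) (s : bool) :
  X = (if s then inside else outside) -> square X.
Proof.
move=> XE.
have aX : a \notin X by rewrite XE; case: (s); rewrite !inE cyc_ltxx ?andbF.
have bX : b \notin X.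
  by rewrite XE; case: (s); rewrite !inE ?cyc_ltxx // /cyc_lt cyc_posxx.
apply/squareP; split=> // T sT; apply: maxD => V VD.
rewrite (sepE b); apply/negP => /cross_aroundP[t [x1 [x2 [x3 [x4]]]]].
set f := fun x => _; case=> /and3P[l1 l2 l3] [e1 e2 e3 e4].
have fo x u : x \in outside -> f x = Some u -> u = s.
  move=> xo; rewrite /f /sdiff !inE.
  have -> : (x \in T) = false.
    apply/negP => /(subsetP sT); move: xo; rewrite !inE => /andP[xb xa] /orP[]/eqP xE.
      by rewrite xE cyc_ltxx in xa.
    by rewrite xE cyc_ltxx in xb.
  rewrite orbF XE; move: xo; case: (s) => xo.
    have -> : (x \in inside) = false.
      by move: xo; rewrite !inE /cyc_lt => /andP[_ h]; rewrite ltnNge ltnW.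
    by case: (x \in V) => // -[].
  by rewrite xo; case: (x \in V) => // -[].
have fi x u : x \in inside -> f x = Some u -> u = ~~ s.
  move=> xi; rewrite /f /sdiff !inE.
  have -> : (x \in T) = false.
    apply/negP => /(subsetP sT); move: xi; rewrite !inE => xa /orP[]/eqP xE.
      by rewrite xE cyc_ltxx in xa.
    by rewrite xE /cyc_lt cyc_posxx in xa.
  rewrite orbF XE; move: xi; case: (s) => xi.
    by rewrite xi; case: (x \in V) => // -[].
  have -> : (x \in outside) = false.
    move: xi; rewrite !inE /cyc_lt => /ltnW h.
    by rewrite [_ < cyc_pos b a]ltnNge h andbF.
  by case: (x \in V) => // -[].
have zone x y : cyc_lt b x y -> (y == b) = false.
  by move=> xy; apply: contraTF xy => /eqP->; rewrite /cyc_lt cyc_posxx.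
have mid x y z u : cyc_lt b x y -> cyc_lt b y z -> f y = Some u -> f z = Some (~~ u) ->
    [\/ y \in outside /\ z \in inside, y = a | z = a].
  move=> xy yz ey ez; have := cyc_b_cases y; have := cyc_b_cases z.
  rewrite (zone _ _ xy) (zone _ _ yz) /=.
  have [->|_] := eqVneq z a; first by constructor 3.
  have [->|_] := eqVneq y a; first by constructor 2.
  move=> /= /orP[] zi /orP[] yi.
  - by have := fo _ _ zi ez; have := fo _ _ yi ey => ->; case: (s).
  - move: zi yi yz; rewrite !inE /cyc_lt => /andP[_ za] ay yz.
    by have := ltn_trans (ltn_trans ay yz) za; rewrite ltnn.
  - by constructor 1.
  by have := fi _ _ zi ez; have := fi _ _ yi ey => ->; case: (s).
have e3' : f x3 = Some (~~ ~~ t) by rewrite negbK.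
have ei y : cyc_lt b a y -> y \in inside by rewrite inE.
have eo x y : cyc_lt b x y -> cyc_lt b y a -> y \in outside.
  by rewrite inE /cyc_lt cyc_posxx => h ->; rewrite andbT (leq_ltn_trans _ h).
case: (mid _ _ _ _ l1 l2 e2 e3') => [[o2 i3]|ea|ea].
- have i4 : x4 \in inside by apply: ei; move: i3; rewrite inE => h; exact: cyc_lt_trans h l3.
  by move: (fi _ _ i3 e3) (fi _ _ i4 e4); case: (s); case: (t).
- rewrite ea in l2; have i3 := ei _ l2.
  have i4 := ei _ (cyc_lt_trans l2 l3).
  by move: (fi _ _ i3 e3) (fi _ _ i4 e4); case: (s); case: (t).
rewrite ea in l2 l3.
have o2 := eo _ _ l1 l2; have i4 := ei _ l3.
have := fo _ _ o2 e2; have := fi _ _ i4 e4 => E1 E2.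
by move: E1 E2; case: (s); case: (t).
Qed.

End Square.

Lemma twist_inj a b : injective (twist a b).
Proof.
move=> K L KL; apply/setP => x; move/setP/(_ x): KL; rewrite !inE.
by case: (x \in K); case: (x \in L); case: cyc_lt.
Qed.

Lemma sub_shatters K L (A B : {set 'I_n}) :
  shatters D K B -> A \subset B -> L \subset B :\: A -> shatters D (K :|: L) A.
Proof.
case/shattersP=> dis H AB LB; apply/shattersP; split.
  rewrite disjoint_sym disjoints_subset; apply/subsetP => x xA; rewrite !inE negb_or.
  apply/andP; split.
    by apply: contraL (subsetP AB _ xA) => xK; rewrite (disjointFr dis xK).
  by apply/negP => /(subsetP LB); rewrite inE xA.
move=> T TA; rewrite -setUA; apply: H; rewrite subUset (subset_trans TA AB) andbT.
exact: subset_trans LB (subsetDl _ _).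
Qed.

(** The chain runs from a square without e to one with e. Around the place where e enters, two
    consecutive squares K0 and K1 agree on the inner arc, so K0 is contained in K1 and the gap
    theorem applies: a difference larger than e would admit a square in between. *)
Lemma cube_outside a b e : a != b -> e \in outside a b ->
  (forall i, i \in inside a b -> exists L, shatters D L [set a; b; i]) ->
  exists K, shatters D K [set a; b; e].
Proof.
move=> ab eo cubes; pose tw := twist a b.
have ei : e \notin inside a b.
  by apply: contraL eo; rewrite !inE /cyc_lt => h; rewrite negb_and -!leqNgt (ltnW h) orbT.
have tw_out x K : x \notin inside a b -> (x \in tw K) = (x \in K).
  by move=> xi; rewrite [LHS]in_set (negPf xi) addbF.
have tw_e K : (e \in tw K) = (e \in K) by exact: tw_out.
pose P := [pred p : {set 'I_n} * {set 'I_n} |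
  [&& square a b p.1, square a b p.2, e \notin p.1 & e \in p.2]].
have P0 : P (inside a b, outside a b).
  have qX X s : X = (if s then inside a b else outside a b) -> square a b X.
    exact: extreme_square.
  by rewrite /= (qX _ true) // (qX _ false) // ei.
case: (arg_minnP (fun p => #|tw p.2 :\: tw p.1|) P0) => -[K0 K1] /= /and4P[q0 q1 e0 e1] mn.
have chain K L x : square a b K -> square a b L -> x \in tw L -> x \notin tw K ->
    tw K \subset tw L.
  move=> qK qL xL xK; case/orP: (square_chain ab qK qL) => // /subsetP/(_ _ xL).
  by rewrite (negPf xK).
have tw01 : tw K0 \subset tw K1 by apply: (chain _ _ e) => //; rewrite tw_e.
have min L : square a b L -> tw K0 \subset tw L -> tw L \subset tw K1 -> L = K0 \/ L = K1.
  move=> qL s0 s1; have [eL|eL] := boolP (e \in L); [right|left].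
    apply: (@twist_inj a b); apply/eqP; rewrite eqEsubset s1 /=.
    have := mn (K0, L); rewrite /= q0 qL e0 eL => /(_ isT) c.
    have /eqP E : tw L :\: tw K0 == tw K1 :\: tw K0 by rewrite eqEcard setSD.
    apply/subsetP => x x1; have [/(subsetP s0)//|x0] := boolP (x \in tw K0).
    have : x \in tw L :\: tw K0 by rewrite E inE x0.
    by rewrite inE => /andP[].
  apply: (@twist_inj a b); apply/eqP; rewrite eqEsubset s0 andbT.
  have := mn (L, K1); rewrite /= q1 qL e1 eL => /(_ isT) c.
  have /eqP E : tw K1 :\: tw L == tw K1 :\: tw K0 by rewrite eqEcard setDS.
  apply/subsetP => x xL; apply: contraTT xL => x0.
  have [x1|] := boolP (x \in tw K1); last by apply: contra => /(subsetP s1).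
  have : x \in tw K1 :\: tw L by rewrite E inE x0.
  by rewrite inE => /andP[].
(* Otherwise a cube in directions a, b, i contains two squares, with twists differing in i alone,
   between K0 and K1. By minimality they are K0 and K1, which however differ in e. *)
have agree i : i \in inside a b -> i \in tw K1 -> i \in tw K0.
  move=> ii i1; apply: contraT => i0; have [L qL] := cubes i ii.
  have iab : i \notin [set a; b].
    move: ii; rewrite !inE => ai; apply/negP => /orP[]/eqP iE.
      by rewrite iE cyc_ltxx in ai.
    by rewrite iE /cyc_lt cyc_posxx in ai.
  have sab : [set a; b] \subset [set a; b; i] by exact: subsetUl.
  have qL0 : square a b L by rewrite -[L]setU0; exact: sub_shatters qL sab (sub0set _).
  have qL1 : square a b (L :|: [set i]).
    by apply: sub_shatters qL sab _; rewrite sub1set inE iab !inE eqxx !orbT.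
  have iL : i \notin L.
    by have /shattersP[dis _] := qL; rewrite (disjointFl dis) // !inE eqxx !orbT.
  have iL0 : i \in tw L by rewrite inE (negPf iL) ii.
  have iL1 : i \notin tw (L :|: [set i]) by rewrite inE ii !inE eqxx orbT.
  have twL : tw L = i |: tw (L :|: [set i]).
    apply/setP => x; rewrite in_setU1; have [->|xi] := eqVneq x i; first by rewrite iL0.
    by rewrite /= !inE (negPf xi) orbF.
  have s0 : tw K0 \subset tw (L :|: [set i]).
    have := chain _ _ _ q0 qL0 iL0 i0; rewrite twL => s; apply/subsetP => x x0.
    have := subsetP s _ x0; rewrite in_setU1 => /orP[/eqP xi|//].
    by rewrite -xi x0 in i0.
  have s1 : tw (L :|: [set i]) \subset tw K1 := chain _ _ _ qL1 q1 i1 iL1.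
  have sL1 : tw L \subset tw K1 by rewrite twL subUset sub1set i1.
  have sL0 : tw K0 \subset tw L by rewrite twL (subset_trans s0) ?subsetUr.
  case: (min _ qL1 s0 s1) => E; last by rewrite E i1 in iL1.
  case: (min _ qL0 sL0 sL1) => E'; first by rewrite E' (negPf i0) in iL0.
  have : e \in L :|: [set i] by rewrite E' !inE e1.
  by rewrite E (negPf e0).
have in01 x : x \in inside a b -> (x \in K0) = (x \in K1).
  move=> xi; have := agree x xi; have := subsetP tw01 x; rewrite !inE; move: xi; rewrite inE => ->.
  by case: (x \in K0); case: (x \in K1) => //= h1 h2; [have := h2 isT | have := h1 isT].
have /squareP[a0 b0 K0D] := q0; have /squareP[a1 b1 K1D] := q1.
have K01 : K0 \subset K1.
  apply/subsetP => x x0; case/or4P: (cyc_b_cases ab x) => [/eqP xb|/eqP xa|xo|xi].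
  - by rewrite -xb x0 in b0.
  - by rewrite -xa x0 in a0.
  - have xi : x \notin inside a b.
      apply: contraL xo; rewrite !inE /cyc_lt => h.
      by rewrite negb_and -!leqNgt (ltnW h) orbT.
    by have := subsetP tw01 x; rewrite !tw_out // x0; apply.
  by rewrite -in01.
have Eout : {in K1 :\: K0, forall x, cyc_lt b x a}.
  move=> x; rewrite inE => /andP[x0 x1].
  case/or4P: (cyc_b_cases ab x) => [/eqP xb|/eqP xa|xo|xi].
  - by rewrite xb (negPf b1) in x1.
  - by rewrite xa (negPf a1) in x1.
  - by move: xo; rewrite inE => /andP[].
  by rewrite (in01 _ xi) x1 in x0.
have [E1|E1] := leqP #|K1 :\: K0| 1.
  have Ee : K1 :\: K0 = [set e].
    by apply/esym/eqP; rewrite eqEcard sub1set inE e0 e1 cards1.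
  exists K0; apply/shattersP; split.
    rewrite disjoint_sym disjoints_subset !subUset !sub1set !inE.
    by rewrite a0 b0 e0.
  move=> T sT; have [eT|eT] := boolP (e \in T).
    have -> : K0 :|: T = K1 :|: (T :\ e).
      rewrite -(setD1K eT) setUA; congr (_ :|: _); last by rewrite setD1K.
      by rewrite -Ee setDE setUIr setUCr setIT; apply/setUidPr.
    apply: K1D; apply/subsetP => x; rewrite inE => /andP[xe /(subsetP sT)].
    by rewrite !inE in xe *; rewrite (negPf xe) orbF.
  apply: K0D; apply/subsetP => x xT; have := subsetP sT _ xT.
  by rewrite !inE => /orP[//|/eqP xe]; rewrite -xe xT in eT.
have [S [S0 S1 Ssep]] := gap_refinable ab sepD a1 b1 K01 K0D K1D Eout E1.
have [sK0 /subsetPn[x xS x0]] := andP S0; have [sK1 /subsetPn[y y1 yS]] := andP S1.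
have qS : square a b S.
  apply/squareP; split=> [||T sT].
  - by apply: contra a1; exact: subsetP.
  - by apply: contra b1; exact: subsetP.
  by apply: maxD => V VD; exact: Ssep.
have inS z : z \in inside a b -> (z \in S) = (z \in K1).
  move=> zi; apply/idP/idP => [|z1]; first exact: subsetP.
  by apply: (subsetP sK0); rewrite in01.
case: (min S qS).
- apply/subsetP => z; have [zi|zi] := boolP (z \in inside a b).
    by rewrite !in_set in01 // inS.
  by rewrite !tw_out //; exact: subsetP.
- apply/subsetP => z; have [zi|zi] := boolP (z \in inside a b).
    by rewrite !in_set inS.
  by rewrite !tw_out //; exact: subsetP.
- by move=> SE; rewrite -SE xS in x0.
by move=> SE; rewrite SE y1 in yS.
Qed.

Lemma inside_pos a b i : a != b -> i \in inside a b -> cyc_pos a i < cyc_pos a b.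
Proof.
rewrite inE /cyc_lt => ab ai; have := pos_neq a ab; rewrite cyc_posxx.
have := cyc_pos_rebase b a i; have := cyc_pos_rebase b a b.
have := cyc_pos_lt b i; have := pos_neq b ab; rewrite cyc_posxx.
move: ai; clear; lia.
Qed.

(** Induction on the length of the arc from a to b: for i inside it, the pair a, i has a shorter
    arc, with b as third direction. *)
Theorem shatters_triple a b e : a != b -> a != e -> b != e ->
  exists K, shatters D K [set a; b; e].
Proof.
have [k] := ubnP (cyc_pos a b); elim: k a b e => // k IH a b e abk ab ae be.
have inside_cube i : i \in inside a b -> exists K, shatters D K [set a; b; i].
  move=> ii; have lt := inside_pos ab ii.
  have ai : a != i by apply: contraTneq ii => <-; rewrite inE cyc_ltxx.
  have bi : b != i by apply: contraTneq ii => <-; rewrite inE /cyc_lt cyc_posxx.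
  have ib : i != b by rewrite eq_sym.
  by have [K HK] := IH a i b (leq_trans lt abk) ai ab ib; exists K; rewrite setUAC.
case/or4P: (cyc_b_cases ab e) => [/eqP eb|/eqP ea|eo|/inside_cube//].
- by rewrite eb eqxx in be.
- by rewrite ea eqxx in ae.
exact: cube_outside.
Qed.

End Cubes.

(** * Counting *)

Definition shattered (T : finType) (D : {set {set T}}) : {set {set T}} :=
  [set A | [exists K, shatters D K A]].

Lemma shatteredP (T : finType) (D : {set {set T}}) A :
  reflect (exists K, shatters D K A) (A \in shattered D).
Proof. by rewrite inE; exact: existsP. Qed.

(** Split D by an x on which its members differ. Shattered sets without x are shattered by one part;
    those with x, after removal of x, by both. Union and intersection together have the size of the
    two counts. *)
Lemma shattered_card (T : finType) (D : {set {set T}}) : #|shattered D| <= #|D|.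
Proof.
have [k] := ubnP #|D|; elim: k D => // k IH D Dk.
have [x /andP[x0 x1]|all_same] := pickP (fun x : T =>
    (set0 != [set V in D | x \notin V]) && (set0 != [set V in D | x \in V])).
  set D0 := [set V in D | x \notin V] in x0; set D1 := [set V in D | x \in V] in x1.
  have DE : #|D| = #|D0| + #|D1|.
    rewrite -(cardsID [set V : {set T} | x \notin V] D); congr (_ + _).
      by apply: eq_card => V; rewrite !inE.
    by apply: eq_card => V; rewrite !inE negbK andbC.
  have D0_lt : #|D0| < k.
    by rewrite -ltnS (leq_trans _ Dk) // ltnS DE -[X in X < _]addn0 ltn_add2l card_gt0 eq_sym.
  have D1_lt : #|D1| < k.
    by rewrite -ltnS (leq_trans _ Dk) // ltnS DE -[X in X < _]add0n ltn_add2r card_gt0 eq_sym.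
  rewrite DE; apply: leq_trans (leq_add (IH _ D0_lt) (IH _ D1_lt)).
  rewrite -cardsUI -(cardsID [set A : {set T} | x \notin A] (shattered D)); apply: leq_add.
    apply/subset_leq_card/subsetP => A; rewrite inE => /andP[/shatteredP[K /shattersP[dis H]]].
    rewrite !inE => xA; apply/orP.
    have [xK|xK] := boolP (x \in K); [right|left]; apply/existsP; exists K;
      apply/shattersP; split=> // B BA; rewrite inE H // inE ?xK // negb_or xK /=.
    by apply: contra xA; exact: subsetP.
  rewrite -(@card_in_imset _ _ (fun A => A :\ x)); last first.
    move=> A B; rewrite !inE !negbK => /andP[xA _] /andP[xB _] AB.
    by rewrite -(setD1K xA) AB setD1K.
  apply/subset_leq_card/subsetP => _ /imsetP[A + ->].
  rewrite !inE negbK => /andP[xA /existsP[K /shattersP[dis H]]].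
  have xK : x \notin K by rewrite (disjointFl dis).
  apply/andP; split; apply/existsP.
    exists K; apply/shattersP; split.
      by apply: disjointWr dis; exact: subsetDl.
    move=> B; rewrite subsetD1 => /andP[BA xB]; rewrite inE H //.
    by rewrite inE negb_or xK.
  exists (x |: K); apply/shattersP; split.
    rewrite disjoint_sym disjoints_subset; apply/subsetP => y; rewrite !inE negb_or.
    by case/andP=> -> /(disjointFl dis) ->.
  move=> B; rewrite subsetD1 => /andP[BA xB]; rewrite inE !inE eqxx andbT.
  by rewrite -setUA setUCA; apply: H; rewrite subUset sub1set xA.
have D1 V W : V \in D -> W \in D -> V = W.
  move=> VD WD; apply/setP => x; have := all_same x.
  case: (boolP (x \in V)) => xV; case: (boolP (x \in W)) => xW // /negP[];
    apply/andP; split; rewrite eq_sym; apply/set0Pn.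
  - by exists W; rewrite inE WD xW.
  - by exists V; rewrite inE VD xV.
  - by exists V; rewrite inE VD xV.
  by exists W; rewrite inE WD xW.
have sh0 A : A \in shattered D -> A = set0 /\ exists V, V \in D.
  case/shatteredP=> K /shattersP[dis H].
  have KD := H _ (sub0set A); have KA := H _ (subxx A).
  split; last by exists (K :|: set0).
  apply/setP => x; rewrite inE; apply/negbTE/negP => xA.
  have : x \in K :|: A by rewrite inE xA orbT.
  by rewrite (D1 _ _ KA KD) !inE orbF (disjointFl dis xA).
have [->|/set0Pn[A /sh0[_ [V VD]]]] := eqVneq (shattered D) set0; first by rewrite cards0.
apply: (@leq_trans #|[set (set0 : {set T})]|).
  by apply/subset_leq_card/subsetP => B /sh0[-> _]; rewrite inE.
by rewrite cards1 card_gt0; apply/set0Pn; exists V.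
Qed.

(** From n to n + 1 the term r grows by r and a new term 1 appears; by Pascal the left side also
    grows by 'C(n + 1, 2) + 1. *)
Lemma sum_levels n : \sum_(i < 4) 'C(n, i) = \sum_(r < n.+1) (r * (n - r)).+1.
Proof.
have sum4 k : \sum_(i < 4) 'C(k, i) = 1 + k + 'C(k, 2) + 'C(k, 3).
  by rewrite !big_ord_recr big_ord0 /= bin0 bin1.
elim: n => [|n IH]; first by rewrite sum4 !big_ord_recr !big_ord0.
rewrite [RHS]big_ord_recr /= subnn muln0.
have -> : \sum_(i < n.+1) (i * (n.+1 - i)).+1 = \sum_(i < n.+1) ((i * (n - i)).+1 + i).
  apply: eq_bigr => i _; have := ltn_ord i; rewrite ltnS => /subSn->.
  by rewrite mulnS addSn addnC.
rewrite big_split /= -IH !sum4.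
have -> : \sum_(i < n.+1) nat_of_ord i = 'C(n.+1, 2) by rewrite -bin2_sum big_mkord.
rewrite !binS !bin1; lia.
Qed.

Lemma sum_card_levels (T : finType) (S : {set {set T}}) k :
  \sum_(i < k) #|[set V in S | #|V| == i :> nat]| = #|[set V in S | #|V| < k]|.
Proof.
elim: k => [|k IH]; first by rewrite big_ord0; apply/esym/eqP; rewrite cards_eq0;
  apply/eqP/setP => V; rewrite !inE andbF.
rewrite big_ord_recr /= IH -(cardsID [set V : {set T} | #|V| < k] [set V in S | #|V| < k.+1]).
congr (_ + _); apply: eq_card => V; rewrite !inE ltnS.
  by case: (V \in S) => //=; rewrite andb_idl //; exact: ltnW.
by case: (V \in S); rewrite ?andbF //= -leqNgt eq_sym eqn_leq.
Qed.

Lemma superset_card (T : finType) (A : {set T}) k : #|A| <= k -> k <= #|T| ->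
  exists2 U : {set T}, A \subset U & #|U| = k.
Proof.
elim: k => [|k IH] Ak kT; first by exists A => //; apply/eqP; rewrite -leqn0.
move: Ak; rewrite leq_eqVlt => /orP[/eqP Ak|]; first by exists A.
rewrite ltnS => /IH/(_ (ltnW kT))[U AU cU].
have /set0Pn[x] : ~: U != set0 by rewrite -card_gt0 cardsCs setCK cU subn_gt0.
rewrite inE => xU; exists (x |: U); last by rewrite cardsU1 xU cU.
exact: subset_trans AU (subsetUr _ _).
Qed.

(** * The bound for one level, and equality on all levels *)

Section Levels.

Variable n : nat.
Implicit Types (X Y A : {set 'I_n}) (C D : {set {set 'I_n}}).

Definition trace m X : {set 'I_n} := [set x in X | x < m].

Lemma card_trace_tail m X : #|X| = #|trace m X| + #|[set x in X | m <= x]|.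
Proof.
rewrite -(cardsID [set x : 'I_n | x < m] X); congr (_ + _).
  by apply: eq_card => x; rewrite !inE.
by apply: eq_card => x; rewrite !inE -leqNgt andbC.
Qed.

Lemma cyc_pos0 (b x : 'I_n) : b = 0 :> nat -> cyc_pos b x = x.
Proof. by move=> b0; rewrite cyc_posE b0 subn0. Qed.

(* Sets with the traces m |: A and B continue with a "+" at m and a "-" after m. *)
Lemma branch_order r (m : 'I_n) X Y A B (p q : 'I_n) : #|X| = r -> #|Y| = r ->
  sep X Y -> trace m.+1 X = m |: A -> trace m.+1 Y = B -> m \notin A -> m \notin B ->
  #|A| = #|B| -> p \in A -> p \notin B -> q \in B -> q \notin A -> q < p.
Proof.
move=> cX cY sXY tX tY mA mB cAB pA pB qB qA.
rewrite ltnNge; apply/negP => pq.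
have b_lt : 0 < n by exact: leq_ltn_trans (leq0n m) (ltn_ord m).
pose b := Ordinal b_lt; have b0 : b = 0 :> nat by [].
have [z zY] : exists2 z : 'I_n, (z \in Y) && (m.+1 <= z) & z \notin X.
  have : #|[set x in X | m.+1 <= x]| < #|[set x in Y | m.+1 <= x]|.
    have := card_trace_tail m.+1 X; have := card_trace_tail m.+1 Y.
    by rewrite cX cY tX tY cardsU1 mA cAB; clear; lia.
  move=> lt.
  have /subsetPn[z] : ~~ ([set x in Y | m.+1 <= x] \subset [set x in X | m.+1 <= x]).
    by apply: contraL lt => /subset_leq_card; rewrite -leqNgt.
  rewrite !inE => /andP[zY mz]; rewrite mz andbT => zX; exists z; rewrite ?zY //.
case/andP: zY => zY mz zX.
have inX (x : 'I_n) : x <= m -> (x \in X) = (x \in m |: A).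
  by rewrite -tX inE ltnS => ->; rewrite andbT.
have inY (x : 'I_n) : x <= m -> (x \in Y) = (x \in B) by rewrite -tY inE ltnS => ->; rewrite andbT.
have Alt x : x \in A -> x < m.
  move=> xA; have : x \in m |: A by rewrite inE xA orbT.
  rewrite -tX inE ltnS leq_eqVlt => /andP[_ /orP[/eqP/val_inj xm|//]].
  by rewrite -xm xA in mA.
have Blt x : x \in B -> x < m.
  move=> xB; have : x \in B := xB.
  rewrite -{1}tY inE ltnS leq_eqVlt => /andP[_ /orP[/eqP/val_inj xm|//]].
  by rewrite -xm xB in mB.
apply: (@sep_alternates n b X Y p q m z true sXY); split.
  rewrite /cyc_lt !cyc_pos0 // Blt // mz !andbT ltn_neqAle pq andbT.
  by apply: contraNneq qA => /val_inj <-.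
have pm := ltnW (Alt _ pA); have qm := ltnW (Blt _ qB).
split; apply/eqP; rewrite sdiffP /= inE.
- by rewrite inX // inY // !inE pA pB orbT.
- rewrite inX // inY // !inE qB (negPf qA) orbF andbT.
  by apply: contraTneq qB => ->.
- by rewrite inX // inY // !inE eqxx mB.
by rewrite zX zY.
Qed.

Lemma card_ord_lt m : m <= n -> #|[set x : 'I_n | x < m]| = m.
Proof.
by move=> mn; rewrite -sum1dep_card (big_ord_narrow mn) sum1_card card_ord.
Qed.

Lemma card_cells r m :
  #|[set c : 'I_r * 'I_(n - r) | c.1 + c.2 < m.+1]| =
  #|[set c : 'I_r * 'I_(n - r) | c.1 + c.2 < m]| +
  #|[set c : 'I_r * 'I_(n - r) | c.1 + c.2 == m :> nat]|.
Proof.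
rewrite -(cardsID [set c : 'I_r * 'I_(n - r) | c.1 + c.2 < m]); congr (_ + _).
  by apply: eq_card => c; rewrite !inE; clear; lia.
by apply: eq_card => c; rewrite !inE; clear; lia.
Qed.

(** A trace below m branches if it continues both with and without m. By [branch_order] at most one
    trace of each size i branches, and then i < r and m - i < n - r: it is charged to the cell (i, m
    - i) of an r by n - r rectangle. *)
Theorem level_bound r C : separated_system C -> {in C, forall X, #|X| = r} ->
  #|C| <= (r * (n - r)).+1.
Proof.
move=> sepC cC.
have bound m : m <= n ->
    #|trace m @: C| <= #|[set c : 'I_r * 'I_(n - r) | c.1 + c.2 < m]|.+1.
  elim: m => [|m IH] mn.
    apply: (@leq_trans #|[set (set0 : {set 'I_n})]|); last by rewrite cards1.
    apply/subset_leq_card/subsetP => _ /imsetP[X _ ->].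
    by rewrite inE; apply/eqP/setP => x; rewrite !inE andbF.
  pose mo := Ordinal mn.
  have tr_out X : mo \notin X -> trace m.+1 X = trace m X.
    move=> mX; apply/setP => x; rewrite !inE ltnS leq_eqVlt.
    case: (boolP (x \in X)) => //= xX; case: eqP => //= xm.
    by have := xX; rewrite (_ : x = mo) ?(negPf mX) //; exact: val_inj.
  have tr_in X : trace m.+1 X :\ mo = trace m X.
    apply/setP => x; rewrite !inE ltnS leq_eqVlt -(inj_eq val_inj) /=.
    by case: eqP => //= ->; rewrite ltnn andbF.
  have mo_tr X : (mo \in trace m.+1 X) = (mo \in X) by rewrite inE ltnSn andbT.
  set C1 := trace m.+1 @: C.
  pose P0 := [set Z in C1 | mo \notin Z]; pose P1 := [set Z in C1 | mo \in Z].
  pose Q1 := [set Z :\ mo | Z in P1].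
  have -> : #|C1| = #|P0| + #|Q1|.
    have -> : #|Q1| = #|P1|.
      rewrite card_in_imset // => A B; rewrite /P1 !inE => /andP[_ mA] /andP[_ mB] AB.
      by rewrite -(setD1K mA) AB setD1K.
    rewrite -(cardsID [set Z : {set 'I_n} | mo \notin Z] C1); congr (_ + _).
      by apply: eq_card => Z; rewrite !inE.
    by apply: eq_card => Z; rewrite !inE negbK andbC.
  have P0P A : A \in P0 -> exists2 Y, Y \in C & trace m.+1 Y = A /\ trace m Y = A.
    rewrite /P0 inE => /andP[/imsetP[Y YC ->]]; rewrite mo_tr => mY.
    by exists Y => //; rewrite tr_out.
  have Q1P A : A \in Q1 -> exists2 X, X \in C & trace m.+1 X = mo |: A /\ trace m X = A.
    case/imsetP=> Z; rewrite /P1 inE => /andP[/imsetP[X XC ->] mX] ->.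
    by exists X; rewrite // setD1K // tr_in.
  (* The union of [P0] and [Q1] consists of traces below m; their intersection consists of the
     branching ones. *)
  rewrite -cardsUI card_cells -addSn; apply: leq_add.
    apply: leq_trans (IH (ltnW mn)); apply/subset_leq_card; rewrite subUset.
    apply/andP; split; apply/subsetP => A; first by case/P0P=> Y YC [_ <-]; exact: imset_f.
    by case/Q1P=> X XC [_ <-]; exact: imset_f.
  have moP A : A \in P0 -> mo \notin A by rewrite /P0 inE => /andP[].
  pose f (A : {set 'I_n}) := (insub #|A| : option 'I_r, insub (m - #|A|) : option 'I_(n - r)).
  have cell A : A \in P0 :&: Q1 -> [/\ #|A| < r, #|A| <= m & m - #|A| < n - r].
    rewrite inE => /andP[A0 A1]; have mA := moP _ A0.
    have [Y YC [tY tY']] := P0P _ A0; have [X XC [tX _]] := Q1P _ A1.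
    have Am : #|A| <= m.
      rewrite -[leqRHS](card_ord_lt (ltnW mn)) -tY'.
      by apply/subset_leq_card/subsetP => x; rewrite !inE => /andP[].
    have := card_trace_tail m.+1 X; have := card_trace_tail m.+1 Y.
    rewrite tX tY (cC _ XC) (cC _ YC) cardsU1 mA => cY cX.
    have tail : #|[set x in Y | m.+1 <= x]| <= n - m.+1.
      have := cardsC [set x : 'I_n | x < m.+1]; rewrite card_ord_lt // card_ord => e.
      rewrite -[in leqRHS]e addKn; apply/subset_leq_card/subsetP => x.
      by rewrite !inE -leqNgt => /andP[].
    have mn' : m < n := mn; move: mn' Am cY cX tail; clear; rewrite /= => *; split; lia.
  rewrite -(@card_in_imset _ _ f); last first.
    move=> A B Ai Bi [fA _]; have [Ar _ _] := cell _ Ai; have [Br _ _] := cell _ Bi.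
    have cAB : #|A| = #|B|.
      by move: fA; rewrite (insubT (fun i => i < r) Ar) (insubT (fun i => i < r) Br) => -[].
    move: Ai Bi; rewrite !in_setI.
    move=> /andP[A0 A1] /andP[B0 B1].
    have [YA YAC [tYA _]] := P0P _ A0; have [XA XAC [tXA _]] := Q1P _ A1.
    have [YB YBC [tYB _]] := P0P _ B0; have [XB XBC [tXB _]] := Q1P _ B1.
    have sC X Y : X \in C -> Y \in C -> sep X Y.
      by move=> XC; move/forall_inP/(_ X XC)/forall_inP: sepC; apply.
    apply/eqP; rewrite eqEcard cAB leqnn andbT; apply/subsetPn => -[p pA pB].
    have /subsetPn[q qB qA] : ~~ (B \subset A).
      apply/negP => BA; have /eqP E : B == A by rewrite eqEcard BA cAB leqnn.
      by rewrite E pA in pB.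
    have := branch_order (m := mo) (cC _ XAC) (cC _ YBC) (sC _ _ XAC YBC) tXA tYB
      (moP _ A0) (moP _ B0) cAB pA pB qB qA.
    have := branch_order (m := mo) (cC _ XBC) (cC _ YAC) (sC _ _ XBC YAC) tXB tYA
      (moP _ B0) (moP _ A0) (esym cAB) qB qA pA pB.
    by move=> l1 l2; have := ltn_trans l1 l2; rewrite ltnn.
  apply: leq_trans (leq_imset_card (fun c : 'I_r * 'I_(n - r) => (Some c.1, Some c.2)) _).
  apply/subset_leq_card/subsetP => _ /imsetP[A Ai ->]; have [Ar Am Anr] := cell _ Ai.
  apply/imsetP; exists (Ordinal Ar, Ordinal Anr); first by rewrite inE /= subnKC.
  by rewrite /f !insubT.
have trn X : trace n X = X by apply/setP => x; rewrite inE ltn_ord andbT.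
have := bound n (leqnn n).
have -> : trace n @: C = C.
  by rewrite -[RHS]imset_id; apply: eq_imset.
move/leq_trans; apply; rewrite ltnS; apply: leq_trans (max_card _) _.
by rewrite card_prod !card_ord.
Qed.

Lemma sum_leq_eq (I : finType) (F G : I -> nat) :
  (forall i, F i <= G i) -> \sum_i G i <= \sum_i F i -> forall i, F i = G i.
Proof.
move=> FG GF i; apply/eqP; rewrite eqn_leq FG /=; move: GF.
rewrite (bigD1 i) //= [X in _ <= X](bigD1 i) //= => GF.
have le : \sum_(j | j != i) F j <= \sum_(j | j != i) G j by exact: leq_sum.
by rewrite -(leq_add2r (\sum_(j | j != i) F j)) (leq_trans _ GF) // leq_add2l.
Qed.

Section Total.

Variable D : {set {set 'I_n}}.
Hypothesis n_gt0 : 0 < n.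
Hypothesis maxsepD : maxset (@separated_system n) D.

Lemma total_sep : {in D &, forall V W, sep V W}.
Proof.
move=> V W VD WD; have /maxsetp := maxsepD.
by move/forall_inP/(_ V VD)/forall_inP/(_ W WD).
Qed.

Lemma total_max X : {in D, forall V, sep V X} -> X \in D.
Proof.
move=> DX; have /maxsetP[_ /(_ (X |: D))] := maxsepD => <-; rewrite ?setU11 //.
  apply/forall_inP => V; rewrite in_setU1 => VX; apply/forall_inP => W.
  rewrite in_setU1 => WX; case/orP: VX => [/eqP->|VD]; case/orP: WX => [/eqP->|WD].
  - exact: sepxx.
  - by rewrite sepC DX.
  - exact: DX.
  exact: total_sep.
exact: subsetUr.
Qed.

Lemma small_shattered (A : {set 'I_n}) : #|A| <= 3 -> A \in shattered D.
Proof.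
move=> A3; apply/shatteredP; have [n3|n3] := leqP n 3.
  (* On at most three positions nothing crosses, so D contains every set. *)
  exists set0; apply/shattersP; split=> [|B _].
    by rewrite disjoints_subset sub0set.
  apply: total_max => V _; rewrite (sepE (Ordinal n_gt0)); apply/negP.
  case/cross_aroundP=> s [x1 [x2 [x3 [x4 [/and3P[l1 l2 l3] _]]]]].
  have := cyc_pos_lt (Ordinal n_gt0) x4; move: l1 l2 l3 n3; rewrite /cyc_lt; clear; lia.
have [|U AU U3] := superset_card A3; first by rewrite card_ord ltnW.
have [a [b [e [ab ae be UE]]]] : exists a b e, [/\ a != b, a != e, b != e & U = [set a; b; e]].
  have /card_gt2P[a [b [e [[aU bU eU] [ab be ea]]]]] : 2 < #|U| by rewrite U3.
  exists a, b, e; rewrite eq_sym in ea; split=> //; apply/esym/eqP.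
  rewrite eqEcard !subUset !sub1set aU bU eU U3 setUC cardsU1 cards2 ab !inE.
  by rewrite negb_or (eq_sym e a) ea (eq_sym e b) be.
have [K HK] := shatters_triple total_sep total_max ab ae be.
exists (K :|: set0); rewrite UE in AU.
exact: sub_shatters HK AU (sub0set _).
Qed.

Lemma total_card : \sum_(r < n.+1) (r * (n - r)).+1 <= #|D|.
Proof.
apply: leq_trans (shattered_card D); rewrite -sum_levels.
apply: (@leq_trans #|[set A in [set: {set 'I_n}] | #|A| < 4]|).
  rewrite -sum_card_levels; apply: leq_sum => i _; rewrite -[n in 'C(n, _)]card_ord -card_draws.
  by apply/subset_leq_card/subsetP => A; rewrite !inE.
by apply/subset_leq_card/subsetP => A; rewrite inE => /andP[_ A3]; exact: small_shattered.
Qed.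

Lemma total_level r : r <= n -> #|[set V in D | #|V| == r]| = (r * (n - r)).+1.
Proof.
rewrite -ltnS => rn.
pose F (i : 'I_n.+1) := #|[set V in D | #|V| == i :> nat]|.
pose G (i : 'I_n.+1) := (i * (n - i)).+1.
suff : forall i, F i = G i by move=> /(_ (Ordinal rn)).
apply: sum_leq_eq => [i|].
  apply: level_bound => [|X]; last by rewrite inE => /andP[_ /eqP].
  apply/forall_inP => V; rewrite inE => /andP[VD _]; apply/forall_inP => W.
  by rewrite inE => /andP[WD _]; exact: total_sep.
apply: leq_trans total_card _; rewrite sum_card_levels.
apply/subset_leq_card/subsetP => V VD; rewrite inE VD ltnS.
by rewrite -[leqRHS](card_ord n) max_card.
Qed.

End Total.

(** Maximality among r-sets makes C the full level r of any maximal extension D. *)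
Theorem grassmann_pure r C : 0 < n -> r <= n -> {in C, forall X, #|X| = r} ->
  separated_system C ->
  (forall X, #|X| = r -> {in C, forall V, sep V X} -> X \in C) ->
  #|C| = (r * (n - r)).+1.
Proof.
move=> n0 rn cC sC maxC; have [D mD CD] := maxset_exists sC.
rewrite -(total_level n0 mD rn); apply: eq_card => X; rewrite inE; apply/idP/andP.
  by move=> XC; rewrite (subsetP CD) // cC.
case=> XD /eqP cX; apply: maxC => // V VC; apply: (total_sep mD) => //.
exact: (subsetP CD).
Qed.

End Levels.

(** * Necklaces *)

Section CyclicStep.

Variable n : nat.
Implicit Types (i j x y : 'I_n).

Lemma cyc_pos_ordS j x :
  cyc_pos (ordS j) x = if x == j then n.-1 else (cyc_pos j x).-1.
Proof.
have xn := ltn_ord x; have jn := ltn_ord j; rewrite !cyc_posE /= -val_eqE /=.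
have [jn1|jn1] := leqP n j.+1.
  have -> : j.+1 = n by lia.
  rewrite modnn leq0n subn0; case: eqP => xj; first by lia.
  by case: (leqP j x); lia.
rewrite modn_small //; case: eqP => xj; first by case: ifP; lia.
by case: (leqP j x); case: (leqP j.+1 x); lia.
Qed.

Lemma cyc_pos_ordSS j x : x != j -> cyc_pos j x = (cyc_pos (ordS j) x).+1.
Proof.
move=> xj; rewrite cyc_pos_ordS (negPf xj) prednK // lt0n.
by apply: contra xj => /eqP; rewrite -(cyc_posxx j) => /cyc_pos_inj ->.
Qed.

Lemma cyc_pos_ordS_last j : cyc_pos (ordS j) j = n.-1.
Proof. by rewrite cyc_pos_ordS eqxx. Qed.

Lemma cyc_lt_ordS j x y : x != j -> y != j -> cyc_lt (ordS j) x y = cyc_lt j x y.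
Proof. by move=> xj yj; rewrite /cyc_lt (cyc_pos_ordSS xj) (cyc_pos_ordSS yj) ltnS. Qed.

Lemma cyc_lt_first j x : x != j -> cyc_lt j j x.
Proof. by move=> /cyc_pos_ordSS; rewrite /cyc_lt cyc_posxx => ->. Qed.

Lemma cyc_lt_last j x : cyc_lt (ordS j) j x = false.
Proof.
rewrite /cyc_lt cyc_pos_ordS_last; apply/negbTE; rewrite -leqNgt -ltnS.
by rewrite prednK ?cyc_pos_lt // (leq_trans _ (ltn_ord j)).
Qed.

Lemma cyc_pos_iter j t : t < n -> cyc_pos j (iter t (@ordS n) j) = t.
Proof.
elim: t => [|t IH] tn; first by rewrite cyc_posxx.
have {IH} pt := IH (ltnW tn); rewrite iterS; set k := iter t _ j in pt *.
have := cyc_pos_rebase j k (ordS k); rewrite pt.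
have -> : cyc_pos k (ordS k) = 1.
  rewrite cyc_pos_ordSS ?cyc_posxx //; apply/negP => /eqP kk.
  have := cyc_pos_ordS_last k; rewrite kk cyc_posxx; move: tn; clear; lia.
have := cyc_pos_lt j (ordS k); move: tn; clear; lia.
Qed.

Lemma iter_ordS_pos j k : iter (cyc_pos j k) (@ordS n) j = k.
Proof. by apply: (@cyc_pos_inj n j); rewrite cyc_pos_iter // cyc_pos_lt. Qed.

Lemma cyc_ind (P : 'I_n -> Prop) j0 :
  P j0 -> (forall j, P j -> P (ordS j)) -> forall j, P j.
Proof.
move=> P0 PS j; rewrite -(iter_ordS_pos j0 j).
by elim: (cyc_pos j0 j) => //= t; exact: PS.
Qed.

End CyclicStep.

Section NecklaceBasics.

Variables n r : nat.
Implicit Types (N : necklace n r) (i j k x y : 'I_n) (X Y : {set 'I_n}).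

Lemma sep_atP i X Y :
  reflect (forall x y, x \in X -> x \notin Y -> y \in Y -> y \notin X -> cyc_lt i x y)
          (sep_at i X Y).
Proof.
apply: (iffP forall_inP) => [H x y xX xY yY yX|H x].
  have xXY : x \in X :\: Y by rewrite inE xX xY.
  have yYX : y \in Y :\: X by rewrite inE yX yY.
  by move/(_ x xXY)/forall_inP/(_ y yYX): H.
by rewrite inE => /andP[xY xX]; apply/forall_inP => y; rewrite inE => /andP[yX yY]; exact: H.
Qed.

Lemma neck_notin_next N i x : (x \in N i) -> (x \notin N (ordS i)) -> x = i.
Proof.
move=> xi xS; apply/eqP; apply: contraNT xS => xne.
by apply: (subsetP (neck_step N i)); rewrite !inE xne.
Qed.

(** An element x can be discarded only on the step after N_x. *)
Lemma neck_leave N j k x : x \in N j -> x \notin N k -> cyc_pos j x < cyc_pos j k.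
Proof.
rewrite -{1}(iter_ordS_pos j k); have := cyc_pos_lt j k.
elim: (cyc_pos j k) => [|t IH] tn xj /=; first by rewrite xj.
have [xt xS|xt _] := boolP (x \in N (iter t (@ordS n) j)).
  by rewrite (neck_notin_next xt xS) cyc_pos_iter // ltnW.
by apply: ltnW; rewrite ltnS IH // ltnW.
Qed.

(** Elements of N_j outside N_k are discarded between j and k, those of N_k outside N_j between k
    and j. *)
Lemma neck_sep N j k : sep_at j (N j) (N k).
Proof.
apply/sep_atP => x y xj xk yk yj.
have := neck_leave xj xk; have := neck_leave yk yj.
have := cyc_pos_rebase j k y; have := cyc_pos_rebase j k j; rewrite cyc_posxx /cyc_lt.
clear; lia.
Qed.

Lemma IntP N X :
  reflect (#|X| = r /\ forall i, sep_at i (N i) X) (X \in Int N).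
Proof.
by rewrite inE; apply: (iffP andP) => -[/eqP cX /forallP H].
Qed.

Lemma SepP N X : reflect (#|X| = r /\ forall i, sep X (N i)) (X \in Sep N).
Proof.
by rewrite inE; apply: (iffP andP) => -[/eqP cX /forallP H].
Qed.

Lemma neck_Int N k : N k \in Int N.
Proof. by apply/IntP; split=> [|j]; [exact: neck_card|exact: neck_sep]. Qed.

Lemma sep_at_sep i X Y : sep_at i X Y -> sep X Y.
Proof. by move=> s; apply/existsP; exists i. Qed.

Lemma Int_sep_neck N X i : X \in Int N -> sep X (N i).
Proof. by case/IntP=> _ H; rewrite sepC; exact: sep_at_sep (H i). Qed.

Lemma neck_next_out N i : neck_next N i \notin N i :\ i.
Proof.
apply/negP => kN; have := neck_cardS N i (ordS i).
rewrite neck_nextE (setUidPr _) ?sub1set // => /eqP.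
by rewrite eqn_leq ltnn andbF.
Qed.

Lemma neck_next_eq N i x : N (ordS i) = x |: (N i :\ i) -> neck_next N i = x.
Proof.
by move=> E; have [y [_ U]] := neck_next_uniq N i; rewrite -(U _ (neck_nextE N i)) (U _ E).
Qed.

End NecklaceBasics.

(** * Enlarging the interior by exchanging two consecutive values of the permutation *)

Section Expansion.

Variables (n r : nat) (N : necklace n r) (p : 'I_n).

Let i := ordS p.
Let u := neck_next N i.
Let v := neck_next N p.
Let M := N p :\ p.
Let H := u |: M.

Hypotheses (ui : u != i) (uv : cyc_lt i u v).

Lemma exp_Np : N p = p |: M.
Proof. by rewrite setD1K // neck_mem. Qed.

Lemma exp_Ni : N i = v |: M.
Proof. exact: neck_nextE. Qed.

Lemma exp_facts : [/\ p != i, u != v, v != i & u != p] /\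
  [/\ v \notin M, u \notin M, i \in M & p \notin M].
Proof.
have u_v : u != v by apply: contraTneq uv => ->; rewrite cyc_ltxx.
have p_i : p != i by apply: contraNneq u_v => E; rewrite /u /v -E.
have v_i : v != i by apply: contraTneq uv => ->; rewrite /cyc_lt cyc_posxx.
have u_p : u != p by apply: contraTneq uv => ->; rewrite cyc_lt_last.
have uN : u \notin N i.
  by have := neck_next_out N i; rewrite !inE ui.
split; split=> //.
- exact: neck_next_out.
- by apply: contra uN => uM; rewrite exp_Ni inE uM orbT.
- by have := neck_mem N i; rewrite exp_Ni !in_setU1 eq_sym (negPf v_i).
by rewrite !inE eqxx.
Qed.

Lemma exp_NSi : N (ordS i) = u |: ((v |: M) :\ i).
Proof. by rewrite -exp_Ni; exact: neck_nextE. Qed.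

Lemma exp_cardH : #|H| = r.
Proof.
have [_ [_ uM _ _]] := exp_facts.
by rewrite cardsU1 uM add1n /M -(neck_cardS N p p) neck_card.
Qed.

(** From N_p to N_(i+1) the elements v and u enter one after the other; only the set in the middle
    changes when u enters first. *)
Definition expand_set j := if j == i then H else N j.

Lemma expand_card j : #|expand_set j| = r.
Proof.
by rewrite /expand_set; case: eqP => _; [exact: exp_cardH|exact: neck_card].
Qed.

Lemma expand_step j : expand_set j :\ j \subset expand_set (ordS j).
Proof.
have [[p_i u_v v_i u_p] [vM uM iM pM]] := exp_facts.
rewrite /expand_set; have [->|ji] := eqVneq j i.
  have -> : (ordS i == i) = false.
    apply/negbTE; apply: contra p_i => /eqP E; apply/eqP.
    by apply: (@ordS_inj n); rewrite -/i E.
  rewrite exp_NSi; apply/subsetP => x; rewrite !(in_setD1, in_setU1).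
  by case/andP=> -> /orP[->//|->]; rewrite !orbT.
have [E|Sji] := eqVneq (ordS j) i; last exact: neck_step.
by have -> : j = p; [exact: (@ordS_inj n) | exact: subsetUr].
Qed.

Lemma expand_mem j : j \in expand_set j.
Proof.
have [_ [_ _ iM _]] := exp_facts.
rewrite /expand_set; case: eqP => [->|_]; last exact: neck_mem.
by rewrite !in_setU1 iM orbT.
Qed.

Definition expand : necklace n r := Necklace expand_card expand_step expand_mem.

Lemma expand_next j : neck_next expand j = neck_next N (tperm p i j).
Proof.
have [[p_i u_v v_i u_p] [vM uM iM pM]] := exp_facts.
have Si : (ordS i == i) = false.
  apply/negbTE; apply: contra p_i => /eqP E; apply/eqP.
  by apply: (@ordS_inj n); rewrite -/i E.
apply: neck_next_eq; case: tpermP => [->|->|/eqP jp /eqP ji] /=; rewrite /expand_set.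
- by rewrite -/i eqxx (negPf p_i).
- rewrite Si eqxx exp_NSi -/v; apply/setP => x; rewrite !in_setU1 !in_setD1 !in_setU1.
  have [->|//] := eqVneq x i; last by rewrite orbCA.
  by rewrite (eq_sym i u) (negPf ui) (eq_sym i v) (negPf v_i).
have -> : (ordS j == i) = false.
  by apply/negbTE; apply: contra jp => /eqP E; apply/eqP/(@ordS_inj n).
by rewrite (negPf ji); exact: neck_nextE.
Qed.

Lemma expand_Int X : X \in Int N -> X \in Int expand.
Proof.
have [[p_i u_v v_i u_p] [vM uM iM pM]] := exp_facts.
case/IntP=> cX XN; apply/IntP; split=> // j; rewrite /= /expand_set.
case: eqP => [->|_]; last exact: XN.
have Xp := sep_atP _ _ _ (XN p); have XSi := sep_atP _ _ _ (XN (ordS i)).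
apply/sep_atP => z x; rewrite in_setU1 => zH zX xX.
rewrite in_setU1 negb_or => /andP[xu xM].
have x_i : x != i by apply: contraNneq xM => ->.
case/orP: zH => [/eqP zu|zM].
  rewrite zu; have [->|xv] := eqVneq x v; first exact: uv.
  rewrite -(cyc_lt_ordS ui x_i); apply: XSi; rewrite -?zu //.
    by rewrite zu exp_NSi setU11.
  by rewrite exp_NSi !in_setU1 in_setD1 in_setU1 (negPf xu) (negPf xv) (negPf xM) andbF.
have z_p : z != p by apply: contraNneq pM => <-.
have [xp|x_p] := eqVneq x p.
  by have := cyc_lt_total i z_p; rewrite xp cyc_lt_last orbF.
rewrite (cyc_lt_ordS z_p x_p); apply: Xp => //; rewrite exp_Np in_setU1 ?zM ?orbT //.
by rewrite (negPf x_p).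
Qed.

Lemma expand_not_Int : H \notin Int N.
Proof.
have [[p_i u_v v_i u_p] [vM uM iM pM]] := exp_facts.
apply/negP => /IntP[_ /(_ i)/sep_atP/(_ v u)].
rewrite exp_Ni !in_setU1 !eqxx (negPf vM) (negPf uM) !orbF (eq_sym v u) (negPf u_v).
by move=> /(_ isT isT isT isT); move: uv; rewrite /cyc_lt; clear; lia.
Qed.

(** The conditions at p and i + 1 and the one for H leave v, u as the only pair that can violate the
    condition for N_i. If it does and X is not H, then m in M outside X and x in X outside H make m,
    u, v, x alternate. *)
Lemma expand_Int_Sep X : X \in Int expand -> sep X (N i) -> X \in Int N \/ X = H.
Proof.
have [[p_i u_v v_i u_p] [vM uM iM pM]] := exp_facts.
have Si : (ordS i == i) = false.
  apply/negbTE; apply: contra p_i => /eqP E; apply/eqP.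
  by apply: (@ordS_inj n); rewrite -/i E.
case/IntP=> cX XE sXi.
have XN j : j != i -> sep_at j (N j) X.
  by move=> ji; have := XE j; rewrite /= /expand_set (negPf ji).
have XH : sep_at i H X by have := XE i; rewrite /= /expand_set eqxx.
have XNI : sep_at i (N i) X -> X \in Int N.
  by move=> s; apply/IntP; split=> // j; have [->|/XN] := eqVneq j i.
have [/XNI|nsep] := boolP (sep_at i (N i) X); [by left | right].
have XSi : sep_at (ordS i) (N (ordS i)) X by apply: XN; rewrite Si.
have Xp : sep_at p (N p) X by exact: XN.
have bad z x : z \in N i -> z \notin X -> x \in X -> x \notin N i -> cyc_lt i x z ->
    z = v /\ x = u.
  rewrite exp_Ni !in_setU1 negb_or => zN zX xX /andP[xv xM] xz.
  have x_i : x != i by apply: contraNneq xM => ->.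
  case/orP: zN => [/eqP zv|zM].
    split=> //; apply/eqP; apply: contraTT xz => xu; rewrite zv in zX *.
    have : cyc_lt (ordS i) v x.
      apply: (sep_atP _ _ _ XSi) => //; rewrite exp_NSi !in_setU1 in_setD1 in_setU1.
        by rewrite v_i eqxx orbT.
      by rewrite (negPf xu) (negPf xv) (negPf xM) andbF.
    by rewrite (cyc_lt_ordS v_i x_i) /cyc_lt -leqNgt => /ltnW.
  have nz : cyc_lt i z x -> False.
    by move: xz; rewrite /cyc_lt; clear; lia.
  exfalso; apply: nz; have [xu|xu] := eqVneq x u.
    have x_p : x != p by rewrite xu.
    have z_p : z != p by apply: contraNneq pM => <-.
    rewrite (cyc_lt_ordS z_p x_p); apply: (sep_atP _ _ _ Xp) => //.
      by rewrite exp_Np in_setU1 zM orbT.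
    by rewrite exp_Np in_setU1 (negPf x_p).
  apply: (sep_atP _ _ _ XH) => //; rewrite in_setU1 ?zM ?orbT //.
  by rewrite (negPf xu).
have [vX uX] : v \notin X /\ u \in X.
  move: nsep; rewrite negb_forall => /existsP[z]; rewrite negb_imply inE => /andP[/andP[zX zN]].
  rewrite negb_forall => /existsP[x]; rewrite negb_imply inE => /andP[/andP[xN xX]] xz.
  have zx : z != x by apply: contraNneq zX => ->.
  have xz' : cyc_lt i x z by move: (pos_neq i zx) xz; rewrite /cyc_lt; clear; lia.
  by have [<- <-] := bad z x zN zX xX xN xz'.
apply/eqP; rewrite eq_sym eqEcard cX exp_cardH leqnn andbT.
rewrite subUset sub1set uX; apply/subsetPn => -[m mM mX].
have [x xX xH] : exists2 x, x \in X & x \notin H.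
  apply/subsetPn; apply: contra mX => XsubH.
  have /eqP -> : X == H.
    by rewrite eqEcard XsubH cX exp_cardH leqnn.
  by rewrite in_setU1 mM orbT.
move: (xH); rewrite in_setU1 negb_or => /andP[xu xM].
have xv : x != v by apply: contraNneq vX => <-.
have xN : x \notin N i by rewrite exp_Ni in_setU1 negb_or xv.
have uN : u \notin N i by rewrite exp_Ni in_setU1 negb_or u_v.
have mN : m \in N i by rewrite exp_Ni in_setU1 mM orbT.
have vN : v \in N i by rewrite exp_Ni setU11.
have mu : cyc_lt i m u.
  have mu : m != u by apply: contraNneq uM => <-.
  have := cyc_lt_total i mu; case/orP=> // um.
  by have [mv _] := bad m u mN mX uX uN um; rewrite -mv mM in vM.
have vx : cyc_lt i v x.
  have vx : v != x by rewrite eq_sym.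
  have := cyc_lt_total i vx; case/orP=> // xv'.
  by have [_ /eqP] := bad v x vN vX xX xN xv'; rewrite (negPf xu).
rewrite sepC in sXi.
apply: (sep_alternates (b := i) (x1 := m) (x2 := u) (x3 := v) (x4 := x) (s := true) sXi).
split; first by rewrite mu uv vx.
by split; apply/eqP; rewrite sdiffP /= inE ?mN ?uN ?vN ?xN ?mX ?uX ?vX ?xX.
Qed.

End Expansion.

(** * Alignments under an exchange *)

Section Alignments.

Variable n : nat.
Implicit Types (s : 'I_n -> 'I_n) (a b x y : 'I_n).

Definition aligned a x y b := [&& cyc_lt a a x, cyc_lt a x y & cyc_le a y b].

(** Indexing by preimages lets an exchange of values act as a transposition of the indices. *)
Lemma card_alignments (s : {perm 'I_n}) :
  #|alignments s| = #|[set ab : 'I_n * 'I_n | aligned ab.1 (s ab.1) (s ab.2) ab.2]|.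
Proof.
pose f ab : 'I_n * 'I_n := (s ab.1, s ab.2).
have f_inj : injective f by move=> [a b] [a' b'] [/perm_inj-> /perm_inj->].
rewrite -(card_preimset (alignments s) f_inj); apply: eq_card => -[a b].
by rewrite !inE /= !permK.
Qed.

End Alignments.

Section ExpandAlignments.

Variables (n r : nat) (N : necklace n r) (p : 'I_n).

Let i := ordS p.

Hypotheses (ui : neck_next N i != i) (uv : cyc_lt i (neck_next N i) (neck_next N p)).

(** The transposition of p and i matches all alignments except the one with preimages i, p, which is
    lost: after the exchange, u and v would have to lie between p and its successor i. *)
Lemma card_expand_alignments :
  #|alignments (neck_perm N)| = #|alignments (neck_perm (expand ui uv))|.+1.
Proof.
have [[p_i u_v v_i u_p] _] := exp_facts ui uv; rewrite -/i in p_i v_i.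
set u := neck_next N i in u_v u_p; set v := neck_next N p in u_v v_i.
rewrite !card_alignments; set A := [set ab | _]; set A' := [set ab | _].
pose t (ab : 'I_n * 'I_n) := (tperm p i ab.1, tperm p i ab.2).
have t_inj : injective t by move=> [a b] [a' b'] [/perm_inj-> /perm_inj->].
have tA' a b : ((a, b) \in t @^-1: A') =
    aligned (tperm p i a) (neck_next N a) (neck_next N b) (tperm p i b).
  by rewrite !inE /= !(permE (@neck_next_inj _ _ _)) !expand_next !tpermK.
(* Counted from p instead of i = p + 1, positions grow by one, except that p passes from last to
   first. *)
have shift z : (z = p /\ (cyc_pos i z = n.-1 /\ cyc_pos p z = 0)) \/
               (z != p /\ cyc_pos p z = (cyc_pos i z).+1).
  have [->|zp] := eqVneq z p; [left|right].
    by rewrite cyc_pos_ordS_last cyc_posxx.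
  by split=> //; exact: cyc_pos_ordSS.
have lt_n z := cyc_pos_lt p z.
have vi0 : cyc_pos i v != 0 by rewrite -(cyc_posxx i) pos_neq.
have uv' : cyc_pos i u < cyc_pos i v := uv.
have ui0 : cyc_pos i u != 0 by rewrite -(cyc_posxx i) pos_neq.
have next a : a != i -> cyc_pos a i = (cyc_pos a p).+1.
  move=> ai; have := cyc_pos_rebase a p i; have := cyc_pos_lt a i; have := cyc_pos_lt a p.
  have := pos_neq a p_i; have := pos_neq a ai; rewrite cyc_posxx.
  have : cyc_pos p i = 1 by rewrite cyc_pos_ordSS 1?eq_sym // cyc_posxx.
  clear; lia.
have AE : A = (i, p) |: t @^-1: A'.
  apply/setP => -[a b]; rewrite in_setU1 tA' inE /= !(permE (@neck_next_inj _ _ _)) xpair_eqE.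
  case: (tpermP p i a) => [->|->|/eqP ap /eqP ai];
    case: (tpermP p i b) => [->|->|/eqP bp /eqP bi];
    rewrite ?eqxx ?(negPf p_i) ?(negPf ap) ?(negPf ai) /= -/u -/v ?andbF /=.
  - by rewrite /aligned !cyc_ltxx !andbF.
  - rewrite /aligned /cyc_lt /cyc_le cyc_posxx.
    move: (shift i) (shift u) (shift v) (lt_n v) uv'; rewrite !cyc_posxx; clear; lia.
  - set y := neck_next N b; rewrite /aligned /cyc_lt /cyc_le !cyc_posxx.
    move: (shift v) (shift y) (shift b) (lt_n v) (lt_n y) (lt_n b) vi0 bp; clear.
    by case=> [[-> [-> ->]]|[_ ->]]; case=> [[-> [-> ->]]|[_ ->]];
      case=> [[-> [-> ->]]|[_ ->]]; rewrite ?eqxx //; lia.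
  - rewrite /aligned /cyc_lt /cyc_le cyc_posxx uv'.
    move: (cyc_pos_lt i v) ui0; rewrite cyc_pos_ordS_last; clear; lia.
  - by rewrite ?(eq_sym i p) ?(negPf p_i) /aligned !cyc_ltxx !andbF.
  - set y := neck_next N b; rewrite /aligned /cyc_lt /cyc_le !cyc_posxx (negPf bp) /=.
    move: (shift u) (shift y) (shift b) (lt_n u) (lt_n y) (lt_n b) ui0 bp u_p; clear.
    by case=> [[-> [-> ->]]|[_ ->]]; case=> [[-> [-> ->]]|[_ ->]];
      case=> [[-> [-> ->]]|[_ ->]]; rewrite ?eqxx //; lia.
  - rewrite /aligned /cyc_le (next _ ai).
    by move: (pos_neq a v_i); rewrite (next _ ai); clear; lia.
  - rewrite /aligned /cyc_le (next _ ai).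
    by move: (pos_neq a ui); rewrite -/i -/u (next _ ai); clear; lia.
  by [].
rewrite AE cardsU1 card_preimset // (_ : _ \notin _ = true) //.
rewrite tA' tpermL tpermR -/u -/v /aligned /cyc_lt /cyc_le cyc_posxx.
move: (shift i) (shift u) (shift v) (lt_n v) uv'; rewrite !cyc_posxx; clear; lia.
Qed.

End ExpandAlignments.

(** * Necklaces that admit no exchange *)

Section Terminal.

Variables (n r : nat) (N : necklace n r).
Hypothesis stuck : forall p, neck_next N (ordS p) != ordS p ->
  ~~ cyc_lt (ordS p) (neck_next N (ordS p)) (neck_next N p).

(** Length of the jump from j to its image; a fixed point counts as a full turn. *)
Let delta j := if neck_next N j == j then n else cyc_pos j (neck_next N j).

Lemma delta_mono p : delta p <= delta (ordS p).
Proof.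
have dn j : delta j <= n by rewrite /delta; case: eqP => // _; exact/ltnW/cyc_pos_lt.
rewrite [leqRHS]/delta; case: eqP => [_|/eqP ui]; first exact: dn.
have := stuck ui; set i := ordS p in ui *; rewrite /cyc_lt -leqNgt => vu.
have [ip|pi] := eqVneq p i; first by rewrite /delta; rewrite -ip in ui *; rewrite (negPf ui).
have uv : neck_next N i != neck_next N p.
  by apply: contra pi => /eqP /neck_next_inj ->.
have := pos_neq i uv; rewrite neq_ltn ltnNge vu /= => {}vu.
have vp : neck_next N p != p.
  apply: contraTneq vu => ->; rewrite cyc_pos_ordS_last -leqNgt -ltnS.
  by rewrite prednK ?cyc_pos_lt // (leq_trans _ (ltn_ord p)).
by rewrite /delta (negPf vp) cyc_pos_ordSS.
Qed.

(** A function that never decreases around a circle is constant. *)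
Lemma delta_const j k : delta j = delta k.
Proof.
have le j' k' : delta j' <= delta k'.
  apply: (@cyc_ind _ (fun x => delta j' <= delta x) j') => // x.
  by move/leq_trans; apply; exact: delta_mono.
by apply/eqP; rewrite eqn_leq !le.
Qed.

Lemma stuck_alignments : #|alignments (neck_perm N)| = 0.
Proof.
rewrite card_alignments; apply/eqP; rewrite cards_eq0; apply/eqP/setP => -[a b].
rewrite !inE /= !permE /aligned; apply/negbTE/negP; rewrite /cyc_lt /cyc_le cyc_posxx.
have := delta_const a b; rewrite /delta.
case: eqP => [->|_]; first by rewrite cyc_posxx.
case: eqP => [_ an|_ ab]; first by have := cyc_pos_lt a (neck_next N a); rewrite an ltnn.
have := cyc_pos_rebase a b (neck_next N b); have := cyc_pos_lt a b.
have := cyc_pos_lt b (neck_next N b); rewrite -ab; clear; lia.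
Qed.

(** All sets of the necklace are thus cyclic intervals of one length starting at their index, so the
    condition of the interior holds for every r-set. *)
Lemma stuck_mem j0 i x : (x \in N i) = (cyc_pos i x < delta j0).
Proof.
move: {2}(cyc_pos i x) (erefl (cyc_pos i x)) => k; elim: k i x => [|k IH] i x ix.
  have -> : x = i by apply: (@cyc_pos_inj n i); rewrite ix cyc_posxx.
  rewrite neck_mem cyc_posxx (delta_const j0 i) /delta; case: eqP => [_|/eqP ii].
    by rewrite (leq_trans _ (ltn_ord i)).
  by rewrite lt0n -(cyc_posxx i) pos_neq.
have xi : x != i by apply: contraTneq isT => xi; move: ix; rewrite xi cyc_posxx.
have kS : cyc_pos (ordS i) x = k.
  by have := cyc_pos_ordSS xi; rewrite ix => -[].
have := IH _ _ kS; rewrite neck_nextE in_setU1 in_setD1 xi /= kS ix (delta_const j0 i).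
have := neck_next_out N i; have := cyc_pos_lt i x; rewrite ix /delta.
have [<-|xs] := eqVneq x (neck_next N i).
  rewrite (negPf xi) in_setD1 xi /= ix => _ /negPf -> _.
  by rewrite ltnn.
move=> kn _ /= ->; case: eqP => [_|_]; first by rewrite kn ltnW.
have := pos_neq i xs; rewrite ix; clear; lia.
Qed.

Lemma stuck_Int (X : {set 'I_n}) : #|X| = r -> X \in Int N.
Proof.
move=> cX; apply/IntP; split=> // i; apply/sep_atP => x y.
by rewrite !(stuck_mem i) /cyc_lt -leqNgt => xd _ _ dy; exact: leq_trans xd dy.
Qed.

End Terminal.

Lemma separatedP n (C : {set {set 'I_n}}) :
  reflect {in C &, forall X Y, sep X Y} (separated_system C).
Proof.
apply: (iffP forall_inP) => [H X Y XC YC|H X XC]; first exact: (forall_inP (H X XC)).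
by apply/forall_inP => Y YC; exact: H.
Qed.

Lemma max_separatedP n (D C : {set {set 'I_n}}) : 0 < n ->
  reflect [/\ C \subset D, {in C &, forall X Y, sep X Y} &
              forall X, X \in D -> {in C, forall V, sep V X} -> X \in C]
          (max_separated D C).
Proof.
move=> n0; apply: (iffP maxsetP) => [[/andP[CD /separatedP sC] mC]|[CD sC mC]].
  split=> // X XD XC; rewrite -(mC (X |: C)) ?setU11 ?subsetUr // subUset sub1set XD CD.
  apply/separatedP => V W; rewrite !in_setU1.
  case/orP=> [/eqP->|VC] /orP[/eqP->|WC].
  - exact: sepxx.
  - by rewrite sepC XC.
  - exact: XC.
  exact: sC.
split=> [|B /andP[BD /separatedP sB] CB]; first by rewrite CD; apply/separatedP.
apply/eqP; rewrite eqEsubset CB andbT; apply/subsetP => X XB.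
by apply: mC => [|V /(subsetP CB) VB]; [exact: (subsetP BD)|exact: sB].
Qed.

Theorem Int_card n r (N : necklace n r) B : 0 < n -> max_separated (Int N) B ->
  #|B| + #|alignments (neck_perm N)| = (r * (n - r)).+1.
Proof.
move=> n0; have [k] := ubnP #|alignments (neck_perm N)|.
elim: k N B => // k IH N B Nk mB.
have rn : r <= n by rewrite -(neck_card N (Ordinal n0)) -[leqRHS](card_ord n) max_card.
have [BI sB mxB] := max_separatedP _ _ n0 mB.
have [/existsP[p /andP[ui uv]]|none] := boolP [exists p,
    (neck_next N (ordS p) != ordS p) &&
    cyc_lt (ordS p) (neck_next N (ordS p)) (neck_next N p)]; last first.
  have stuck p : neck_next N (ordS p) != ordS p ->
      ~~ cyc_lt (ordS p) (neck_next N (ordS p)) (neck_next N p).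
    by move=> ui; apply: contra none => uv; apply/existsP; exists p; rewrite ui.
  rewrite (stuck_alignments stuck) addn0; apply: grassmann_pure => //.
  - by move=> X /(subsetP BI)/IntP[].
  - exact/separatedP.
  by move=> X cX; apply: mxB; exact: stuck_Int.
have ce := card_expand_alignments ui uv; set N' := expand ui uv in ce.
set H := neck_next N (ordS p) |: (N p :\ p).
have HN' : N' (ordS p) = H by rewrite /= /expand_set eqxx.
have HI : H \in Int N' by rewrite -HN'; exact: neck_Int.
have HnB : H \notin B by apply: contra (expand_not_Int ui uv); exact: (subsetP BI).
have sH X : X \in Int N -> sep X H.
  by move=> XN; rewrite -HN'; apply: Int_sep_neck; exact: expand_Int.
have NB j : N j \in B.
  apply: mxB => [|V VB]; first exact: neck_Int.
  by apply: Int_sep_neck; exact: (subsetP BI).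
have := IH N' (H |: B); rewrite cardsU1 HnB ce addnS => <-.
- by rewrite add1n addSn.
- by rewrite -ltnS -ce.
apply/max_separatedP => //; split.
- rewrite subUset sub1set HI; apply/subsetP => X /(subsetP BI); exact: expand_Int.
- move=> X Y; rewrite !in_setU1 => /orP[/eqP->|XB] /orP[/eqP->|YB].
  + exact: sepxx.
  + by rewrite sepC; apply: sH; exact: (subsetP BI).
  + by apply: sH; exact: (subsetP BI).
  exact: sB.
(* X is separated from N_(p+1), a member of B, so [expand_Int_Sep] leaves only H as a possible new
   element. *)
move=> X XI sX; rewrite in_setU1.
have [|XN|->] := expand_Int_Sep (N := N) (p := p) XI; last by rewrite eqxx.
  by rewrite sepC; apply: sX; rewrite in_setU1 NB orbT.
by rewrite mxB ?orbT // => V VB; apply: sX; rewrite in_setU1 VB orbT.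
Qed.

(** * The interior is separated from the exterior *)

Definition triple := (bool * bool * bool)%type.

(** Codes up to 3 are those of the words without a minus before a plus, which encodes [sep_at]. All
    others are merged into the dead state. *)
Definition gstep (s : option bool) (c : nat) : nat :=
  let c' := astep s c in if c' <= 3 then c' else 7.

(** Greedy subsequence search: the state counts the predicates already met, and the default [xpred0]
    makes the final state stable. *)
Definition seek (ps : seq (pred triple)) (t : triple) (c : nat) : nat :=
  if nth xpred0 ps c t then c.+1 else c.

Definition in_first (t : triple) := t.1.1 && ~~ t.2.
Definition in_last (t : triple) := t.2 && ~~ t.1.1.
Definition in_mid (t : triple) := t.1.2 && ~~ t.2.
Definition out_mid (t : triple) := t.2 && ~~ t.1.2.

(* For letters (x in N, x in X, x in Y), these recognize, from right to left,
   the words containing elements of Y \ X, X \ Y, Y \ N, N \ Y in this order,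
   resp. of Y \ N, N \ Y, Y \ X, X \ Y in this order. *)
Definition seekL := seek [:: in_first; in_last; in_mid; out_mid].
Definition seekR := seek [:: in_mid; out_mid; in_first; in_last].

Definition signX (t : triple) := sdiff t.1.1 t.1.2.
Definition signY (t : triple) := sdiff t.1.1 t.2.
Definition signXY (t : triple) := sdiff t.1.2 t.2.

(** Capped at 2 to stay finite. Comparing the tallies of both signs is how the equal cardinalities
    of N_j, X and Y enter the check. *)
Definition tally (s : bool) (f : triple -> option bool) (t : triple) (c : nat) : nat :=
  if f t == Some s then minn 2 c.+1 else c.

(** An invariant meant to pass from j to j + 1. The pattern of [seekL] has an element of Y \ N_j
    before one of N_j \ Y, so it excludes [sep_at] for N_j and Y. Code 5 means plus, minus, plus. *)
Definition obstructed (l r c : nat) : bool := (l == 4) && ((r != 4) || (c == 5)).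

(* A letter [(m, t)] with t = (x in N_j, x in X, x in Y): the word runs through
   j, j+1, ..., j-1 and ends with j again.  The first j has m = 1 and is read
   for N_j only, the last one has m = 4 and is read for N_{j+1} only; m = 2
   marks the element entering N_{j+1}. *)
Definition here (l : nat * triple) : triple :=
  if l.1 == 1 then (true, l.2.1.2, l.2.2)
  else if l.1 == 2 then (false, l.2.1.2, l.2.2) else l.2.

Definition there (l : nat * triple) : triple :=
  if l.1 == 2 then (true, l.2.1.2, l.2.2) else l.2.

Definition encode (t : triple) : nat := 4 * t.1.1 + 2 * t.1.2 + t.2.
Definition decode (a : nat) : triple := (4 <= a, odd a./2, odd a).

Lemma encodeK : cancel encode decode.
Proof. by case=> [[[] []] []]. Qed.

Lemma encode_lt t : encode t < 8.
Proof. by case: t => [[[] []] []]. Qed.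

(** Actions below 8 encode triples; action 8 stands for the skipped occurrence of j. *)
Definition lift (skip : nat) (read : nat * triple -> triple) (G : triple -> nat -> nat) :=
  Component (fun l : nat * triple => if l.1 == skip then 8 else encode (read l))
            (fun a c => if a < 8 then G (decode a) c else c) 7.

Lemma lift_exec skip read G l c :
  exec (lift skip read G) (act (lift skip read G) l) c =
  if l.1 == skip then c else G (read l) c.
Proof.
have lt := encode_lt (read l); have eK := encodeK (read l).
by rewrite /lift /act /exec; case: (l.1 == skip); rewrite ?lt ?eK.
Qed.

(* Forces both occurrences of j to agree, and exactly one element to enter N_{j+1}
   (j itself when its last occurrence belongs to N_{j+1}). *)
Definition turn_stage : component (nat * triple) :=
  Component (fun l : nat * triple => let q := 2 * l.2.1.2 + l.2.2 in
    match l.1 with 0 => 0 | 1 => 1 + q | 2 => 5 | _ => 6 + 4 * l.2.1.1 + q end)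
    (fun a c => if a == 0 then (if 0 < c <= 8 then c else 10)
      else if a <= 4 then (if c == 4 + a then 9 else 10)
      else if a == 5 then (if 0 < c <= 4 then c + 4 else 10)
      else if c == 0 then a - 5 else 10) 10.

Definition gX t := gstep (signX t).
Definition nY t := astep (signY t).

Definition turn_guards : seq (component (nat * triple)) :=
  [:: turn_stage; lift 4 here gX; lift 1 there gX; lift 4 here nY; lift 1 there nY].

Definition turn_tracks : seq (component (nat * triple)) :=
  [:: lift 4 here (fun t => astep (signXY t));
      lift 4 here seekL; lift 4 here seekR; lift 1 there seekL; lift 1 there seekR;
      lift 4 here (tally true signX); lift 4 here (tally false signX);
      lift 4 here (tally true signY); lift 4 here (tally false signY)].

Definition turn_letters : seq (nat * triple) :=
  [seq (m, b) | m <- [:: 0; 1; 2; 4],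
    b <- [seq (b, k) | b <- [seq (v, v') | v <- [:: true; false], v' <- [:: true; false]],
          k <- [:: true; false]]].

(** Entries 0 to 4 are the guards, with the codes of N_j and N_(j+1) against Y at 3 and 4. Entry 5
    compares X with Y, 6 to 9 are the searches and 10 to 13 the tallies. Only complete words with X
    and Y crossing and matching tallies are constrained. *)
Definition turn_fin (s : seq nat) : bool :=
  let: (c, c') := (nth 0 s 3, nth 0 s 4) in
  let: (l, r) := (nth 0 s 6, nth 0 s 7) in
  let: (l', r') := (nth 0 s 8, nth 0 s 9) in
  [&& nth 0 s 0 == 9, nth 0 s 5 == 7, nth 0 s 10 == nth 0 s 11 & nth 0 s 12 == nth 0 s 13] ==>
  [&& obstructed l r c ==> ~~ (c <= 3),
      (c <= 3) ==> (c' <= 3) || obstructed l' r' c' &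
      obstructed l r c ==> obstructed l' r' c'].

Lemma turn_verified : verify turn_letters turn_guards turn_tracks turn_fin.
Proof. vm_cast_no_check (erefl true). Qed.

Lemma turn_guards_absorbing :
  all (fun c => all (fun l => exec c (act c l) (dead c) == dead c) turn_letters) turn_guards.
Proof. by vm_compute. Qed.

Lemma foldr_gstep (T : Type) (f : T -> option bool) s :
  foldr (fun x => gstep (f x)) 0 s =
  let c := code [seq f x | x <- s] in if c <= 3 then c else 7.
Proof.
elim: s => //= x s ->; have := code_le7 [seq f x | x <- s].
by rewrite /gstep; move: (code _) => c; case: (f x) => [[]|]; do 8!case: c => [//|c].
Qed.

Lemma foldr_tally (T : Type) (g : T -> triple) b f s :
  foldr (fun x => tally b f (g x)) 0 s = minn 2 (count (fun x => f (g x) == Some b) s).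
Proof.
elim: s => //= x s ->; rewrite /tally; case: eqP => _ /=; last by rewrite add0n.
by move: (count _ _) => k; clear; lia.
Qed.

Lemma sep_at_code n (b : 'I_n) (X Y : {set 'I_n}) :
  sep_at b X Y = (code [seq sdiff (x \in X) (x \in Y) | x <- around b] <= 3).
Proof.
set f := fun x => _; set c := code _.
have -> : (c <= 3) = ~~ subseq [:: Some false; Some true] [seq f x | x <- around b].
  rewrite (@subseq_alternating false 2) // -/c.
  by have := code_le7 [seq f x | x <- around b]; rewrite -/c; do 8!case: c => [//|c].
apply/sep_atP/negP => [H ss|H x y xX xY yY yX].
  have [m _ em] := subseqP ss; move: em; rewrite -map_mask.
  have := subseq_sorted (@cyc_lt_trans n b) (mask_subseq m (around b)) (around_sorted b).
  case: (mask m _) => [|y [|x [|? ?]]] //= /andP[yx _] [/esym/eqP ey /esym/eqP ex].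
  move: ey ex; rewrite !sdiffP !inE => /andP[yX yY] /andP[xY xX].
  have := H x y xX xY yY yX; move: yx; rewrite /cyc_lt; clear; lia.
apply: contraT => nxy; case: H.
have -> : [:: Some false; Some true] = [seq f z | z <- [:: y; x]].
  by rewrite /= /f /sdiff (negPf yX) (negPf xY) xX yY.
apply: map_subseq; rewrite -(@around_filter n b [:: y; x]) ?filter_subseq //= andbT.
have xy : x != y by apply: contraNneq xY => ->.
by have := cyc_lt_total b xy; rewrite (negPf nxy).
Qed.

Lemma around_ordS n (j : 'I_n) : exists rest,
  [/\ around j = j :: rest, around (ordS j) = rcons rest j & j \notin rest].
Proof.
exists [seq x <- around j | x != j]; split; last by rewrite mem_filter eqxx.
- apply: (irr_sorted_eq (@cyc_lt_trans n j) (@cyc_ltxx n j) (around_sorted j)).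
    rewrite /= path_sortedE; last exact: cyc_lt_trans.
    rewrite (sorted_filter (@cyc_lt_trans n j)) ?around_sorted // andbT.
    by apply/allP => x; rewrite mem_filter => /andP[xj _]; exact: cyc_lt_first.
  by move=> x; rewrite inE mem_filter !mem_around andbT orbN.
apply: (irr_sorted_eq (@cyc_lt_trans n _) (@cyc_ltxx n _) (around_sorted _)).
  rewrite sorted_pairwise; last exact: cyc_lt_trans.
  rewrite pairwise_rcons -sorted_pairwise; last exact: cyc_lt_trans.
  apply/andP; split.
    apply/allP => x; rewrite mem_filter => /andP[xj _].
    by have := cyc_lt_total (ordS j) xj; rewrite cyc_lt_last orbF.
  rewrite (@eq_in_sorted _ [pred x | x != j] _ (cyc_lt j)) ?filter_all //.
    exact: (sorted_filter (@cyc_lt_trans n j)) (around_sorted j).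
  by move=> x y xj yj; exact: cyc_lt_ordS.
by move=> x; rewrite mem_rcons inE mem_filter !mem_around andbT orbN.
Qed.

Lemma count_around n (b : 'I_n) (A : {set 'I_n}) : count (fun x => x \in A) (around b) = #|A|.
Proof.
have /seq.permP-> : perm_eq (around b) (enum 'I_n) by rewrite perm_sort.
by rewrite -sum1_card -sum1_count big_enum_cond.
Qed.

Section Start.

Variables (n r : nat) (N : necklace n r) (Y : {set 'I_n}).
Hypothesis YS : Y \in Sep N.

Let witness j y z := [/\ y \in Y, y \notin N j, z \in N j, z \notin Y & cyc_lt j y z].

(* The last witness against j moves towards j as j advances, and cannot reach it. *)
Lemma start_bound k j :
  (forall y z, witness j y z -> cyc_pos j y < k) -> exists i, sep_at i (N i) Y.
Proof.
have [cY YN] := SepP _ _ YS.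
elim: k j => [|k IH] j H.
  exists j; apply/sep_atP => z y zN zY yY yN.
  have zy : z != y by apply: contraNneq zY => ->.
  by case/orP: (cyc_lt_total j zy) => // yz; have := H y z (And5 yY yN zN zY yz).
have [|/sep_atP nsep] := boolP (sep_at j (N j) Y); first by exists j.
have [i si|none] := pickP (fun i => sep_at i (N i) Y); first by exists i.
have [y [z [yY yN zN zY yz]]] : exists y z, witness j y z.
  have [[y z] /and5P[yY yN zN zY yz]|noyz] := pickP (fun yz : 'I_n * 'I_n =>
      [&& yz.1 \in Y, yz.1 \notin N j, yz.2 \in N j, yz.2 \notin Y & cyc_lt j yz.1 yz.2]).
    by exists y, z.
  case: nsep => z y zN zY yY yN.
  have zy : z != y by apply: contraNneq zY => ->.
  case/orP: (cyc_lt_total j zy) => // yz.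
  by have := noyz (y, z); rewrite /= yY yN zN zY yz.
apply: (IH (ordS j)) => y' z' [yY' yN' zN' zY' yz'].
have yj' : y' != j by apply: contraTneq yz' => ->; rewrite cyc_lt_last.
have yNj' : y' \notin N j.
  by apply: contra yj' => yj; apply/eqP; exact: neck_notin_next yN'.
rewrite -ltnS -cyc_pos_ordSS // ltnNge; apply/negP => far.
have nw x : witness j y' x -> False by move=> /H; rewrite ltnNge far.
have yy' : cyc_pos j y < cyc_pos j y'.
  by apply: leq_trans far; apply: (H y z).
have zy' : cyc_lt j z y'.
  have zy' : z != y' by apply: contraNneq zY => ->.
  by case/orP: (cyc_lt_total j zy') => // y'z; case: (nw z).
have zj : z != j by apply: contraTneq yz => ->; rewrite /cyc_lt cyc_posxx.
have sdif b j' x : (if b then x \in N j' else x \in Y) ->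
    (if b then x \notin Y else x \notin N j') ->
    sdiff (x \in N j') (x \in Y) = Some b.
  by case: b => h1 h2; apply/eqP; rewrite sdiffP inE h1 h2.
have [zj'|zj'] := eqVneq z' j.
  have yj : y != j by apply: contraNneq yN => ->; exact: neck_mem.
  apply: (sep_alternates (b := j) (x1 := j) (x2 := y) (x3 := z) (x4 := y') (s := true)
    (X := N j) (Y := Y)); first by rewrite sepC.
  split; first by rewrite cyc_lt_first // yz zy'.
  by split; apply: sdif => //=; [exact: neck_mem|rewrite -zj'].
have zNj' : z' \notin N j.
  by apply/negP => zNj; apply: (nw z'); split=> //; rewrite -cyc_lt_ordS.
have zE : z' = neck_next N j.
  by apply/eqP; move: zN'; rewrite neck_nextE in_setU1 in_setD1 (negPf zNj') andbF orbF.
apply: (sep_alternates (b := j) (x1 := y) (x2 := z) (x3 := y') (x4 := z') (s := false)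
    (X := N (ordS j)) (Y := Y)); first by rewrite sepC.
split; first by rewrite yz zy' -cyc_lt_ordS.
split; apply: sdif => //=.
- rewrite neck_nextE in_setU1 in_setD1 (negPf yN) andbF orbF -zE.
  by apply: contraNneq zY' => <-.
- by rewrite neck_nextE in_setU1 in_setD1 zj zN orbT.
Qed.

Lemma exists_start : 0 < n -> exists i, sep_at i (N i) Y.
Proof.
move=> n0; apply: (@start_bound n (Ordinal n0)) => y z _; exact: cyc_pos_lt.
Qed.

End Start.

(** * Propagation around the circle for a crossing pair *)

Section Turn.

Variables (n r : nat) (N : necklace n r) (X Y : {set 'I_n}).

Hypotheses (XI : X \in Int N) (YS : Y \in Sep N) (crossXY : ~~ sep X Y).

Let T j x : triple := (x \in N j, x \in X, x \in Y).
Let val G j := foldr (fun x => G (T j x)) 0 (around j).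
Let codeY j := code [seq sdiff (x \in N j) (x \in Y) | x <- around j].
Let bad j := obstructed (val seekL j) (val seekR j) (codeY j).

Lemma turn_step j :
  [/\ bad j -> ~~ (codeY j <= 3), codeY j <= 3 -> (codeY (ordS j) <= 3) || bad (ordS j) &
      bad j -> bad (ordS j)].
Proof.
have [rest [aj aSj jrest]] := around_ordS j.
set w := neck_next N j.
pose f x : nat * triple := (if x == w then 2 else 0, T j x).
pose l4 : nat * triple := (4, T (ordS j) j).
pose word := (1, T j j) :: [seq f x | x <- rest] ++ [:: l4].
have urest : uniq rest by have := around_uniq j; rewrite aj => /andP[].
have wN : w != j -> w \notin N j.
  by move=> wj; have := neck_next_out N j; rewrite !inE wj.
have hereE x : x \in rest -> here (f x) = T j x.
  move=> xr; rewrite /here /f /=; have [xw|//] := eqVneq x w.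
  rewrite /= /T xw (negPf (wN _)) //; apply: contraNneq jrest => <-.
  by rewrite -xw.
have thereE x : x \in rest -> there (f x) = T (ordS j) x.
  move=> xr; have xj : x != j by apply: contraNneq jrest => <-.
  rewrite /there /f /= /T neck_nextE in_setU1 -/w !inE xj /=.
  by have [->|//] := eqVneq x w.
have f4 x : ((f x).1 == 4) = false by rewrite /f /=; case: ifP.
have f1 x : ((f x).1 == 1) = false by rewrite /f /=; case: ifP.
have feed_here G : feed (lift 4 here G) word = val G j.
  rewrite /feed /word /val aj; set F := fun l => _.
  have FE l c : F l c = if l.1 == 4 then c else G (here l) c by exact: lift_exec.
  rewrite [LHS]/= FE; congr (G _ _).
    by rewrite /here /T /= neck_mem.
  rewrite foldr_cat /= FE /=.
  elim: (rest) hereE => //= x s IH H; rewrite FE f4 H ?mem_head // IH // => y ys.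
  by apply: H; rewrite inE ys orbT.
have feed_there G : feed (lift 1 there G) word = val G (ordS j).
  rewrite /feed /word /val aSj; set F := fun l => _.
  have FE l c : F l c = if l.1 == 1 then c else G (there l) c by exact: lift_exec.
  rewrite [LHS]/= FE /= foldr_cat foldr_rcons /= FE /=.
  elim: (rest) thereE => //= x s IH H; rewrite FE f1 H ?mem_head // IH // => y ys.
  by apply: H; rewrite inE ys orbT.
have stg : feed turn_stage word = 9.
  pose q := 2 * (j \in X) + (j \in Y).
  have q3 : q <= 3 by rewrite /q; case: (j \in X); case: (j \in Y).
  have fixE : (j \in N (ordS j)) = (w == j) by rewrite neck_nextE !inE eqxx orbF eq_sym.
  suff H s : uniq s -> j \notin s -> feed turn_stage ([seq f x | x <- s] ++ [:: l4]) =
      (1 + q + 4 * ((w \in s) || (w == j)))%N.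
    have := H rest urest jrest; rewrite /feed /word [in X in _ -> X]/=.
    have -> : (w \in rest) || (w == j).
      by have := mem_around j w; rewrite aj inE orbC.
    rewrite muln1 => ->; rewrite /T /= -/q.
    by case: (q) q3 => [|[|[|[|?]]]].
  elim: s => [|x s IH] /=.
    move=> _ _; rewrite /feed /= /T fixE -/q.
    by case: (w == j); case: (q) q3 => [|[|[|[|?]]]].
  move=> /andP[xs us]; rewrite inE negb_or => /andP[jx js].
  have := IH us js; rewrite /feed /= => ->; rewrite inE (eq_sym w x).
  have [xw|_] /= := eqVneq x w; last first.
    by case: (_ || _); case: (q) q3 => [|[|[|[|?]]]].
  have -> : (w == j) = false by rewrite -xw eq_sym; exact: negPf.
  have -> : (w \in s) = false by rewrite -xw; exact: negPf.
  by case: (q) q3 => [|[|[|[|?]]]].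
have wL : all (mem turn_letters) word.
  have mL m t : m \in [:: 0; 1; 2; 4] -> (m, t) \in turn_letters.
    move=> mm; apply/allpairsP; exists (m, t); split=> //=.
    by case: t => [[[] []] []].
  rewrite /word -cat1s !all_cat !all_seq1.
  apply/and3P; split; [exact: mL| |exact: mL].
  apply/allP => _ /mapP[x _ ->].
  by rewrite /f /=; case: ifP => _; exact: mL.
clearbody word.
have [cX XN] := IntP _ _ XI; have [cY YN] := SepP _ _ YS.
have gXE k : val gX k != 7.
  rewrite /val (foldr_gstep (fun x => signX (T k x))) /=.
  by have := XN k; rewrite sep_at_code => sk; rewrite sk; apply: contraTneq sk => ->.
have nYE k : val nY k = codeY k.
  rewrite /val /codeY; elim: (around k) => //= x s ->.
  by rewrite /nY; congr (astep _ _).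
have nY7 k : codeY k != 7.
  by have := YN k; rewrite sepC (sepE k).
have al : alive turn_guards word.
  by rewrite /alive /= stg !feed_here !feed_there !gXE !nYE !nY7.
have := verifyP turn_guards_absorbing turn_verified wL al.
have tallyE b F (Z : {set 'I_n}) : #|Z| = r ->
    (forall x, F (T j x) = sdiff (x \in N j) (x \in Z)) ->
    val (tally b F) j = minn 2 #|N j :\: Z|.
  move=> cZ FZ; rewrite /val foldr_tally; congr (minn 2 _).
  have -> : #|N j :\: Z| = #|if b then N j :\: Z else Z :\: N j|.
    case: b => //; apply/eqP; rewrite -(eqn_add2l #|N j :&: Z|) cardsID neck_card.
    by rewrite setIC cardsID cZ.
  rewrite -(count_around j); apply: eq_count => x.
  by rewrite FZ sdiffP; case: b.
rewrite /turn_fin /run /= stg !feed_here !feed_there !nYE.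
rewrite (tallyE true _ X) // (tallyE false _ X) // (tallyE true _ Y) // (tallyE false _ Y) //.
have -> : val (fun t => astep (signXY t)) j = 7.
  move: crossXY; rewrite (sepE j) negbK => /eqP <-.
  by rewrite /val; elim: (around j) => //= x s ->.
rewrite !eqxx /= -/(bad j) -/(bad (ordS j)) => /and3P[/implyP h1 /implyP h2 /implyP h3].
by split.
Qed.

(** Start from an index j0 where the condition holds. A failure at j1 means that an obstruction
    arose on the way; it would persist around the circle back to j0, where it is excluded. *)
Lemma crossing_Int : 0 < n -> Y \in Int N.
Proof.
move=> n0; have [cY _] := SepP _ _ YS; have [j0 s0] := exists_start YS n0.
apply/IntP; split=> // j1; rewrite sep_at_code -/(codeY j1); apply: contraT => n1.
have b1 : bad j1.
  have : (codeY j1 <= 3) || bad j1; last by rewrite (negPf n1).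
  apply: (@cyc_ind n (fun j => (codeY j <= 3) || bad j) j0).
    by move: s0; rewrite sep_at_code => ->.
  by move=> j; have [_ h2 h3] := turn_step j; case/orP => [/h2//|/h3 ->]; rewrite orbT.
have : bad j0 by apply: (@cyc_ind n bad j1) => // j; have [_ _] := turn_step j.
by have [h1 _ _] := turn_step j0; move/h1; rewrite /codeY -sep_at_code s0.
Qed.

End Turn.

Theorem Int_Out_sep n r (N : necklace n r) X Y :
  0 < n -> X \in Int N -> Y \in Out N -> sep X Y.
Proof.
move=> n0 XI; rewrite in_setD => /andP[YnI YS].
by apply: contraT => nXY; rewrite (crossing_Int XI YS nXY n0) in YnI.
Qed.

(** A maximal B in the interior contains the necklace. So an r-set separated from B and C lies in
    [Sep N], hence in the interior or the exterior, and thus in B or C: their union is maximal among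
    all r-sets. *)
Theorem Out_card n r (N : necklace n r) C :
  0 < n -> max_separated (Out N) C -> #|C| = #|alignments (neck_perm N)|.
Proof.
move=> n0 /(max_separatedP _ _ n0)[CO sC mxC].
have [B mB _] : {B | max_separated (Int N) B & set0 \subset B}.
  apply: maxset_exists; rewrite sub0set /=; apply/separatedP => V W; by rewrite inE.
have [BI sB mxB] := max_separatedP _ _ n0 mB.
have rn : r <= n by rewrite -(neck_card N (Ordinal n0)) -[leqRHS](card_ord n) max_card.
have NB j : N j \in B.
  apply: mxB => [|V VB]; first exact: neck_Int.
  by apply: Int_sep_neck; exact: (subsetP BI).
have disj : B :&: C = set0.
  apply/setP => V; rewrite !inE; apply/negbTE/negP => /andP[/(subsetP BI) VI].
  by move/(subsetP CO); rewrite in_setD VI.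
have BC V W : V \in B -> W \in C -> sep V W.
  by move=> /(subsetP BI) VI /(subsetP CO); exact: Int_Out_sep.
have := @grassmann_pure n r (B :|: C) n0 rn; rewrite cardsU disj cards0 subn0.
rewrite -(Int_card n0 mB) => H; apply/(@addnI #|B|)/H.
- move=> V; rewrite in_setU => /orP[/(subsetP BI)/IntP[]//|/(subsetP CO)].
  by rewrite in_setD => /andP[_ /SepP[]].
- apply/separatedP => V W; rewrite !in_setU => /orP[VB|VC] /orP[WB|WC].
  + exact: sB.
  + exact: BC.
  + by rewrite sepC BC.
  exact: sC.
move=> X cX sX; have sBX V : V \in B -> sep V X by move=> VB; apply: sX; rewrite inE VB.
have XS : X \in Sep N by apply/SepP; split=> // j; rewrite sepC; exact/sBX/NB.
rewrite in_setU; have [XI|XI] := boolP (X \in Int N); first by rewrite mxB.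
rewrite mxC ?orbT // => [|V VC]; first by rewrite in_setD XI XS.
by apply: sX; rewrite inE VC orbT.
Qed.

Theorem proposition3 (n r : nat) (n_ge1 : 1 <= n) (N : necklace n r) :
  pure (Out N) /\ rank (Out N) = #|alignments (neck_perm N)|.
Proof.
have pureO : pure (Out N) by move=> C1 C2 m1 m2; rewrite (Out_card n_ge1 m1) (Out_card n_ge1 m2).
split=> //.
have [C mC _] : {C | max_separated (Out N) C & set0 \subset C}.
  apply: maxset_exists; rewrite sub0set /=; apply/separatedP => V W; by rewrite inE.
by rewrite -(rank_pure pureO mC) (Out_card n_ge1 mC).
Qed.
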